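(* Let $q=2$, $a_k=k^{\alpha}$ and $\sigma_k=k^{\beta}$, $k\in\mathbb N$, with $\alpha>0$, $\beta>0$. All limits are as $\varepsilon\to0$. (a) The sharp asymptotics $$\beta_\varepsilon(r_\varepsilon,\vartheta)=\Phi(H^{(\vartheta)}-u_\varepsilon)+o(1)\quad(\vartheta\in(0,1)),\qquad \gamma_\varepsilon(r_\varepsilon)=2\Phi(-u_\varepsilon/2)+o(1)$$ hold, where $u_\varepsilon=u_\varepsilon(r_\varepsilon)$ is the value of the extreme problem $$u_\varepsilon^2=\frac{1}{2\varepsilon^4}\inf_{\eta\in\Theta_2(r_\varepsilon)}\sum_{k\in\mathbb N}\eta_k^4 ,$$ which satisfies $$u_\varepsilon\sim c_1\,\varepsilon^{-2}\,r_\varepsilon^{(4\alpha+4\beta+1)/(2\alpha)}$$ for a constant $c_1=c_1(\alpha,\beta)>0$. (b) The asymptotically minimax family of tests $\psi_{\varepsilon,H}=\mathbf 1_{\{t_\varepsilon>H\}}$ are determined by the family of test statistics $$t_\varepsilon=\sum_{k\in\mathbb N}w_k\big((y_k/\varepsilon)^2-1\big),\qquad w_k=\frac{\tilde\eta_k^2}{\sqrt{2\sum_{j\in\mathbb N}\tilde\eta_j^4}},\qquad w_0=\sup_{k\in\mathbb N}w_k,$$ where $\{\tilde\eta_k\}_{k\in\mathbb N}$ is the extreme sequence of the extreme problem in (a), given by $$\tilde\eta_k^2=z_0^2\,k^{2\beta}\big(1-(k/m)^{2\alpha}\big)_+,\qquad k\in\mathbb N,$$ with $z_0=z_{0,\varepsilon}$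 and the efficient dimension $m=m_\varepsilon$ determined by $$\sum_{k\in\mathbb N}k^{2\beta}\tilde\eta_k^2=r_\varepsilon^2,\qquad \sum_{k\in\mathbb N}k^{2\alpha+2\beta}\tilde\eta_k^2=1 .$$ (c) The separation rates are of the form $$r_\varepsilon^*=\varepsilon^{4\alpha/(4\alpha+4\beta+1)}.$$
   Context: Model: one observes $y=\{y_k\}_{k\in\mathbb N}$, $y_k=\eta_k+\varepsilon\xi_k$, with $\xi_k$ i.i.d. $N(0,1)$, $\varepsilon>0$ small, $\eta\in\ell^2$ unknown; $E_{\varepsilon,\eta}$ is the corresponding expectation. Sets: $\Theta_2=\{\eta\in\ell^2:\sum_k|a_k\sigma_k\eta_k|^2\le1\}$, $\Theta_2(r)=\{\eta\in\Theta_2:\sum_k\sigma_k^2\eta_k^2\ge r^2\}$. $r_\varepsilon>0$ is a given family with $r_\varepsilon\to0$ as $\varepsilon\to0$. One tests $H_0:\eta=0$ against $H_1:\eta\in\Theta_2(r_\varepsilon)$. Tests and errors: a (randomized) test $\psi$ is a measurable function of $y$ with values in $[0,1]$. $\alpha_\varepsilon(\psi)=E_{\varepsilon,0}\psi$, $\beta_\varepsilon(\Theta,\psi)=\sup_{\eta\in\Theta}E_{\varepsilon,\eta}(1-\psi)$, $\gamma_\varepsilon(\Theta,\psi)=\alpha_\varepsilon(\psi)+\beta_\varepsilon(\Theta,\psi)$. For a level $\vartheta\in(0,1)$, $\beta_\varepsilon(r,\vartheta)=\inf_{\psi:\alpha_\varepsilon(\psi)\le\vartheta}\beta_\varepsilon(\Theta_2(r),\psi)$,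 and $\gamma_\varepsilon(r)=\inf_\psi\gamma_\varepsilon(\Theta_2(r),\psi)$. Asymptotically minimax: a family $\psi_{\varepsilon,\vartheta}$ is asymptotically minimax (first criterion) if $\alpha_\varepsilon(\psi_{\varepsilon,\vartheta})\le\vartheta+o(1)$ and $\beta_\varepsilon(\Theta_2(r_\varepsilon),\psi_{\varepsilon,\vartheta})=\beta_\varepsilon(r_\varepsilon,\vartheta)+o(1)$; a family $\psi_\varepsilon$ is asymptotically minimax (second criterion) if $\gamma_\varepsilon(\Theta_2(r_\varepsilon),\psi_\varepsilon)=\gamma_\varepsilon(r_\varepsilon)+o(1)$. Separation rate: a positive family $r_\varepsilon^*\to0$ such that $\gamma_\varepsilon(r_\varepsilon)\to1$ and $\beta_\varepsilon(r_\varepsilon,\vartheta)\to1-\vartheta$ for any $\vartheta\in(0,1)$ as $r_\varepsilon/r_\varepsilon^*\to0$, while $\gamma_\varepsilon(r_\varepsilon)\to0$ and $\beta_\varepsilon(r_\varepsilon,\vartheta)\to0$ for any $\vartheta\in(0,1)$ as $r_\varepsilon/r_\varepsilon^*\to\infty$. Notation: $(x)_+=\max\{0,x\}$; $\mathbf 1_{\{\cdot\}}$ is the indicator function; $\Phi$ is the standard normal distribution function and $\Phi(H^{(\vartheta)})=1-\vartheta$; $c_\varepsilon\sim d_\varepsilon$ means $c_\varepsilon/d_\varepsilon\to1$. For $r_\varepsilon$ small enough the two equations determining $z_0$ and $m$ (equivalently $z_0$ and $A=m^{-2\alpha}$) have a unique solution. *)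

(* Defs.v *)
From HB Require Import structures.
From mathcomp Require Import all_boot all_order all_algebra finmap.
From mathcomp Require Import all_classical all_reals all_analysis.

Set Implicit Arguments.
Unset Strict Implicit.
Unset Printing Implicit Defensive.

Import Order.TTheory GRing.Theory Num.Theory.
Import numFieldNormedType.Exports.

Local Open Scope classical_set_scope.
Local Open Scope ring_scope.

(* Sequences indexed by the positive integers are functions on nat, the value
   at k : nat being the term of index k.+1.  Families indexed by the noise
   level eps > 0 are functions on R, and limits as eps -> 0 are taken along
   the filter 0^'+, so values at eps <= 0 are irrelevant. *)

Section model.
Context {d : measure_display} {T : measurableType d} {R : realType}.
Variables (P : probability T R) (xi : nat -> {RV P >-> R}).

Definition iid_standard_normal : Prop :=
  (forall (k : nat) (A : set R), measurable A ->
     distribution P (xi k) A = normal_prob 0 1 A) /\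
  (forall (J : {fset nat}) (A : nat -> set R), (forall k, measurable (A k)) ->
     P (\bigcap_(k in [set` J]) (xi k @^-1` A k)) =
     (\prod_(k <- J) P (xi k @^-1` A k))%E).

Definition observation (eps : R) (eta : R^nat) (w : T) : R^nat :=
  fun k => eta k + eps * xi k w.

(* E_{eps, eta} f(y) *)
Definition expect (eps : R) (eta : R^nat) (f : R^nat -> R) : R :=
  fine ('E_P[fun w => f (observation eps eta w)])%E.

End model.

Section tests.
Context {R : realType}.

Definition product_sigma_algebra : set (set (R^nat)) :=
  <<s \bigcup_k preimage_set_system [set: R^nat] (fun y => y k) measurable >>.

(* [0, 1]-valued functions of the observation, i.e. randomized tests *)
Definition is_test (psi : R^nat -> R) : Prop :=
  (forall B : set R, measurable B -> product_sigma_algebra (psi @^-1` B)) /\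
  (forall y, 0 <= psi y <= 1).

Definition Phi (x : R) : R := fine (normal_prob 0 1 `]-oo, x]).

End tests.

Section alternatives.
Context {R : realType}.
Variables a sigma : R^nat.

Definition ell2 : set (R^nat) :=
  [set eta | (\sum_(0 <= k <oo) ((eta k) ^+ 2)%:E < +oo)%E].

Definition Theta2 : set (R^nat) :=
  [set eta | ell2 eta /\
    (\sum_(0 <= k <oo) (`|a k * sigma k * eta k| ^+ 2)%:E <= 1)%E].

Definition Theta2_r (r : R) : set (R^nat) :=
  [set eta | Theta2 eta /\
    ((r ^+ 2)%:E <= \sum_(0 <= k <oo) ((sigma k) ^+ 2 * (eta k) ^+ 2)%:E)%E].

Definition sum_pow4 (eta : R^nat) : \bar R :=
  (\sum_(0 <= k <oo) ((eta k) ^+ 4)%:E)%E.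

Definition extreme_value (eps r : R) : R :=
  Num.sqrt ((2 * eps ^+ 4)^-1 * fine (ereal_inf (sum_pow4 @` Theta2_r r))).

Definition is_extreme_sequence (r : R) (eta : R^nat) : Prop :=
  Theta2_r r eta /\
  (forall eta', Theta2_r r eta' -> (sum_pow4 eta <= sum_pow4 eta')%E).

End alternatives.

Section errors.
Context {d : measure_display} {T : measurableType d} {R : realType}.
Variables (P : probability T R) (xi : nat -> {RV P >-> R}).

Definition alpha_error (eps : R) (psi : R^nat -> R) : R :=
  expect xi eps (fun=> 0) psi.

(* For a test the set below is included in [0, 1], so sup is the usual supremum
   unless Theta is empty (sup set0 = 0).  For the sets Theta2_r a_poly
   sigma_poly r used below, this is excluded as soon as r <= 1. *)
Definition beta_error (eps : R) (Theta : set (R^nat)) (psi : R^nat -> R) : R :=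
  sup [set expect xi eps eta (fun y => 1 - psi y) | eta in Theta].

Definition gamma_error (eps : R) (Theta : set (R^nat)) (psi : R^nat -> R) : R :=
  alpha_error eps psi + beta_error eps Theta psi.

Variables a sigma : R^nat.

Definition beta_minimax (eps r level : R) : R :=
  inf [set beta_error eps (Theta2_r a sigma r) psi | psi in
        [set psi | is_test psi /\ alpha_error eps psi <= level]].

Definition gamma_minimax (eps r : R) : R :=
  inf [set gamma_error eps (Theta2_r a sigma r) psi | psi in is_test].

Definition radius_family (r : R -> R) : Prop :=
  (forall eps, 0 < eps -> 0 < r eps) /\ r eps @[eps --> 0^'+] --> (0 : R).

(* The bound on alpha_error for every delta > 0 is alpha <= level + o(1). *)
Definition asymptotically_minimax_level (r : R -> R) (level : R)
    (psi : R -> R^nat -> R) : Prop :=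
  [/\ \forall eps \near 0^'+, is_test (psi eps),
      forall delta, 0 < delta ->
        \forall eps \near 0^'+, alpha_error eps (psi eps) <= level + delta
    & beta_error eps (Theta2_r a sigma (r eps)) (psi eps)
        - beta_minimax eps (r eps) level @[eps --> 0^'+] --> (0 : R)].

Definition asymptotically_minimax_total (r : R -> R)
    (psi : R -> R^nat -> R) : Prop :=
  (\forall eps \near 0^'+, is_test (psi eps)) /\
  gamma_error eps (Theta2_r a sigma (r eps)) (psi eps)
    - gamma_minimax eps (r eps) @[eps --> 0^'+] --> (0 : R).

Definition is_separation_rate (rstar : R -> R) : Prop :=
  [/\ radius_family rstar,
      forall r, radius_family r ->
        r eps / rstar eps @[eps --> 0^'+] --> (0 : R) ->
        gamma_minimax eps (r eps) @[eps --> 0^'+] --> (1 : R) /\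
        (forall level, 0 < level < 1 ->
          beta_minimax eps (r eps) level @[eps --> 0^'+] --> 1 - level)
    & forall r, radius_family r ->
        r eps / rstar eps @[eps --> 0^'+] --> +oo ->
        gamma_minimax eps (r eps) @[eps --> 0^'+] --> (0 : R) /\
        (forall level, 0 < level < 1 ->
          beta_minimax eps (r eps) level @[eps --> 0^'+] --> (0 : R))].

End errors.

Section polynomial_case.
Context {R : realType}.
Variables alpha beta : R.

Definition idx (k : nat) : R := k.+1%:R.

Definition a_poly : R^nat := fun k => idx k `^ alpha.
Definition sigma_poly : R^nat := fun k => idx k `^ beta.

(* squares of the terms of the extreme sequence *)
Definition eta_tilde2 (z0 m : R) : R^nat := fun k =>
  z0 ^+ 2 * idx k `^ (2 * beta) * Num.max 0 (1 - (idx k / m) `^ (2 * alpha)).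

Definition solves_extreme_system (r z0 m : R) : Prop :=
  [/\ 0 < z0, 0 < m,
      (\sum_(0 <= k <oo) (idx k `^ (2 * beta) * eta_tilde2 z0 m k)%:E
        = (r ^+ 2)%:E)%E
    & (\sum_(0 <= k <oo)
         (idx k `^ (2 * alpha + 2 * beta) * eta_tilde2 z0 m k)%:E = 1)%E].

Definition weights (z0 m : R) : R^nat := fun k =>
  eta_tilde2 z0 m k /
  Num.sqrt (2 * fine (\sum_(0 <= j <oo) ((eta_tilde2 z0 m j) ^+ 2)%:E)%E).

(* Only finitely many weights are nonzero when 0 < m, so that the series
   below is a finite sum. *)
Definition test_statistic (eps z0 m : R) (y : R^nat) : R :=
  limn (series (fun k => weights z0 m k * ((y k / eps) ^+ 2 - 1))).

Definition threshold_test (eps z0 m H : R) : R^nat -> R :=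
  \1_[set y | H < test_statistic eps z0 m y].

End polynomial_case.

(* Main.v *)
(* Under the null, the statistic t is a weighted sum of centred chi-squares with
   sum w_k^2 = 1/2 and uniformly small weights, hence asymptotically standard
   normal by Lindeberg's replacement method.  With x_k = eta~_k^2, complementary slackness gives sum x_k eta_k^2 >= sum x_k^2 for every alternative
   eta, so the mean of t is at least u under every alternative: this yields the
   upper bounds.  For the lower bounds, put independent random signs on the
   extreme sequence.  The likelihood ratio L of the mixture is a product of
   factors cosh(v_k xi_k) exp(-v_k^2/2) with v_k^2 = 2 u w_k, and
   cosh x >= exp(x^2/2 - x^4/12) gives L >= exp(u t - u^2/2 - o(1)).  Since
   beta(psi) + c alpha(psi) >= E min(c, L) for every test psi, taking
   c = exp(u H - u^2/2) reproduces the Neyman-Pearson risk of N(0,1) against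
   N(u,1).  The asymptotics of u come from comparing the power sums that enter
   the two equations for (z_0, m) with integrals. *)
Require Import Defs.
From HB Require Import structures.
From mathcomp Require Import all_boot all_order all_algebra finmap.
From mathcomp Require Import all_classical all_reals all_analysis.
From mathcomp Require Import measurable_realfun ring lra.

Set Implicit Arguments.
Unset Strict Implicit.
Unset Printing Implicit Defensive.

Import Order.TTheory GRing.Theory Num.Theory.
Import numFieldNormedType.Exports.

Local Open Scope classical_set_scope.
Local Open Scope ring_scope.

(** All bounds before the last part are nonasymptotic: for each [delta] there is a bound on the
    weights, hence a radius [r0], that works for all thresholds and alternatives at once. The reason
    is that u is uncontrolled along the family: it may vanish, oscillate or diverge, and in the
    second criterion the threshold u / 2 moves with it, so there is no fixed limit experiment to
    pass to. Upper bounds therefore allow any H <= u / 2 + K. Lower bounds are proved for u <= C,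
    beyond which the Gaussian risk is already below [delta].

    The quantity E min(c, L) is not a probability, whereas the central limit theorem compares
    distribution functions; the truncated exponential is sliced into finitely many layers, each of
    them a tail probability of t. The constants 1/2 and 1/12 are those of ln cosh x = x^2/2 - x^4/12
    + ..., and the quartic term has mean u^2/2, which supplies the -u^2/2 of the Gaussian likelihood
    ratio.

    Small weights come from m -> +oo, and r -> 0 forces this through 1 <= m^(2 alpha) r^2. *)

(** * Standard normal integrals *)

Section density.
Local Open Scope ereal_scope.
Context d (T : measurableType d) (R : realType).
Variables (mu nu : {measure set T -> \bar R}) (g : T -> R).
Hypotheses (mg : measurable_fun [set: T] g) (g0 : forall x, (0 <= g x)%R).
Hypothesis nuE : forall A, measurable A -> nu A = \int[mu]_(x in A) (g x)%:E.

Import HBNNSimple.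

(** [nuE] gives nu on sets only; linearity extends it to simple functions and monotone convergence
    along [nnsfun_approx] to f. *)
Lemma ge0_integral_density (f : T -> \bar R) :
  measurable_fun [set: T] f -> (forall x, 0 <= f x) ->
  \int[nu]_x f x = \int[mu]_x (f x * (g x)%:E).
Proof.
move=> mf f0; pose h := nnsfun_approx measurableT mf.
have mEg : measurable_fun [set: T] (EFin \o g) by exact/measurable_EFinP.
transitivity (lim (\int[nu]_x (EFin \o h n) x @[n --> \oo])).
  have fE x : f x = lim ((EFin \o h n) x @[n --> \oo]).
    by apply/esym/cvg_lim => //; exact: cvg_nnsfun_approx.
  under eq_integral do rewrite fE.
  apply: monotone_convergence => //.
  - by move=> n; exact/measurable_EFinP.
  - by move=> n x _; rewrite lee_fin.
  - by move=> x _ a b ab; rewrite lee_fin; exact/lefP/nd_nnsfun_approx.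
transitivity (lim (\int[mu]_x ((EFin \o h n) x * (g x)%:E) @[n --> \oo])); last first.
  have fE x : f x * (g x)%:E = lim ((EFin \o h n) x * (g x)%:E @[n --> \oo]).
    apply/esym/cvg_lim => //; apply: cvgeZr => //; exact: cvg_nnsfun_approx.
  under [RHS]eq_integral do rewrite fE.
  apply/esym/monotone_convergence => //.
  - by move=> n; apply: emeasurable_funM => //; exact/measurable_EFinP.
  - by move=> n x _; rewrite mule_ge0 ?lee_fin.
  - move=> x _ a b ab; rewrite lee_wpmul2r ?lee_fin//.
    exact/lefP/nd_nnsfun_approx.
apply/congr_lim/funext => n.
transitivity (\sum_(y \in range (h n)) \int[nu]_x (y * \1_(h n @^-1` [set y]) x)%:E).
  rewrite -ge0_integral_fsum//.
  - by apply: eq_integral => t _; rewrite /= fimfunE -fsumEFin.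
  - by move=> y; apply/measurable_EFinP; exact: measurable_funM.
  - by move=> y x _; exact: nnfun_muleindic_ge0.
transitivity (\sum_(y \in range (h n)) \int[mu]_x ((y * \1_(h n @^-1` [set y]) x)%:E * (g x)%:E)); last first.
  rewrite -ge0_integral_fsum//.
  - apply: eq_integral => t _; rewrite /= fimfunE -ge0_mule_fsuml.
      by rewrite fsumEFin.
    by move=> y; exact: nnfun_muleindic_ge0.
  - move=> y; apply: emeasurable_funM => //.
    by apply/measurable_EFinP; exact: measurable_funM.
  - by move=> y x _; rewrite mule_ge0 ?lee_fin// -lee_fin; exact: nnfun_muleindic_ge0.
apply: eq_fsbigr => y /[!inE] -[t _ <-].
have hy0 : (0 <= (h n t)%:E)%E by rewrite lee_fin.
set A := _ @^-1` _.
have mA : measurable A by exact: measurable_sfunP.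
under eq_integral do rewrite EFinM.
rewrite (@ge0_integralZl _ _ _ nu _ measurableT); first last.
  by rewrite lee_fin.
  by move=> x _; rewrite lee_fin.
  exact/measurable_EFinP/measurable_indic.
rewrite integral_indic// setIT nuE//.
under [RHS]eq_integral do rewrite EFinM -muleA.
rewrite (@ge0_integralZl _ _ _ mu _ measurableT); first last.
  by rewrite lee_fin.
  by move=> x _; rewrite mule_ge0// lee_fin.
  apply: emeasurable_funM => //.
  by apply/measurable_EFinP; exact: measurable_indic.
congr (_ * _); rewrite integral_mkcond; apply: eq_integral => x _.
by rewrite patchE indicE; case: ifPn; rewrite ?mul1e ?mul0e.
Qed.

End density.

Section affine.
Context {R : realType}.
Notation mu := (@lebesgue_measure R).
Local Open Scope ereal_scope.

(** The image of Lebesgue measure under x -> a x + b, scaled by a, agrees with Lebesgue measure on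
    half-open intervals, so the two coincide. *)
Lemma lebesgue_affine (a b : R) (f : R -> \bar R) : (0 < a)%R ->
  measurable_fun [set: R] f -> (forall x, 0 <= f x) ->
  \int[mu]_x f x = a%:E * \int[mu]_x f (a * x + b)%R.
Proof.
move=> a0 mf f0.
pose phi := (fun x : R => a * x + b)%R : measurableTypeR R -> measurableTypeR R.
have mphi : measurable_fun [set: measurableTypeR R] phi.
  by apply: measurable_funD => //; exact: measurable_funM.
pose nu := measure_function_pushforward__canonical__measure_function_Measure mu mphi.
have an0 : a != 0%R by rewrite gt_eqF.
transitivity (\int[mscale (NngNum (ltW a0)) nu]_x f x).
  apply: eq_measure_integral => A mA _; rewrite /=.
  apply: lebesgue_measure_unique => // X [[x y]] _ <-.
  rewrite /= /mscale/= /nu/= /pushforward.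
  have -> : phi @^-1` [set` `]x, y]] = [set` `]((x - b) / a)%R, ((y - b) / a)%R]].
    apply/seteqP; split => z /=; rewrite !in_itv/= /phi.
      by rewrite ltr_pdivrMr// ler_pdivlMr// ltrBlDr lerBrDr mulrC.
    by rewrite ltr_pdivrMr// ler_pdivlMr// ltrBlDr lerBrDr mulrC.
  rewrite !lebesgue_measure_itv/= !lte_fin ltr_pM2r ?invr_gt0// ltrBlDr subrK.
  case: ifPn => _; last by rewrite mule0.
  by rewrite -!EFinB -EFinM; congr EFin; field.
rewrite ge0_integral_mscale//=; congr (_ * _).
by rewrite ge0_integral_pushforward.
Qed.

End affine.

Section ge0_integralT.
Local Open Scope ereal_scope.
Context d (T : measurableType d) (R : realType) (mu : {measure set T -> \bar R}).
Implicit Types f g : T -> \bar R.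

Lemma ge0_integralTD f g :
  measurable_fun [set: T] f -> measurable_fun [set: T] g ->
  (forall x, 0 <= f x) -> (forall x, 0 <= g x) ->
  \int[mu]_x (f x + g x) = \int[mu]_x f x + \int[mu]_x g x.
Proof. by move=> mf mg f0 g0; rewrite ge0_integralD. Qed.

Lemma ge0_integralTZl f (k : R) :
  measurable_fun [set: T] f -> (forall x, 0 <= f x) -> (0 <= k)%R ->
  \int[mu]_x (k%:E * f x) = k%:E * \int[mu]_x f x.
Proof. by move=> mf f0 k0; rewrite ge0_integralZl. Qed.

Lemma ge0_le_integralT f g :
  measurable_fun [set: T] f -> measurable_fun [set: T] g ->
  (forall x, 0 <= f x) -> (forall x, f x <= g x) ->
  \int[mu]_x f x <= \int[mu]_x g x.
Proof.
by move=> mf mg f0 fg; apply: ge0_le_integral.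
Qed.

End ge0_integralT.

Lemma integral_probability_cst d (T : measurableType d) (R : realType)
  (P : probability T R) (k : \bar R) : (\int[P]_x k = k)%E.
Proof. by rewrite integral_cst//= probability_setT mule1. Qed.

(** The identity carries [normal_prob 0 1] from [measurableTypeR R] to the canonical measurable
    structure of [R]. *)
Definition std_normal (R : realType) : probability R R :=
  let id_mfun : {mfun measurableTypeR R >-> R} :=
    HB.pack idfun (isMeasurableFun.Build _ _ (measurableTypeR R) R idfun
                     (@measurable_id _ R [set: R])) in
  distribution (normal_prob 0 1) id_mfun.

Lemma std_normalE (R : realType) (A : set R) :
  std_normal R A = normal_prob 0 1 A.
Proof. by []. Qed.

Section std_normal.
Context {R : realType}.
Notation mu := (@lebesgue_measure R).
Notation N := (std_normal R).
Notation phi := (@normal_pdf R 0 1).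
Implicit Types (f : R -> \bar R) (x y v s t : R).

Lemma std_normal_pdfE x : phi x = normal_peak 1 * expR (- (x ^+ 2 / 2)).
Proof.
rewrite normal_pdfE ?oner_neq0// /normal_fun subr0 mulNr.
by rewrite expr1n.
Qed.

Lemma measurable_std_normal_pdf : measurable_fun [set: R] (EFin \o phi).
Proof. apply/measurable_EFinP; exact: measurable_normal_pdf. Qed.

Local Open Scope ereal_scope.

Lemma ge0_integral_std_normal f : measurable_fun [set: R] f ->
  (forall x, 0 <= f x) -> \int[N]_x f x = \int[mu]_x (f x * (phi x)%:E).
Proof.
move=> mf f0; rewrite ge0_integral_pushforward//.
apply: ge0_integral_density => //.
- exact: measurable_normal_pdf.
- by move=> x; exact: normal_pdf_ge0.
Qed.

(** The exponential is the likelihood ratio of N(v, 1) against N(0, 1). *)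
Lemma ge0_integral_std_normal_shift f v : measurable_fun [set: R] f ->
  (forall x, 0 <= f x) ->
  \int[N]_x f (x + v)%R = \int[N]_x (f x * (expR (v * x - v ^+ 2 / 2))%:E).
Proof.
move=> mf f0.
have mfv : measurable_fun [set: R] (fun x => f (x + v)%R).
  by apply: measurableT_comp => //; exact: measurable_funD.
have me : measurable_fun [set: R] (fun x => expR (v * x - v ^+ 2 / 2)).
  by apply: measurableT_comp => //; exact: measurable_funB.
have mfe : measurable_fun [set: R] (fun x => f x * (expR (v * x - v ^+ 2 / 2))%:E).
  by apply: emeasurable_funM => //; exact/measurable_EFinP.
have fe0 x : 0 <= f x * (expR (v * x - v ^+ 2 / 2))%:E.
  by rewrite mule_ge0// lee_fin expR_ge0.
have mphi := measurable_std_normal_pdf.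
rewrite !ge0_integral_std_normal//.
rewrite [RHS](lebesgue_affine v ltr01)//; last 2 first.
- exact: emeasurable_funM.
- by move=> x; rewrite mule_ge0// lee_fin normal_pdf_ge0.
rewrite mul1e; apply: eq_integral => x _; rewrite mul1r -muleA -EFinM.
congr (_ * _%:E); rewrite !std_normal_pdfE mulrCA -expRD; congr (_ * expR _)%R.
by field.
Qed.

(** Completing the square in y splits the product of densities into phi (z / w) and a Gaussian
    density in y, whose integral [lebesgue_affine] evaluates. *)
Lemma std_normal_conv s t (z : R) : (0 < s)%R ->
  let w := Num.sqrt (s ^+ 2 + t ^+ 2) in
  s^-1%:E * \int[mu]_y ((phi ((z - t * y) / s))%:E * (phi y)%:E) =
  (w^-1 * phi (z / w))%:E.
Proof.
move=> s0 w; have w2 : (w ^+ 2 = s ^+ 2 + t ^+ 2)%R.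
  by rewrite sqr_sqrtr// addr_ge0// sqr_ge0.
have w0 : (0 < w)%R by rewrite sqrtr_gt0 ltr_pwDl ?exprn_gt0// sqr_ge0.
have sn0 : s != 0%R by rewrite gt_eqF.
have wn0 : w != 0%R by rewrite gt_eqF.
have E y : (phi ((z - t * y) / s))%:E * (phi y)%:E =
    (phi (z / w))%:E * (phi (w / s * y + - (t * z / (s * w))))%:E.
  rewrite -!EFinM !std_normal_pdfE; congr EFin.
  rewrite mulrACA [RHS]mulrACA -!expRD; congr (_ * expR _)%R.
  rewrite -!opprD -!mulrDl; congr (- (_ / _))%R.
  have -> : (((z - t * y) / s)^+2 + y ^+ 2 =
    ((z - t * y)^+2 + s ^+ 2 * y ^+ 2) / s ^+ 2)%R by field.
  have -> : ((z / w) ^+ 2 + (w / s * y - t * z / (s * w)) ^+ 2 =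
    (s ^+ 2 * z ^+ 2 + (w ^+ 2 * y - t * z) ^+ 2) / (s ^+ 2 * w ^+ 2))%R by field; rewrite sn0 wn0.
  apply/eqP; rewrite eqr_div ?mulf_neq0 ?expf_neq0//; apply/eqP.
  by rewrite !w2; ring.
under eq_integral do rewrite E.
have mphi := measurable_std_normal_pdf.
have mphi' : measurable_fun [set: R] (fun y => (phi (w / s * y + - (t * z / (s * w))))%:E).
  apply: measurableT_comp mphi _; apply: measurable_funD => //; exact: measurable_funM.
rewrite ge0_integralZl//; [|by move=> y _; rewrite lee_fin normal_pdf_ge0|by rewrite lee_fin normal_pdf_ge0].
have := @lebesgue_affine R (w / s) (- (t * z / (s * w))) (fun x => (phi x)%:E) (divr_gt0 w0 s0) mphi.
rewrite integral_normal_pdf => /(_ (fun x => _)) H.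
have {}H := H (fun x => normal_pdf_ge0 0 1 x).
have -> : \int[mu]_y (phi (w / s * y + - (t * z / (s * w))))%:E = (s / w)%:E.
  rewrite -[LHS]mul1e -(_ : (s / w * (w / s))%:E = 1); last by congr EFin; field; rewrite sn0 wn0.
  by rewrite EFinM -muleA -H mule1.
by rewrite -!EFinM; congr EFin; field; rewrite sn0 wn0.
Qed.

(** After Tonelli the inner integral over y is the convolution computed in [std_normal_conv]. The
    case s = 0 is apart because s x then has no density. *)
Lemma std_normal_stable f s t : (0 <= s)%R -> (0 <= t)%R ->
  measurable_fun [set: R] f -> (forall x, 0 <= f x) ->
  \int[N]_y \int[N]_x f (s * x + t * y)%R =
  \int[N]_x f (Num.sqrt (s ^+ 2 + t ^+ 2) * x)%R.
Proof.
rewrite le_eqVlt => /predU1P[<-|s0] t0 mf f0.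
  under eq_integral do under eq_integral do rewrite mul0r add0r.
  rewrite expr0n/= add0r sqrtr_sqr ger0_norm//; apply: eq_integral => y _.
  by rewrite integral_probability_cst.
set w := Num.sqrt _.
have w0 : (0 < w)%R by rewrite sqrtr_gt0 ltr_pwDl ?exprn_gt0// sqr_ge0.
have sn0 : s != 0%R by rewrite gt_eqF.
have mphi := measurable_std_normal_pdf.
have phi0 x : 0 <= (phi x)%:E by rewrite lee_fin normal_pdf_ge0.
have mlin (a b : R) : measurable_fun [set: R] (fun x => a * x + b)%R.
  by apply: measurable_funD => //; exact: measurable_funM.
have sV0 : (0 < s^-1)%R by rewrite invr_gt0.
have step1 y : \int[N]_x f (s * x + t * y)%R =
    s^-1%:E * \int[mu]_z (f z * (phi ((z - t * y) / s))%:E).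
  rewrite ge0_integral_std_normal//; last by apply: measurableT_comp.
  rewrite (lebesgue_affine (- (t * y / s)) sV0); last 2 first.
  - by apply: emeasurable_funM => //; apply: measurableT_comp.
  - by move=> x; rewrite mule_ge0.
  have e1 (z : R) : (s * (s^-1 * z + - (t * y / s)) + t * y = z)%R by field.
  have e2 (z : R) : (s^-1 * z + - (t * y / s) = (z - t * y) / s)%R by field.
  by under eq_integral do rewrite e1 e2.
under eq_integral do rewrite step1.
pose F (zy : R * R) := f zy.1 * (phi ((zy.1 - t * zy.2) / s))%:E * (phi zy.2)%:E.
have mF : measurable_fun [set: R * R] F.
  apply: emeasurable_funM; last exact: (measurableT_comp mphi measurable_snd).
  apply: emeasurable_funM; first exact: (measurableT_comp mf measurable_fst).
  apply: measurableT_comp mphi _; apply: measurable_funM => //.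
  by apply: measurable_funB => //; apply: measurable_funM.
have F0 zy : 0 <= F zy by rewrite /F !mule_ge0.
have mG y : measurable_fun [set: R] (fun z => f z * (phi ((z - t * y) / s))%:E).
  apply: emeasurable_funM => //; apply: measurableT_comp mphi _.
  by apply: measurable_funM => //; exact: measurable_funB.
have mH : measurable_fun [set: R]
    (fun y => \int[mu]_z (f z * (phi ((z - t * y) / s))%:E)).
  apply: (@measurable_fun_fubini_tonelli_G _ _ _ _ _ mu (fun zy => f zy.1 * (phi ((zy.1 - t * zy.2) / s))%:E)).
    apply: emeasurable_funM; first exact: (measurableT_comp mf measurable_fst).
    apply: measurableT_comp mphi _; apply: measurable_funM => //.
    by apply: measurable_funB => //; apply: measurable_funM.
  by move=> zy; rewrite mule_ge0.
have H0 y : 0 <= \int[mu]_z (f z * (phi ((z - t * y) / s))%:E).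
  by apply: integral_ge0 => z _; rewrite mule_ge0.
rewrite ge0_integralZl//; last by rewrite lee_fin ltW.
rewrite (ge0_integral_std_normal mH)//.
transitivity (s^-1%:E * \int[mu]_y \int[mu]_z F (z, y)).
  congr (_ * _); apply: eq_integral => y _.
  rewrite -ge0_integralZr//=; first exact: mG.
  by move=> z _; rewrite mule_ge0.
rewrite -(@fubini_tonelli _ _ _ _ _ mu mu F)//.
rewrite ge0_integral_std_normal//; last by apply: measurableT_comp => //; exact: measurable_funM.
have wV0 : (0 < w^-1)%R by rewrite invr_gt0.
rewrite [RHS](lebesgue_affine 0 wV0); last 2 first.
- by apply: emeasurable_funM => //; apply: measurableT_comp => //; exact: measurable_funM.
- by move=> x; rewrite mule_ge0.
have mFF := @measurable_fun_fubini_tonelli_F _ _ _ _ _ mu F mF F0.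
rewrite -ge0_integralZl//; last 2 first.
- by move=> z _; exact: integral_ge0.
- by rewrite lee_fin ltW.
have mR : measurable_fun [set: R] (fun x => f (w * (w^-1 * x + 0))%R * (phi (w^-1 * x + 0))%:E).
  apply: emeasurable_funM; last exact: (measurableT_comp mphi).
  apply: (measurableT_comp mf); apply: measurable_funM => //; exact: mlin.
rewrite -ge0_integralZl//; last 2 first.
- by move=> z _; rewrite mule_ge0.
- by rewrite lee_fin ltW.
apply: eq_integral => z _.
transitivity (f z * (w^-1 * phi (z / w))%:E); last first.
  rewrite EFinM muleCA addr0 mulrA divff ?gt_eqF// mul1r; congr (_ * (_ * _%:E)).
  by rewrite mulrC.
rewrite -std_normal_conv// muleCA; congr (_ * _).
rewrite -ge0_integralZl//=.
- by apply: eq_integral => y _; rewrite /F/= muleA.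
- apply: emeasurable_funM => //; apply: measurableT_comp mphi _.
  by apply: measurable_funM => //; apply: measurable_funB => //; apply: measurable_funM.
- by move=> y _; rewrite mule_ge0.
Qed.

End std_normal.

Section improper.
Context {R : realType}.
Notation mu := (@lebesgue_measure R).

(** Dominated convergence reduces to symmetric intervals [-n, n], where the integral is F n - F (-
    n); the bound on |F x| |x| makes both terms of order 1 / n. *)
Lemma integral_derive_eq0 (F f : R -> R) (C : R) :
  (forall x : R, is_derive x (1 : R) F (f x)) -> continuous f ->
  mu.-integrable [set: R] (EFin \o f) ->
  (forall x, `|F x| * `|x| <= C) ->
  (\int[mu]_x (f x)%:E = 0)%E.
Proof.
move=> dF cf fi FC.
pose f_ (n : nat) := (EFin \o f) \_ `[(- n.+1%:R), n.+1%:R].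
have mf : measurable_fun [set: R] (EFin \o f) by exact: measurable_int fi.
have [_ _] : [/\ mu.-integrable [set: R] (EFin \o f),
    [sequence (\int[mu]_x `|f_ n x - (f x)%:E|)%E]_n @ \oo --> 0%E &
  [sequence (\int[mu]_x f_ n x)%E]_n @ \oo --> (\int[mu]_x (f x)%:E)%E].
  apply: (@dominated_convergence _ _ _ mu _ measurableT _ _ (abse \o (EFin \o f))) => //.
  - by move=> n; apply/(measurable_restrictT (EFin \o f)) => //; exact: measurable_funTS.
  - apply/aeW => x _.
    apply: cvg_near_cst; near=> n.
    rewrite /f_ patchE mem_set//= in_itv/= -ler_norml.
    apply: (@le_trans _ _ n%:R); last by rewrite ler_nat.
    by near: n; exact: nbhs_infty_ger.
  - exact: integrable_abse.
  - apply/aeW => x n _; rewrite /f_ patchE /=; case: ifPn => //= _.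
    by rewrite normr0 lee_fin.
have -> : [sequence (\int[mu]_x f_ n x)%E]_n =
    (fun n : nat => (F n.+1%:R - F (- n.+1%:R))%:E).
  apply/funext => n /=; rewrite /f_ -integral_mkcond EFinB.
  rewrite (@continuous_FTC2 _ f F)//.
  - by rewrite -subr_gt0 opprK addr_gt0.
  - exact: continuous_subspaceT.
  - have cF x : {for x, continuous F}.
      apply: differentiable_continuous; apply/derivable1_diffP.
      by have [] := dF x.
    split.
    + by move=> x _; have [] := dF x.
    + exact/cvg_at_right_filter/cF.
    + exact/cvg_at_left_filter/cF.
  - move=> x _; rewrite derive1E; exact: derive_val.
move=> H; have {}H := cvg_lim _ H; rewrite -H//.
apply: cvg_lim => //; apply: cvg_EFin; first by apply: nearW.
have F0 (s : R) : `|s| = 1 -> F (s * n.+1%:R) @[n --> \oo] --> (0 : R).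
  move=> s1; apply: norm_cvg0.
  apply: (@squeeze_cvgr _ _ _ _ (cst 0) (fun n : nat => C * n.+1%:R^-1)).
  - apply: nearW => n; rewrite normr_ge0/= ler_pdivlMr//.
    by rewrite (le_trans _ (FC (s * n.+1%:R)))// normrM s1 mul1r normr_nat.
  - exact: cvg_cst.
  - rewrite -[X in _ --> X](mulr0 C); apply: cvgMr; exact: cvg_harmonic.
rewrite /comp/= -[X in _ --> X](subr0 0); apply: cvgB.
  have := F0 1; rewrite normr1 => /(_ erefl).
  by under eq_fun do rewrite mul1r.
have := F0 (-1); rewrite normrN1 => /(_ erefl).
by under eq_fun do rewrite mulN1r.
Unshelve. all: by end_near. Qed.

End improper.

Section moments.
Context {R : realType}.
Notation mu := (@lebesgue_measure R).
Notation N := (std_normal R).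
Notation phi := (@normal_pdf R 0 1).

Lemma std_normal_mgf (v : R) :
  (\int[N]_x (expR (v * x))%:E = (expR (v ^+ 2 / 2))%:E)%E.
Proof.
have me : measurable_fun [set: R] (fun x => expR (v * x)).
  by apply: measurableT_comp => //; exact: measurable_funM.
have := @ge0_integral_std_normal_shift R (cst 1%E) v (measurable_cst _) (fun=> lee01).
rewrite integral_probability_cst.
under eq_integral do rewrite mul1e expRD EFinM.
rewrite ge0_integralZr//; last exact/measurable_EFinP.
move=> H; rewrite -[RHS]mul1e H -muleA -EFinM -expRD addNr expR0.
by rewrite mule1.
Qed.

(** |x|^n / n! is a term of the exponential series of |x|. The right side has a finite integral by
    [std_normal_mgf], which is how all moments are shown to exist. *)
Lemma normrX_le_expR (x : R) n :
  `|x| ^+ n <= n`!%:R * (expR (1 * x) + expR ((-1) * x)).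
Proof.
have h : `|x| ^+ n <= n`!%:R * expR `|x|.
  case: n => [|n]; first by rewrite expr0 mul1r -(@expR0 R) ler_expR.
  have := @expR_ge1Dxn R `|x| n (normr_ge0 _).
  have f0 : 0 < (n.+1)`!%:R :> R by rewrite ltr0n fact_gt0.
  rewrite -(ler_pM2l f0); apply: le_trans.
  by rewrite mulrDr [X in _ + X]mulrC divfK ?gt_eqF// mulr1 lerDr ltW.
apply: (le_trans h); rewrite ler_wpM2l// mul1r mulN1r.
by case: (ger0P x) => _; rewrite ?lerDl ?lerDr expR_ge0.
Qed.

Lemma std_normal_integrableX n : N.-integrable [set: R] (fun x => (x ^+ n)%:E).
Proof.
apply/integrableP; split; first by apply/measurable_EFinP; exact: measurable_funX.
have me (v : R) : measurable_fun [set: R] (fun x => (expR (v * x))%:E).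
  by apply/measurable_EFinP/measurableT_comp => //; exact: measurable_funM.
have e0 (v x : R) : (0 <= (expR (v * x))%:E)%E by rewrite lee_fin expR_ge0.
apply: (@le_lt_trans _ _ (\int[N]_x (n`!%:R%:E * ((expR (1 * x))%:E + (expR ((-1) * x))%:E)))%E).
  apply: ge0_le_integralT => //.
  - by apply: measurableT_comp => //; apply/measurable_EFinP; exact: measurable_funX.
  - apply: emeasurable_funM => //; apply: emeasurable_funD; exact: me.
  - by move=> x; rewrite abse_EFin -EFinD -EFinM lee_fin normrX normrX_le_expR.
rewrite ge0_integralTZl//; [|by apply: emeasurable_funD; exact: me|by move=> x; rewrite adde_ge0].
by rewrite ge0_integralTD// !std_normal_mgf -EFinD -EFinM ltry.
Qed.

Lemma integrable_std_normalE (f : R -> R) : measurable_fun [set: R] f ->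
  N.-integrable [set: R] (EFin \o f) ->
  mu.-integrable [set: R] (EFin \o (fun x => f x * phi x)) /\
  (\int[N]_x (f x)%:E = \int[mu]_x (f x * phi x)%:E)%E.
Proof.
move=> mf fi; have mphi := measurable_normal_pdf (0 : R) 1.
have mEf : measurable_fun [set: R] (EFin \o f) by exact/measurable_EFinP.
split.
  apply/integrableP; split; first exact/measurable_EFinP/measurable_funM.
  have /integrableP[_] := fi.
  rewrite ge0_integral_std_normal//; last exact: measurableT_comp.
  congr (_ < _)%E; apply: eq_integral => x _.
  by rewrite /= normrM EFinM [X in (_ * X%:E)%E]ger0_norm ?normal_pdf_ge0.
rewrite integralE [RHS]integralE; congr (_ - _)%E.
  rewrite ge0_integral_std_normal//; last exact: measurable_funepos.
  apply: eq_integral => x _; rewrite !funeposE /= -!EFin_max -EFinM.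
  by rewrite maxr_pMl ?normal_pdf_ge0// mul0r.
rewrite ge0_integral_std_normal//; last exact: measurable_funeneg.
apply: eq_integral => x _; rewrite !funenegE /= -!EFin_max -EFinM.
by rewrite maxr_pMl ?normal_pdf_ge0// mul0r mulNr.
Qed.

Lemma normrX_std_normal_pdf_le n :
  exists C : R, forall x, `|x| ^+ n * phi x <= C.
Proof.
exists (n`!%:R * (normal_peak 1 * (expR 2^-1 + expR 2^-1))) => x.
apply: (le_trans (ler_wpM2r (normal_pdf_ge0 _ _ _) (normrX_le_expR x n))).
rewrite -mulrA ler_wpM2l// std_normal_pdfE mulrCA ler_wpM2l ?normal_peak_ge0//.
rewrite mulrDl -!expRD lerD// ler_expR.
  by have := sqr_ge0 (x - 1); lra.
by have := sqr_ge0 (x + 1); lra.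
Qed.

Lemma is_derive_std_normal_pdf (x : R) : is_derive x (1 : R) phi (- x * phi x).
Proof.
rewrite (_ : phi = fun x => normal_peak 1 * expR (- (x ^+ 2 / 2))); last first.
  by apply/funext => y; rewrite std_normal_pdfE.
apply: is_derive_eq; rewrite /GRing.scale/=; by field.
Qed.

Lemma continuous_std_normal_pdf : continuous phi.
Proof. by apply: continuous_normal_pdf; rewrite oner_neq0. Qed.

(** Stein's identity: f = F' - x F, so f phi is the derivative of F phi, and the growth bound on F
    against the decay of phi makes F phi vanish at infinity. *)
Lemma std_normal_integral_derive0 (F f : R -> R) n :
  (forall x, `|F x| * `|x| <= `|x| ^+ n) ->
  (forall x : R, is_derive x (1 : R) F (f x + x * F x)) ->
  continuous f -> N.-integrable [set: R] (EFin \o f) ->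
  \int[N]_x f x = 0.
Proof.
move=> Fn dF cf fi.
have mf : measurable_fun [set: R] f by exact: continuous_measurable_fun.
have [fiphi fE] := integrable_std_normalE mf fi.
have [C hC] := normrX_std_normal_pdf_le n.
rewrite /Rintegral fE; suff -> : (\int[mu]_x (f x * phi x)%:E = 0)%E by [].
apply: (@integral_derive_eq0 _ (fun x => F x * phi x) _ C) => //.
- move=> x; have dphi := is_derive_std_normal_pdf x; have dFx := dF x.
  apply: is_derive_eq; rewrite /GRing.scale/=; ring.
- move=> x; apply: cvgM; [exact: cf|exact: continuous_std_normal_pdf].
- move=> x; apply: le_trans (hC x).
  rewrite normrM mulrAC [X in _ * X]ger0_norm ?normal_pdf_ge0//.
  by rewrite ler_wpM2r ?normal_pdf_ge0.
Qed.

Lemma std_normal_moment1 : \int[N]_x x = 0.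
Proof.
have : \int[N]_x (- (x ^+ 1)) = 0.
  apply: (@std_normal_integral_derive0 (cst 1) _ 1).
  - by move=> x; rewrite normr1 mul1r expr1.
  - by move=> x; rewrite /cst expr1 mulr1 addNr; exact: is_derive_cst.
  - by move=> x; apply: cvgN; exact: exprn_continuous.
  - have := integrableN (std_normal_integrableX 1).
    by apply: eq_integrable.
have -> : (fun x : R => - (x ^+ 1)) = (fun x => (-1) * x).
  by apply/funext => x; rewrite expr1 mulN1r.
rewrite RintegralZl//.
  by move=> /eqP; rewrite mulN1r oppr_eq0 => /eqP.
by have := std_normal_integrableX 1; apply: eq_integrable.
Qed.

(** Stein's identity with F x = x^(n+1). *)
Lemma std_normal_momentSS n :
  \int[N]_x (x ^+ n.+2) = n.+1%:R * \int[N]_x (x ^+ n).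
Proof.
have i1 : N.-integrable [set: R] (EFin \o (fun x : R => n.+1%:R * x ^+ n)).
  by have := integrableZl measurableT n.+1%:R (std_normal_integrableX n); apply: eq_integrable.
have i2 := std_normal_integrableX n.+2.
have : \int[N]_x (n.+1%:R * x ^+ n - x ^+ n.+2) = 0.
  apply: (@std_normal_integral_derive0 (fun x => x ^+ n.+1) _ n.+2).
  - by move=> x; rewrite normrX -exprSr.
  - move=> x.
    have dX : is_derive x (1 : R) (fun x : R => x ^+ n.+1) (n.+1%:R * x ^+ n *: (1 : R)).
      have := @is_deriveX _ _ id n.+1 x (1 : R) 1 (is_derive_id _ _).
      by rewrite exprfctE.
    apply: (is_derive_eq dX); rewrite /GRing.scale/= !exprS; ring.
  - move=> x; apply: cvgB; last exact: exprn_continuous.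
    by apply: cvgMr; exact: exprn_continuous.
  - by have := integrableB measurableT i1 i2; apply: eq_integrable.
rewrite RintegralB// RintegralZl//; last exact: std_normal_integrableX.
by move/eqP; rewrite subr_eq0 => /eqP ->.
Qed.

Lemma std_normal_moment0 : \int[N]_x (x ^+ 0) = 1.
Proof.
under eq_Rintegral do rewrite expr0.
by rewrite /Rintegral integral_probability_cst.
Qed.

Lemma std_normal_moment2 : \int[N]_x (x ^+ 2) = 1.
Proof. by rewrite std_normal_momentSS std_normal_moment0 mulr1. Qed.

Lemma std_normal_moment3 : \int[N]_x (x ^+ 3) = 0.
Proof.
rewrite std_normal_momentSS; under eq_Rintegral do rewrite expr1.
by rewrite std_normal_moment1 mulr0.
Qed.

Lemma std_normal_moment4 : \int[N]_x (x ^+ 4) = 3.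
Proof. by rewrite std_normal_momentSS std_normal_moment2 mulr1. Qed.

End moments.

(** * The law of the noise sequence *)

Definition upd {R : Type} (y : nat -> R) (k : nat) (x : R) : nat -> R :=
  fun j => if j == k then x else y j.

Definition coord_sets (R : realType) : set (set (R^nat)) :=
  \bigcup_k preimage_set_system [set: R^nat] (fun y => y k) measurable.

(** The sigma-algebra is [product_sigma_algebra], here attached to a type so that measures and
    measurable functions on sequences can be formed. *)
Definition seq_space (R : realType) := g_sigma_algebraType (@coord_sets R).

HB.instance Definition _ (R : realType) := Pointed.on (seq_space R).
HB.instance Definition _ (R : realType) := Measurable.on (seq_space R).

(* Redrawing the k-th coordinate from N(0, 1) does not change the law: the only
   form in which independence of the noise is used. *)
Definition resampling (R : realType) (mu : probability (seq_space R) R) : Prop :=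
  forall (k : nat) (f : seq_space R -> \bar R), measurable_fun [set: _] f ->
    (forall y, 0 <= f y)%E ->
  (\int[mu]_y f y = \int[mu]_y \int[std_normal R]_x f (upd y k x))%E.

Section seq_space_measurability.
Context {R : realType}.
Notation V := (seq_space R).

Lemma measurable_coord k : measurable_fun [set: V] (fun y : V => y k : R).
Proof.
move=> _ B mB; rewrite setTI; apply: sub_sigma_algebra.
by exists k => //; exists B => //; rewrite setTI.
Qed.

Lemma measurable_to_seq d (T : measurableType d) (h : T -> V) :
  (forall k, measurable_fun [set: T] (fun t => h t k : R)) ->
  measurable_fun [set: T] h.
Proof.
move=> mh; apply: (@measurability _ _ T V setT h (@coord_sets R)); first by [].
move=> _ [C [k _ [B mB <-]] <-].
by rewrite setTI; have := mh k measurableT B mB; rewrite !setTI.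
Qed.

Lemma measurable_upd k :
  measurable_fun [set: V * R] (fun p : V * R => upd p.1 k p.2 : V).
Proof.
apply: measurable_to_seq => j; rewrite /upd; case: eqP => _.
  exact: measurable_snd.
exact: (measurableT_comp (measurable_coord j) measurable_fst).
Qed.

End seq_space_measurability.

Section law.
Context {d : measure_display} {T : measurableType d} {R : realType}.
Variables (P : probability T R) (xi : nat -> {RV P >-> R}).
Hypothesis iid : iid_standard_normal xi.
Notation V := (seq_space R).

Definition seq_of (w : T) : V := fun k => xi k w.

Lemma measurable_seq_of : measurable_fun [set: T] seq_of.
Proof. by apply: measurable_to_seq => k; exact: measurable_funPT. Qed.

HB.instance Definition _ := isMeasurableFun.Build _ _ _ _ seq_of measurable_seq_of.

Definition seq_law : probability V R := distribution P seq_of.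

Let cyl (J : {fset nat}) (A : nat -> set R) : set V :=
  [set y | forall k, A k (y k)].

(** A pi-system generating the coordinate sigma-algebra, on which [iid] makes the law a finite
    product of normal probabilities. *)
Let cylinders : set (set V) := [set C | exists (J : {fset nat}) (A : nat -> set R),
  [/\ forall k, measurable (A k), forall k, k \notin J -> A k = setT & C = cyl J A]].

Let cylE J A : (forall k, k \notin J -> A k = setT) ->
  cyl J A = \bigcap_(k in [set` J]) [set y | A k (y k)].
Proof.
move=> AJ; apply/seteqP; split => y /= yA; first by move=> k _; exact: yA.
move=> k; have [kJ|kJ] := boolP (k \in J); first exact: yA.
by rewrite AJ.
Qed.

Let seq_law_cyl J A : (forall k, measurable (A k)) ->
  (forall k, k \notin J -> A k = setT) ->
  seq_law (cyl J A) = (\prod_(k <- J) std_normal R (A k))%E.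
Proof.
move=> mA AJ; rewrite cylE//.
have [xiN xiI] := iid; transitivity (P (\bigcap_(k in [set` J]) (xi k @^-1` A k))).
  by [].
by rewrite xiI//; apply: eq_bigr => k _; rewrite std_normalE -(xiN k).
Qed.

Let measurable_cyl J A : (forall k, measurable (A k)) ->
  (forall k, k \notin J -> A k = setT) -> measurable (cyl J A).
Proof.
move=> mA AJ; rewrite cylE//; apply: bigcap_measurableType => k _.
by have := @measurable_coord R k measurableT _ (mA k); rewrite setTI.
Qed.

(** The image of the product of the law with N(0, 1) under (y, x) -> [upd y k x] agrees with the law
    on cylinders, both being products of normal probabilities. Uniqueness on a pi-system identifies
    them, and Tonelli gives the iterated integral. *)
Lemma seq_law_resampling : resampling seq_law.
Proof.
move=> k f mf f0.
pose u (p : V * R) : V := upd p.1 k p.2.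
have mu : measurable_fun [set: V * R] u := measurable_upd k.
pose nu := measure_function_pushforward__canonical__measure_function_Measure
  (seq_law \x std_normal R)%E mu.
have E A : measurable A -> seq_law A = nu A.
  have sub1 : @coord_sets R `<=` cylinders.
    move=> _ [j _ [B mB <-]]; exists [fset j]%fset, (fun i => if i == j then B else setT).
    split=> [i|i|].
    - by case: ifP.
    - by rewrite inE => /negbTE ->.
    - rewrite setTI; apply/seteqP; split => y /=; rewrite /cyl/=.
        by move=> Byj i; case: eqP => [->|].
      by move/(_ j); rewrite eqxx.
  move=> mA; apply: (@g_sigma_algebra_measure_unique _ _ _ cylinders _ (fun=> setT)) => //.
  - by move=> C [J [B [mB BJ ->]]]; exact: measurable_cyl.
  - move=> _; exists fset0, (fun=> setT); split=> //.
    by apply/seteqP.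
  - by rewrite bigcup_const.
  - move=> _ _ [J [B [mB BJ ->]]] [J' [B' [mB' BJ' ->]]].
    exists (J `|` J')%fset, (fun i => B i `&` B' i); split.
    + by move=> i; exact: measurableI.
    + by move=> i; rewrite inE negb_or => /andP[/BJ -> /BJ' ->]; rewrite setIT.
    + apply/seteqP; split=> y; rewrite /cyl/=.
        by move=> [h1 h2] i; split.
      by move=> h; split=> i; case: (h i).
  - move=> _ [J [B [mB BJ ->]]].
    (* k joins the index set so that its factor can be taken out of the product. [B'] leaves the old
       coordinate k free, and the constraint [B k] passes to the new one. *)
    pose J' := (k |` J)%fset.
    have BJ' i : i \notin J' -> B i = setT.
      by rewrite /J' !inE negb_or => /andP[_]; exact: BJ.
    have -> : cyl J B = cyl J' B by [].
    pose B' i := if i == k then setT else B i.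
    transitivity ((seq_law \x std_normal R)%E (cyl (J' `\ k)%fset B' `*` B k)).
      have mB' i : measurable (B' i) by rewrite /B'; case: ifP.
      have BB' i : i \notin (J' `\ k)%fset -> B' i = setT.
        by rewrite /B' !inE; case: eqP => //= _; exact: BJ.
      rewrite product_measure1E//; last exact: measurable_cyl.
      apply: (etrans (seq_law_cyl mB BJ')).
      apply: etrans (congr1 (fun z => z * std_normal R (B k))%E (esym (seq_law_cyl mB' BB'))).
      rewrite (big_fsetD1 k)/=; last by rewrite !inE eqxx.
      rewrite muleC; congr (_ * _)%E; apply: eq_big_seq => i.
      by rewrite !inE /B' => /andP[/negbTE ->].
    rewrite /nu/= /pushforward; congr (_ _).
    apply/seteqP; split => -[y x]; rewrite /cyl/= /u /B' /upd/=.
      by move=> [h Bx] i; have := h i; case: eqP => [->|].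
    move=> h; split=> [i|]; last by have := h k; rewrite eqxx.
    by have := h i; case: eqP.
  - by move=> _; rewrite -ge0_fin_numE// fin_num_measure.
  - by apply: (sub_sigma_algebra2 sub1); exact: mA.
rewrite (@eq_measure_integral _ _ _ _ nu); last by move=> A mA _; exact: E.
rewrite ge0_integral_pushforward//.
rewrite fubini_tonelli1//.
  exact: measurableT_comp.
by move=> p; exact: f0.
Qed.

End law.

(** * Central limit theorem *)

Section smooth_step.
Context {R : realType}.
Implicit Types a h x : R.

Let p x : R := Num.max x 0 ^+ 3 / 6.

(* Integrated quadratic B-spline: a C^2 step from 0 to 1 on [0, 3] whose second
   derivative is Lipschitz, written as a third difference of x_+^3 / 6. *)
Definition smooth_step x : R := p x - 3 * p (x - 1) + 3 * p (x - 2) - p (x - 3).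

(** The second derivative of x_+^3 / 6 is x_+, which is 1-Lipschitz. *)
Let p_taylor a h :
  `|p (a + h) - p a - Num.max a 0 ^+ 2 / 2 * h - Num.max a 0 / 2 * h ^+ 2|
    <= `|h| ^+ 3 / 6.
Proof.
have cube (u v : R) : 0 <= u -> u <= v -> u ^+ 3 <= v ^+ 3.
  by move=> u0 uv; rewrite lerXn2r// nnegrE ?(le_trans u0 uv).
rewrite /p -normrX.
case: (lerP a 0) => a0; case: (lerP (a + h) 0) => b0.
- by rewrite !(expr0n, mul0r, subr0)/= normr0 mulr_ge0// invr_ge0.
- rewrite !(expr0n, mul0r, subr0)/=.
  have h0 : 0 < h by lra.
  rewrite (ger0_norm (divr_ge0 (exprn_ge0 3 (ltW b0)) _))// ger0_norm ?exprn_ge0 ?(ltW h0)//.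
  by rewrite ler_pM2r ?invr_gt0//; apply: cube; lra.
- have h0 : h < 0 by lra.
  have -> : 0 ^+ 3 / 6 - a ^+ 3 / 6 - a ^+ 2 / 2 * h - a / 2 * h ^+ 2 =
    ((- h) ^+ 3 * (-1) - (a + h) ^+ 3) / 6 by rewrite expr0n/=; field.
  rewrite [in leRHS]normrX ltr0_norm// normrM [X in _ * X]ger0_norm ?invr_ge0//.
  rewrite ler_pM2r ?invr_gt0// ler_norml.
  have h1 : 0 <= (- (a + h)) ^+ 3 by rewrite exprn_ge0//; lra.
  have h2 : (- (a + h)) ^+ 3 <= (- h) ^+ 3 by apply: cube; lra.
  have h3 : (a + h) ^+ 3 = - (- (a + h)) ^+ 3 by ring.
  by rewrite h3; apply/andP; split; lra.
- have -> : (a + h) ^+ 3 / 6 - a ^+ 3 / 6 - a ^+ 2 / 2 * h - a / 2 * h ^+ 2 =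
    h ^+ 3 / 6 by field.
  by rewrite normrM [X in _ * X]ger0_norm ?invr_ge0.
Qed.

(** 4 / 3 is 8 / 6: the coefficients 1, 3, 3, 1 of the third difference add up to 8, and each term
    has remainder at most |h|^3 / 6. *)
Lemma smooth_step_taylor : exists s1 s2 : R -> R, forall a h,
  `|smooth_step (a + h) - smooth_step a - s1 a * h - s2 a * h ^+ 2|
    <= 4 / 3 * `|h| ^+ 3.
Proof.
pose q1 x : R := Num.max x 0 ^+ 2 / 2; pose q2 x : R := Num.max x 0 / 2.
exists (fun a => q1 a - 3 * q1 (a - 1) + 3 * q1 (a - 2) - q1 (a - 3)).
exists (fun a => q2 a - 3 * q2 (a - 1) + 3 * q2 (a - 2) - q2 (a - 3)).
move=> a h; rewrite /smooth_step.
have := p_taylor a h; have := p_taylor (a - 1) h.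
have := p_taylor (a - 2) h; have := p_taylor (a - 3) h.
rewrite -/(q1 _) -/(q1 _) -/(q1 _) -/(q1 _) -/(q2 _) -/(q2 _) -/(q2 _) -/(q2 _).
rewrite (addrAC a (-1)) (addrAC a (-2)) (addrAC a (-3)) !ler_norml.
move=> /andP[A1 A2] /andP[B1 B2] /andP[C1 C2] /andP[D1 D2].
by apply/andP; split; lra.
Qed.

Lemma smooth_step_le0 x : x <= 0 -> smooth_step x = 0.
Proof.
by move=> x0; rewrite /smooth_step /p !max_r; lra.
Qed.

Lemma smooth_step_ge3 x : 3 <= x -> smooth_step x = 1.
Proof.
by move=> x0; rewrite /smooth_step /p !max_l; try lra; field.
Qed.

Lemma smooth_step01 x : 0 <= smooth_step x <= 1.
Proof.
have [x0|x0] := lerP x 0; first by rewrite smooth_step_le0// lexx ler01.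
have [x3|x3] := lerP 3 x; first by rewrite smooth_step_ge3// lexx ler01.
rewrite /smooth_step /p (@max_l _ _ x) ?(@max_r _ _ (x - 3)); try lra.
rewrite expr0n/= mul0r subr0.
have cube01 (t : R) : 0 <= t -> t <= 1 -> 0 <= t ^+ 3 <= 1.
  by move=> t0 t1; rewrite exprn_ge0//= exprn_ile1.
have [x1|x1] := lerP x 1.
  rewrite (max_r (_ : x - 1 <= 0)) ?(max_r (_ : x - 2 <= 0)); try lra.
  have := cube01 x (ltW x0) x1; rewrite expr0n/=; lra.
rewrite (@max_l _ _ (x - 1)); last lra.
have [x2|x2] := lerP x 2.
  rewrite max_r; last lra.
  set t := x - 1; have -> : x = 1 + t by rewrite /t; ring.
  have t0 : 0 <= t by rewrite /t; lra.
  have t1 : t <= 1 by rewrite /t; lra.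
  have /andP[c0 c1] := cube01 t t0 t1.
  have s0 : 0 <= t ^+ 2 by rewrite exprn_ge0.
  have s1 : t ^+ 2 <= t by rewrite expr2 ler_piMl.
  have s3 : t ^+ 3 <= t ^+ 2 by rewrite exprS ler_piMl.
  rewrite expr0n/=; have -> : (1 + t) ^+ 3 = 1 + 3 * t + 3 * t ^+ 2 + t ^+ 3 by ring.
  by apply/andP; split; nra.
rewrite max_l; last lra.
have := cube01 (3 - x); have -> : x ^+ 3 / 6 - 3 * ((x - 1) ^+ 3 / 6) +
  3 * ((x - 2) ^+ 3 / 6) = 1 - (3 - x) ^+ 3 / 6 by field.
by lra.
Qed.

Lemma measurable_smooth_step : measurable_fun [set: R] smooth_step.
Proof.
have mp c : measurable_fun [set: R] (fun x => p (x - c)).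
  apply: measurable_funM => //; apply: measurable_funX.
  by apply: measurable_maxr => //; exact: measurable_funB.
have mp0 : measurable_fun [set: R] p.
  by apply: measurable_funM => //; apply: measurable_funX; exact: measurable_maxr.
apply: measurable_funB => //; apply: measurable_funD; last exact: measurable_funM.
by apply: measurable_funB => //; exact: measurable_funM.
Qed.

End smooth_step.

Section lindeberg_step.
Context {R : realType}.
Notation N := (std_normal R).

Lemma std_normal_integrable_poly (p : {poly R}) :
  N.-integrable [set: R] (fun x => (p.[x])%:E).
Proof.
have -> : (fun x : R => (p.[x])%:E) =
    (fun x => \sum_(i <- index_enum 'I_(size p)) (p`_i * x ^+ i)%:E)%E.
  by apply/funext => x; rewrite horner_coef sumEFin.
apply: integrable_sum => // i _.
have := integrableZl measurableT p`_i (std_normal_integrableX i).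
by apply: eq_integrable.
Qed.

Lemma integral_std_normal_poly4 (c0 c1 c2 c3 c4 : R) :
  N.-integrable [set: R] (EFin \o (fun x : R => c0 + c1 * x + c2 * x ^+ 2 + c3 * x ^+ 3 + c4 * x ^+ 4)) /\
  \int[N]_x (c0 + c1 * x + c2 * x ^+ 2 + c3 * x ^+ 3 + c4 * x ^+ 4) =
    c0 + c2 + 3 * c4.
Proof.
have i (c : R) n : N.-integrable [set: R] (EFin \o (fun x : R => c * x ^+ n)).
  have := integrableZl measurableT c (std_normal_integrableX n).
  by apply: eq_integrable.
have iD (f g : R -> R) : N.-integrable [set: R] (EFin \o f) ->
   N.-integrable [set: R] (EFin \o g) ->
   N.-integrable [set: R] (EFin \o (fun x => f x + g x)).
  by move=> fi gi; have := integrableD measurableT fi gi; apply: eq_integrable.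
have v (c : R) n : \int[N]_x (c * x ^+ n) = c * \int[N]_x (x ^+ n).
  by rewrite RintegralZl//; exact: std_normal_integrableX.
have -> : (fun x : R => c0 + c1 * x + c2 * x ^+ 2 + c3 * x ^+ 3 + c4 * x ^+ 4) =
   (fun x => c0 * x ^+ 0 + c1 * x ^+ 1 + c2 * x ^+ 2 + c3 * x ^+ 3 + c4 * x ^+ 4).
  by apply/funext => x; rewrite expr0 mulr1 expr1.
have j1 := iD _ _ (i c0 0) (i c1 1).
have j2 := iD _ _ j1 (i c2 2).
have j3 := iD _ _ j2 (i c3 3).
have j4 := iD _ _ j3 (i c4 4).
split; first exact: j4.
rewrite (RintegralD measurableT j3 (i _ _)) (RintegralD measurableT j2 (i _ _)).
rewrite (RintegralD measurableT j1 (i _ _)) (RintegralD measurableT (i _ _) (i _ _)).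
rewrite !v std_normal_moment0 std_normal_moment2 std_normal_moment3 std_normal_moment4.
under [\int[N]_x (x ^+ 1)]eq_Rintegral do rewrite expr1.
by rewrite std_normal_moment1; ring.
Qed.

(** 5 = 1 + 4: the cubes of the chi-square and Gaussian increments are at most w^3 (x^2 + 1)^3 and 4
    w^3 (x^2 + 1)^3. *)
Definition lindeberg_const : R := 5 * \int[N]_x ((x ^+ 2 + 1) ^+ 3).

Lemma lindeberg_const_ge0 : 0 <= lindeberg_const.
Proof.
rewrite mulr_ge0// Rintegral_ge0// => x _.
by rewrite exprn_ge0// addr_ge0// sqr_ge0.
Qed.

(* w (x^2 - 1) and sqrt 2 w x have the same mean and variance, so the Taylor
   terms of order at most 2 cancel. *)
Lemma lindeberg_step (f : R -> R) (K a w : R) (f1 f2 : R -> R) :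
  measurable_fun [set: R] f -> (forall x, 0 <= f x <= 1) ->
  (forall a h, `|f (a + h) - f a - f1 a * h - f2 a * h ^+ 2| <= K * `|h| ^+ 3) ->
  0 <= K -> 0 <= w ->
  `|\int[N]_x f (a + w * (x ^+ 2 - 1)) - \int[N]_x f (a + Num.sqrt 2 * w * x)| <=
    K * lindeberg_const * w ^+ 3.
Proof.
move=> mf f01 fT K0 w0.
set h1 := fun x : R => w * (x ^+ 2 - 1); set h2 := fun x : R => Num.sqrt 2 * w * x.
have mh1 : measurable_fun [set: R] h1.
  by apply: measurable_funM => //; apply: measurable_funB => //; exact: measurable_funX.
have mh2 : measurable_fun [set: R] h2 by exact: measurable_funM.
have fi (h : R -> R) : measurable_fun [set: R] h ->
    N.-integrable [set: R] (EFin \o (fun x => f (a + h x))).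
  move=> mh; apply: measurable_bounded_integrable => //.
  - by rewrite -ge0_fin_numE// fin_num_measure.
  - by apply: (measurableT_comp mf); exact: measurable_funD.
  - exists 1; split => // M M1 x _ /=.
    by have /andP[? ?] := f01 (a + h x); rewrite ger0_norm// (le_trans _ (ltW M1)).
(* The difference of the two second-order Taylor polynomials. Its integral vanishes, so it can be
   subtracted, and only the cubic remainders are left. *)
pose q x := f1 a * (h1 x - h2 x) + f2 a * (h1 x ^+ 2 - h2 x ^+ 2).
have s2 : Num.sqrt 2 ^+ 2 = 2 :> R by rewrite sqr_sqrtr.
have qE : q = (fun x => (- f1 a * w + f2 a * w ^+ 2) + (- f1 a * Num.sqrt 2 * w) * x +
   (f1 a * w - 4 * f2 a * w ^+ 2) * x ^+ 2 + 0 * x ^+ 3 + f2 a * w ^+ 2 * x ^+ 4).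
  by apply/funext => x; rewrite /q /h1 /h2 !exprMn s2; ring.
have [qi qv] := integral_std_normal_poly4 (- f1 a * w + f2 a * w ^+ 2)
  (- f1 a * Num.sqrt 2 * w) (f1 a * w - 4 * f2 a * w ^+ 2) 0 (f2 a * w ^+ 2).
rewrite -qE in qv.
have {}qi : N.-integrable [set: R] (EFin \o q) by rewrite qE.
have q0 : \int[N]_x q x = 0 by rewrite qv; ring.
have Pi : N.-integrable [set: R] (EFin \o (fun x : R => (x ^+ 2 + 1) ^+ 3)).
  have := std_normal_integrable_poly (('X^2 + 1) ^+ 3).
  by apply: eq_integrable => // x _; rewrite /= !hornerE.
have i12 : N.-integrable [set: R] (EFin \o (fun x => f (a + h1 x) - f (a + h2 x))).
  by have := integrableB measurableT (fi _ mh1) (fi _ mh2); apply: eq_integrable.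
have iD : N.-integrable [set: R] (EFin \o (fun x => f (a + h1 x) - f (a + h2 x) - q x)).
  by have := integrableB measurableT i12 qi; apply: eq_integrable.
have iR : N.-integrable [set: R] (EFin \o (fun x => K * (5 * w ^+ 3) * (x ^+ 2 + 1) ^+ 3)).
  by have := integrableZl measurableT (K * (5 * w ^+ 3)) Pi; apply: eq_integrable.
have -> : \int[N]_x f (a + h1 x) - \int[N]_x f (a + h2 x) =
    \int[N]_x (f (a + h1 x) - f (a + h2 x) - q x).
  rewrite (RintegralB measurableT i12 qi) q0 subr0.
  by rewrite (RintegralB measurableT (fi _ mh1) (fi _ mh2)).
apply: (le_trans (le_normr_Rintegral measurableT iD)).
have -> : K * lindeberg_const * w ^+ 3 =
    \int[N]_x (K * (5 * w ^+ 3) * (x ^+ 2 + 1) ^+ 3).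
  by rewrite RintegralZl// /lindeberg_const; ring.
apply: le_Rintegral => //.
  by have := integrable_norm iD.
move=> x _.
have cube (u v : R) : 0 <= u -> u <= v -> u ^+ 3 <= v ^+ 3.
  by move=> u0 uv; rewrite lerXn2r// nnegrE ?(le_trans u0 uv).
have b1 : `|h1 x| ^+ 3 <= w ^+ 3 * (x ^+ 2 + 1) ^+ 3.
  rewrite -exprMn; apply: cube => //; rewrite normrM (ger0_norm w0) ler_wpM2l//.
  by rewrite ler_norml; apply/andP; split; have := sqr_ge0 x; lra.
have b2 : `|h2 x| ^+ 3 <= 4 * w ^+ 3 * (x ^+ 2 + 1) ^+ 3.
  have -> : `|h2 x| ^+ 3 = Num.sqrt 2 ^+ 3 * (w * `|x|) ^+ 3.
    by rewrite /h2 !normrM (ger0_norm w0) (ger0_norm (sqrtr_ge0 _)) -mulrA exprMn.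
  have -> : 4 * w ^+ 3 * (x ^+ 2 + 1) ^+ 3 = 4 * (w * (x ^+ 2 + 1)) ^+ 3 by ring.
  apply: ler_pM; rewrite ?exprn_ge0 ?mulr_ge0 ?sqrtr_ge0//.
    rewrite exprS s2 (_ : 4 = 2 * 2); last ring.
    rewrite ler_pM2r// -(@ler_pXn2r _ 2) ?nnegrE ?sqrtr_ge0// s2.
    by lra.
  apply: cube; rewrite ?mulr_ge0// ler_wpM2l//.
  rewrite ler_norml; apply/andP; split.
    by have := sqr_ge0 (x + 1); have := sqr_ge0 x; lra.
  by have := sqr_ge0 (x - 1); have := sqr_ge0 x; lra.
have t1 := fT a (h1 x); have t2 := fT a (h2 x).
rewrite (_ : _ - q x = (f (a + h1 x) - f a - f1 a * h1 x - f2 a * h1 x ^+ 2) -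
   (f (a + h2 x) - f a - f1 a * h2 x - f2 a * h2 x ^+ 2)); last by rewrite /q; ring.
apply: (le_trans (ler_normB _ _)); apply: (le_trans (lerD t1 t2)).
by rewrite -mulrDr -mulrA ler_wpM2l//; lra.
Qed.

End lindeberg_step.

Lemma upd_same {R : Type} (y : nat -> R) k x : upd y k x k = x.
Proof. by rewrite /upd eqxx. Qed.

Lemma upd_lt {R : Type} (y : nat -> R) k x j : (j < k)%N -> upd y k x j = y j.
Proof. by move=> jk; rewrite /upd ltn_eqF. Qed.

Section resampled_integrals.
Context {R : realType}.
Notation N := (std_normal R).
Notation V := (seq_space R).
Variable mu : probability V R.
Hypothesis Hres : resampling mu.
Local Open Scope ereal_scope.

(** When g (., x) ignores coordinate n, resampling turns y n into an independent normal variable.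
    This is the conditioning step in the inductions on the number of terms of a sum. *)
Lemma integral_last_coord n (g : V * R -> \bar R) :
  measurable_fun [set: V * R] g -> (forall p, 0 <= g p) ->
  (forall y x z, g (upd y n z, x) = g (y, x)) ->
  \int[mu]_y g (y, y n) = \int[mu]_y \int[N]_x g (y, x).
Proof.
move=> mg g0 gn; rewrite (Hres n (f := fun y => g (y, y n))).
- by apply: eq_integral => y _; apply: eq_integral => x _; rewrite upd_same gn.
- by apply: (measurableT_comp mg); apply: measurable_fun_pair => //; exact: measurable_coord.
- by move=> y; exact: g0.
Qed.

Lemma measurable_coord_sum n (g : nat -> R -> R) :
  (forall k, measurable_fun [set: R] (g k)) ->
  measurable_fun [set: V] (fun y : V => \sum_(k < n) g k (y k))%R.
Proof.
move=> mg; apply: measurable_sum => k.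
exact: (measurableT_comp (mg k) (measurable_coord k)).
Qed.

Lemma coord_sum_upd n (g : nat -> R -> R) (y : V) z :
  (\sum_(k < n) g k (upd y n z k) = \sum_(k < n) g k (y k))%R.
Proof. by apply: eq_bigr => k _; rewrite upd_lt. Qed.

(** The hypothesis with a free constant a says that g k has mean 0 and variance s k; it is applied
    with a equal to the sum of the preceding terms, so that variances add. *)
Lemma integral_sqr_coord_sum n (g : nat -> R -> R) (s : nat -> R) :
  (forall k, measurable_fun [set: R] (g k)) ->
  (forall k a, \int[N]_x ((a + g k x) ^+ 2)%:E = (a ^+ 2 + s k)%:E) ->
  \int[mu]_y ((\sum_(k < n) g k (y k)) ^+ 2)%:E = (\sum_(k < n) s k)%:E.
Proof.
move=> mg gs.
have s0 k : (0 <= s k)%R.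
  have := gs k 0%R; rewrite expr0n/= add0r -lee_fin => <-.
  by apply: integral_ge0 => x _; rewrite lee_fin sqr_ge0.
elim: n => [|n IH].
  under eq_integral do rewrite big_ord0 expr0n/=.
  by rewrite integral0 big_ord0.
under eq_integral do rewrite big_ord_recr/=.
rewrite (integral_last_coord (n := n)
  (g := fun p => ((\sum_(k < n) g k (p.1 k) + g n p.2) ^+ 2)%:E)); first last.
- by move=> y x z; rewrite coord_sum_upd.
- by move=> p; rewrite lee_fin sqr_ge0.
- apply/measurable_EFinP; apply: measurable_funX; apply: measurable_funD.
    exact: (measurableT_comp (measurable_coord_sum n mg) measurable_fst).
  exact: (measurableT_comp (mg n) measurable_snd).
transitivity (\int[mu]_y (((\sum_(k < n) g k (y k)) ^+ 2)%:E + (s n)%:E)).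
  by apply: eq_integral => y _; rewrite -EFinD -gs.
rewrite ge0_integralTD; first last.
- by move=> y; rewrite lee_fin.
- by move=> y; rewrite lee_fin sqr_ge0.
- exact: measurable_cst.
- by apply/measurable_EFinP; apply: measurable_funX; exact: measurable_coord_sum.
by rewrite IH integral_probability_cst big_ord_recr/= EFinD.
Qed.

Lemma chebyshev_coord_sum n (g : nat -> R -> R) (s : nat -> R) (rho : R) :
  (forall k, measurable_fun [set: R] (g k)) ->
  (forall k a, \int[N]_x ((a + g k x) ^+ 2)%:E = (a ^+ 2 + s k)%:E) ->
  (0 < rho)%R ->
  mu [set y : V | rho <= `|\sum_(k < n) g k (y k)|]%R <=
    ((\sum_(k < n) s k) / rho ^+ 2)%:E.
Proof.
move=> mg gs rho0; rewrite EFinM -(integral_sqr_coord_sum n mg gs).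
have mS := measurable_coord_sum n mg.
have rho2 : (0 < rho ^+ 2)%R by rewrite exprn_gt0.
rewrite lee_pdivlMr//; set A := (X in mu X).
have mA : measurable A.
  have := @measurable_fun_le _ V R [set: V] (cst rho) _ measurableT (measurable_cst _) (measurableT_comp (@normr_measurable R _) mS).
  by rewrite setTI.
rewrite muleC -[X in _ * mu X]setIT -integral_indic// -ge0_integralTZl; first last.
- exact: ltW.
- by move=> y; rewrite lee_fin.
- by apply/measurable_EFinP; exact: measurable_indic.
apply: ge0_le_integralT.
- apply: emeasurable_funM => //.
  by apply/measurable_EFinP; exact: measurable_indic.
- by apply/measurable_EFinP; exact: measurable_funX.
- by move=> y; rewrite mule_ge0 ?lee_fin// ltW.
move=> y; rewrite -EFinM lee_fin indicE; case: (boolP (y \in A)) => yA.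
  move: yA; rewrite inE /A/= => h.
  by rewrite mulr1 -[leRHS]real_normK ?num_real// lerXn2r ?nnegrE// ltW.
by rewrite mulr0 sqr_ge0.
Qed.

Section lindeberg.
Variables (f : R -> R) (K : R) (f1 f2 : R -> R) (w : nat -> R).
Hypotheses (mf : measurable_fun [set: R] f) (f01 : forall x, (0 <= f x <= 1)%R).
Hypothesis fT : forall a h,
  (`|f (a + h) - f a - f1 a * h - f2 a * h ^+ 2| <= K * `|h| ^+ 3)%R.
Hypotheses (K0 : (0 <= K)%R) (w0 : forall k, (0 <= w k)%R).

Let g k (x : R) : R := (w k * (x ^+ 2 - 1))%R.
Let mg k : measurable_fun [set: R] (g k).
Proof.
by apply: measurable_funM => //; apply: measurable_funB => //; exact: measurable_funX.
Qed.
Let c k : R := (K * lindeberg_const * w k ^+ 3)%R.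
Let c0 k : (0 <= c k)%R.
Proof. by apply: mulr_ge0; [apply: mulr_ge0 => //; exact: lindeberg_const_ge0|exact: exprn_ge0]. Qed.
Let f0 x : 0 <= (f x)%:E. Proof. by rewrite lee_fin; case/andP: (f01 x). Qed.
Let mEf : measurable_fun [set: R] (EFin \o f). Proof. exact/measurable_EFinP. Qed.
Let mlin (a b : R) : measurable_fun [set: R] (fun x => a + b * x)%R.
Proof. by apply: measurable_funD => //; exact: measurable_funM. Qed.

Let fE (h : R -> R) : measurable_fun [set: R] h ->
  \int[N]_x (f (h x))%:E = (Rintegral N [set: R] (fun x => f (h x)))%:E.
Proof.
move=> mh; rewrite /Rintegral fineK//; apply: integrable_fin_num => //.
apply: measurable_bounded_integrable => //.
- by rewrite -ge0_fin_numE// fin_num_measure.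
- exact: (measurableT_comp mf).
- exists 1%R; split => // M M1 x _ /=.
  by have /andP[? ?] := f01 (h x); rewrite ger0_norm// (le_trans _ (ltW M1)).
Qed.

Let step a n :
  \int[N]_x (f (a + g n x))%:E <= \int[N]_x (f (a + Num.sqrt 2 * w n * x))%:E + (c n)%:E /\
  \int[N]_x (f (a + Num.sqrt 2 * w n * x))%:E <= \int[N]_x (f (a + g n x))%:E + (c n)%:E.
Proof.
rewrite fE; last by apply: measurable_funD => //; exact: mg.
rewrite fE// -!EFinD !lee_fin.
have := lindeberg_step a mf f01 fT K0 (w0 n).
rewrite -/(c n) ler_norml => /andP[? ?]; split; lra.
Qed.

Let tau n : R := Num.sqrt (\sum_(k < n) 2 * w k ^+ 2).

(* The chi-square terms are replaced one at a time; the Gaussian replacements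
   accumulate into a single one of variance tau n ^+ 2 by stability. *)
Lemma lindeberg n b :
  \int[mu]_y (f (b + \sum_(k < n) w k * ((y k : R) ^+ 2 - 1)))%:E <=
    \int[N]_x (f (b + tau n * x))%:E + (\sum_(k < n) c k)%:E /\
  \int[N]_x (f (b + tau n * x))%:E <=
    \int[mu]_y (f (b + \sum_(k < n) w k * ((y k : R) ^+ 2 - 1)))%:E + (\sum_(k < n) c k)%:E.
Proof.
(* The offset b is general so that the induction hypothesis applies with the Gaussian replacement of
   the last term frozen inside it. *)
elim: n b => [|n IH] b.
  under eq_integral do rewrite big_ord0 addr0.
  rewrite /tau big_ord0 sqrtr0 integral_probability_cst.
  under eq_integral do rewrite mul0r addr0.
  by rewrite integral_probability_cst big_ord0 adde0.
have mS := measurable_coord_sum n mg.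
pose S (y : V) : R := (\sum_(k < n) g k (y k))%R.
have E1 : \int[mu]_y (f (b + \sum_(k < n.+1) w k * ((y k : R) ^+ 2 - 1)))%:E =
    \int[mu]_y \int[N]_x (f ((b + S y) + g n x))%:E.
  rewrite -(integral_last_coord (n := n) (g := fun p => (f ((b + S p.1) + g n p.2))%:E)).
  - by apply: eq_integral => y _; rewrite big_ord_recr/= addrA.
  - apply: (measurableT_comp mEf); apply: measurable_funD.
      apply: measurable_funD => //; exact: (measurableT_comp mS measurable_fst).
    exact: (measurableT_comp (mg n) measurable_snd).
  - by move=> p; exact: f0.
  - by move=> y x z; rewrite /S /= coord_sum_upd.
have s2 : (Num.sqrt 2 ^+ 2 = 2 :> R)%R by rewrite sqr_sqrtr.
have tn0 : (0 <= \sum_(k < n) 2 * w k ^+ 2)%R.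
  by apply: sumr_ge0 => k _; rewrite mulr_ge0// sqr_ge0.
have E2 : \int[N]_x (f (b + tau n.+1 * x))%:E =
    \int[N]_x \int[N]_z (f ((b + Num.sqrt 2 * w n * x) + tau n * z))%:E.
  rewrite (_ : tau n.+1 = Num.sqrt (tau n ^+ 2 + (Num.sqrt 2 * w n) ^+ 2))%R; last first.
    by rewrite /tau big_ord_recr/= sqr_sqrtr// exprMn s2.
  have mfb : measurable_fun [set: R] (fun x => (f (b + x))%:E).
    by apply: (measurableT_comp mEf); exact: measurable_funD.
  have sw0 : (0 <= Num.sqrt 2 * w n)%R by rewrite mulr_ge0// sqrtr_ge0.
  rewrite -(std_normal_stable (sqrtr_ge0 _) sw0 mfb (fun x => f0 (b + x)%R)).
  apply: eq_integral => x _; apply: eq_integral => z _.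
  by rewrite -addrA [in RHS](addrC (_ * x)%R).
pose G (p : V * R) := (f ((b + S p.1) + Num.sqrt 2 * w n * p.2))%:E.
have mG : measurable_fun [set: V * R] G.
  apply: (measurableT_comp mEf); apply: measurable_funD.
    apply: measurable_funD => //; exact: (measurableT_comp mS measurable_fst).
  by apply: measurable_funM => //; exact: measurable_snd.
have G0 p : 0 <= G p by exact: f0.
have E3 : \int[mu]_y \int[N]_x G (y, x) = \int[N]_x \int[mu]_y G (y, x).
  exact: (@fubini_tonelli _ _ _ _ _ mu N G mG G0).
have mF1 := @measurable_fun_fubini_tonelli_F _ _ _ _ _ N G mG G0.
have mF2 := @measurable_fun_fubini_tonelli_G _ _ _ _ _ mu G mG G0.
pose H (p : V * R) := (f ((b + S p.1) + g n p.2))%:E.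
have mH : measurable_fun [set: V * R] H.
  apply: (measurableT_comp mEf); apply: measurable_funD.
    apply: measurable_funD => //; exact: (measurableT_comp mS measurable_fst).
  exact: (measurableT_comp (mg n) measurable_snd).
have H0 p : 0 <= H p by exact: f0.
have mF3 := @measurable_fun_fubini_tonelli_F _ _ _ _ _ N H mH H0.
pose Q (p : R * R) := (f ((b + Num.sqrt 2 * w n * p.1) + tau n * p.2))%:E.
have mQ : measurable_fun [set: R * R] Q.
  apply: (measurableT_comp mEf); apply: measurable_funD.
    apply: measurable_funD => //; apply: measurable_funM => //; exact: measurable_fst.
  by apply: measurable_funM => //; exact: measurable_snd.
have Q0 p : 0 <= Q p by exact: f0.
have mF4 := @measurable_fun_fubini_tonelli_F _ _ _ _ _ N Q mQ Q0.
have cs0 : (0 <= \sum_(k < n) c k)%R by apply: sumr_ge0 => k _.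
have GE x : \int[mu]_y G (y, x) =
    \int[mu]_y (f ((b + Num.sqrt 2 * w n * x) + \sum_(k < n) w k * ((y k : R) ^+ 2 - 1)))%:E.
  by apply: eq_integral => y _; rewrite /G/= addrAC.
have cadd d (T : measurableType d) (P : probability T R) (F : T -> \bar R) (k : R) :
    measurable_fun [set: T] F -> (forall t, 0 <= F t) -> (0 <= k)%R ->
    \int[P]_t (F t + k%:E) = \int[P]_t F t + k%:E.
  move=> mF F0 k0; rewrite ge0_integralTD ?integral_probability_cst//.
have i0 d (T : measurableType d) (P : probability T R) (h : T -> R) :
   0 <= \int[P]_t (f (h t))%:E by apply: integral_ge0 => t _; exact: f0.
rewrite E1 E2 big_ord_recr/= EFinD; split.
- apply: (@le_trans _ _ (\int[mu]_y (\int[N]_x G (y, x) + (c n)%:E))).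
    apply: ge0_le_integralT.
    + exact: mF3.
    + by apply: emeasurable_funD => //; exact: measurable_cst.
    + by move=> y; exact: i0.
    + by move=> y; have [] := step (b + S y)%R n.
  rewrite cadd//; last by move=> y; exact: i0.
  rewrite addeA leeD2r// E3.
  apply: (@le_trans _ _ (\int[N]_x (\int[N]_z Q (x, z) + (\sum_(k < n) c k)%:E))).
    apply: ge0_le_integralT.
    + exact: mF2.
    + by apply: emeasurable_funD => //; exact: measurable_cst.
    + by move=> y; exact: i0.
    + by move=> x; rewrite GE; have [] := IH (b + Num.sqrt 2 * w n * x)%R.
  by rewrite cadd//; move=> x; exact: i0.
- apply: (@le_trans _ _ (\int[N]_x (\int[mu]_y G (y, x) + (\sum_(k < n) c k)%:E))).
    apply: ge0_le_integralT.
    + exact: mF4.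
    + by apply: emeasurable_funD => //; exact: measurable_cst.
    + by move=> y; exact: i0.
    + by move=> x; rewrite GE; have [] := IH (b + Num.sqrt 2 * w n * x)%R.
  rewrite cadd//; last by move=> y; exact: i0.
  rewrite (addeC (\sum_(k < n) c k)%:E) addeA leeD2r// -E3.
  apply: (@le_trans _ _ (\int[mu]_y (\int[N]_x H (y, x) + (c n)%:E))).
    apply: ge0_le_integralT.
    + exact: mF1.
    + by apply: emeasurable_funD => //; exact: measurable_cst.
    + by move=> y; exact: i0.
    + by move=> y; have [] := step (b + S y)%R n.
  by rewrite cadd//; move=> x; exact: i0.
Qed.

End lindeberg.

Section sign_mixture.
Variable v : nat -> R.

Definition signed_shift n (s : nat -> bool) (y : V) : V :=
  (fun k => y k + (if (k < n)%N then (-1) ^+ s k * v k else 0))%R.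

(** The average over the two signs of the likelihood ratio of N(v, 1) or N(- v, 1) against N(0,
    1). *)
Definition cosh_factor k (x : R) : R :=
  ((expR (v k * x) + expR (- v k * x)) / 2 * expR (- (v k ^+ 2 / 2)))%R.

(* Likelihood ratio against pure noise of the mixture of the [signed_shift n s]
   over uniform independent signs s. *)
Definition mixture_lr n (y : V) : R := (\prod_(k < n) cosh_factor k (y k))%R.

Lemma cosh_factor_ge0 k x : (0 <= cosh_factor k x)%R.
Proof. by rewrite mulr_ge0 ?divr_ge0 ?addr_ge0 ?expR_ge0. Qed.

Lemma measurable_cosh_factor k : measurable_fun [set: R] (cosh_factor k).
Proof.
have me (a : R) : measurable_fun [set: R] (fun x => expR (a * x)).
  by apply: measurableT_comp => //; exact: measurable_funM.
apply: measurable_funM => //; apply: measurable_funM => //.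
by apply: measurable_funD; exact: me.
Qed.

Lemma measurable_mixture_lr n : measurable_fun [set: V] (mixture_lr n).
Proof.
apply: measurable_prod => k _.
exact: (measurableT_comp (measurable_cosh_factor k) (measurable_coord k)).
Qed.

Lemma mixture_lr_ge0 n y : (0 <= mixture_lr n y)%R.
Proof. by apply: prodr_ge0 => k _; exact: cosh_factor_ge0. Qed.

Lemma measurable_signed_shift n s : measurable_fun [set: V] (signed_shift n s).
Proof.
apply: measurable_to_seq => k; apply: measurable_funD => //.
exact: measurable_coord.
Qed.

(** No probability space of signs is introduced: a bound valid for every choice of signs survives
    averaging, and the average is taken one coordinate at a time. *)
Lemma integral_mixture_le n (f : V -> \bar R) (b : \bar R) :
  measurable_fun [set: V] f -> (forall y, 0 <= f y) ->
  (forall s, \int[mu]_y f (signed_shift n s y) <= b) ->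
  \int[mu]_y (f y * (mixture_lr n y)%:E) <= b.
Proof.
elim: n f => [|n IH] f mf f0 fb.
  have := fb (fun=> false); congr (_ <= _); apply: eq_integral => y _.
  rewrite /mixture_lr big_ord0 mule1; congr f.
  by apply/funext => k; rewrite /signed_shift ltn0 addr0.
(* The last factor is absorbed into the integrand; shifting the first n coordinates leaves it
   unchanged, so the induction hypothesis applies to [g]. *)
pose g (y : V) := f y * (cosh_factor n (y n))%:E.
have mc : measurable_fun [set: V] (fun y => (cosh_factor n (y n))%:E).
  apply/measurable_EFinP.
  exact: (measurableT_comp (measurable_cosh_factor n) (measurable_coord n)).
have mg : measurable_fun [set: V] g by exact: emeasurable_funM.
have g0 y : 0 <= g y by rewrite mule_ge0// lee_fin cosh_factor_ge0.
have -> : \int[mu]_y (f y * (mixture_lr n.+1 y)%:E) =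
    \int[mu]_y (g y * (mixture_lr n y)%:E).
  apply: eq_integral => y _; rewrite /mixture_lr big_ord_recr/= /g -muleA -EFinM.
  by congr (_ * _%:E); rewrite mulrC.
apply: IH => // s.
have ms := measurable_signed_shift.
have updE y (x : R) (c : bool) : upd (signed_shift n s y) n (x + (-1) ^+ c * v n)%R =
    signed_shift n.+1 (upd s n c) (upd y n x).
  apply/funext => k; rewrite /upd /signed_shift ltnS [(k <= n)%N]leq_eqVlt.
  by case: (eqVneq k n) => [->|_].
have updE0 y x : signed_shift n s (upd y n x) = upd (signed_shift n s y) n x.
  apply/funext => k; rewrite /upd /signed_shift.
  by case: (eqVneq k n) => // ->; rewrite ltnn addr0.
have mfu y : measurable_fun [set: R] (fun x => f (upd y n x)).
  apply: (measurableT_comp mf); apply: measurable_to_seq => j.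
  by rewrite /upd; case: eqP => _.
pose F c (y : V) := \int[N]_x f (signed_shift n.+1 (upd s n c) (upd y n x)).
have mFc c : measurable_fun [set: V] (F c).
  apply: (@measurable_fun_fubini_tonelli_F _ _ _ _ _ N
    (fun p : V * R => f (signed_shift n.+1 (upd s n c) (upd p.1 n p.2)))) => //.
  apply: (measurableT_comp mf); apply: (measurableT_comp (ms _ _)).
  exact: measurable_upd.
have Fc0 c y : 0 <= F c y by apply: integral_ge0 => x _.
rewrite (Hres n); first last.
- by move=> y; exact: g0.
- exact: (measurableT_comp mg).
have half0 : (0 <= 2^-1 :> R)%R by rewrite invr_ge0.
(* After coordinate n is resampled, each of the two exponentials in its factor is the density of a
   shift, by v n or by - v n. *)
have -> : \int[mu]_y \int[N]_x g (signed_shift n s (upd y n x)) =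
    \int[mu]_y (2^-1%:E * (F false y + F true y)).
  apply: eq_integral => y _; rewrite /F.
  under [X in _ = _ * (X + _)]eq_integral do rewrite -updE expr0 mul1r.
  under [X in _ = _ * (_ + X)]eq_integral do rewrite -updE expr1 mulN1r.
  rewrite (ge0_integral_std_normal_shift (v n) (mfu _))//.
  rewrite (ge0_integral_std_normal_shift (- v n) (mfu _))//.
  have me (a : R) : measurable_fun [set: R]
      (fun x => f (upd (signed_shift n s y) n x) * (expR (a * x - a ^+ 2 / 2))%:E).
    apply: emeasurable_funM => //; apply/measurable_EFinP.
    by apply: measurableT_comp => //; exact: measurable_funB.
  have e0 (a x : R) :
      0 <= f (upd (signed_shift n s y) n x) * (expR (a * x - a ^+ 2 / 2))%:E.
    by rewrite mule_ge0// lee_fin expR_ge0.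
  rewrite -ge0_integralTD// -ge0_integralTZl//; first last.
    by move=> x; rewrite adde_ge0.
  - exact: emeasurable_funD.
  apply: eq_integral => x _; rewrite updE0 /g upd_same -ge0_muleDr ?lee_fin ?expR_ge0//.
  rewrite muleCA -EFinD -EFinM; congr (_ * _%:E).
  rewrite /cosh_factor sqrrN !expRD mulrDl mulrDl -!mulrA; ring.
rewrite ge0_integralTZl//; first last.
- by move=> y; rewrite adde_ge0.
- exact: emeasurable_funD.
rewrite ge0_integralTD//.
have Fb c : \int[mu]_y F c y <= b.
  rewrite /F -(Hres n (f := fun y => f (signed_shift n.+1 (upd s n c) y)))//.
  exact: (measurableT_comp mf).
apply: (@le_trans _ _ (2^-1%:E * (b + b))).
  by rewrite lee_wpmul2l ?lee_fin// leeD.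
have b0 : 0 <= b by apply: le_trans (Fb true); apply: integral_ge0.
case: b {fb Fb} b0 => [r||]// _.
- by rewrite -EFinD -EFinM lee_fin; lra.
- by rewrite leey.
Qed.

End sign_mixture.

End resampled_integrals.

(** * The normal distribution function *)

Section Phi_facts.
Context {R : realType}.
Notation N := (std_normal R).
Notation leb := (@lebesgue_measure R).
Implicit Types x c t h : R.

Lemma std_normal_itvNy c : N `]-oo, c]%classic = (Phi c)%:E.
Proof.
rewrite std_normalE /Phi fineK// -std_normalE fin_num_measure//.
Qed.

Lemma std_normal_itvy c : N [set x | c < x] = (1 - Phi c)%:E.
Proof.
have -> : [set x | c < x] = ~` `]-oo, c]%classic.
  apply/seteqP; split => x /=; rewrite in_itv/= ltNge; first by move/negP.
  by move/negP.
by rewrite (@probability_setC _ _ _ N)// std_normal_itvNy EFinB.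
Qed.

Lemma Phi_ge0 c : 0 <= Phi c.
Proof. by rewrite -lee_fin -std_normal_itvNy. Qed.

(** The normal density is at most 1 because 2 pi >= 1. *)
Lemma Phi_lip c h : 0 <= h -> Phi c <= Phi (c + h) <= Phi c + h.
Proof.
move=> h0.
have -> : Phi (c + h) = Phi c + fine (N `]c, (c + h)%R]%classic).
  have Nf : N `]c, (c + h)%R]%classic \is a fin_num by exact: fin_num_measure.
  apply: EFin_inj; rewrite EFinD (fineK Nf).
  rewrite -(std_normal_itvNy (c + h)) -(std_normal_itvNy c).
  rewrite -measureU//.
    congr (N _); apply/seteqP; split => x /=; rewrite !in_itv/=.
      by case: (lerP x c) => xc xch; [left|right; rewrite xch].
    by move=> [xc|/andP[]//]; rewrite (le_trans xc)// lerDl.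
  by apply/seteqP; split => x //= -[]; rewrite !in_itv/= => xc /andP[]; rewrite ltNge xc.
suff Nh : (N `]c, (c + h)%R]%classic <= h%:E)%E.
  rewrite lerDl lerD2l fine_ge0//= -lee_fin fineK//.
  by rewrite ge0_fin_numE// (le_lt_trans Nh)// ltry.
apply: (@le_trans _ _ (\int[leb]_(x in `]c, (c + h)%R]) (normal_pdf 0 1 x)%:E)%E).
  exact: lexx.
apply: (@le_trans _ _ (\int[leb]_(x in `]c, (c + h)%R]) 1)%E).
  apply: ge0_le_integral => //.
  - by move=> x _; rewrite lee_fin normal_pdf_ge0.
  - by apply: measurable_funTS; exact: measurable_std_normal_pdf.
  - move=> x _; rewrite lee_fin (le_trans (normal_pdf_ub _ _ (oner_neq0 _)))//.
    have pi0 : 0 < 1 ^+ 2 * pi *+ 2 :> R by rewrite mulrn_wgt0// expr1n mul1r pi_gt0.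
    rewrite /normal_peak invf_le1 ?sqrtr_gt0// -[leLHS]sqrtr1 ler_sqrt ?ltW//.
    by rewrite expr1n mul1r -mulr_natr; have := pi_ge2 R; lra.
rewrite integral_cst//= mul1e lebesgue_measure_itv/= lte_fin ltrDl.
by case: ifP => _; rewrite lee_fin// addrAC subrr add0r.
Qed.

Lemma Phi_nondecreasing c t : c <= t -> Phi c <= Phi t.
Proof.
move=> ct; have h0 : 0 <= t - c by rewrite subr_ge0.
by have /andP[+ _] := Phi_lip c h0; rewrite addrC subrK.
Qed.

Lemma Phi_le_addr c t h : t <= c + h -> 0 <= h -> Phi t <= Phi c + h.
Proof.
move=> tch h0; have /andP[_ +] := Phi_lip c h0.
by apply: le_trans; exact: Phi_nondecreasing.
Qed.

Lemma ge0_integral_std_normalN (f : R -> \bar R) : measurable_fun [set: R] f ->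
  (forall x, 0 <= f x)%E -> (\int[N]_x f (- x)%R = \int[N]_x f x)%E.
Proof.
move=> mf f0; have mN : measurable_fun [set: R] (fun x : R => f (- x)).
  by apply: measurableT_comp.
rewrite !ge0_integral_std_normal//.
have mphi := @measurable_std_normal_pdf R.
have mfp : measurable_fun [set: R] (fun x => f x * (normal_pdf 0 1 x)%:E)%E.
  exact: emeasurable_funM.
have fp0 x : (0 <= f x * (normal_pdf 0 1 x)%:E)%E.
  by rewrite mule_ge0// lee_fin normal_pdf_ge0.
pose oN := (-%R : measurableTypeR R -> measurableTypeR R).
have moN : measurable_fun [set: measurableTypeR R] oN by exact: oppr_measurable.
transitivity (\int[pushforward leb oN]_x (f x * (normal_pdf 0 1 x)%:E))%E.
  rewrite (ge0_integral_pushforward moN leb measurableT mfp (fun x _ => fp0 x)).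
  by apply: eq_integral => x _ /=; rewrite !std_normal_pdfE sqrrN.
pose nu := measure_function_pushforward__canonical__measure_function_Measure leb moN.
by apply: (@eq_measure_integral _ _ _ _ leb nu) => A mA _; exact: lebesgue_measureN.
Qed.

Lemma PhiN c : Phi (- c) = 1 - Phi c.
Proof.
apply: EFin_inj; rewrite -std_normal_itvNy -std_normal_itvy.
have m1 : measurable [set x | c < x].
  by rewrite (_ : [set x | c < x] = `]c, +oo[%classic)//; apply/seteqP; split => x /=; rewrite in_itv/= andbT.
have m2 : measurable [set x | - c < x].
  by rewrite (_ : [set x | - c < x] = `](- c), +oo[%classic)//; apply/seteqP; split => x /=; rewrite in_itv/= andbT.
have E1 (A : set R) : measurable A -> N A = (\int[N]_x (\1_A x)%:E)%E.
  by move=> mA; rewrite integral_indic// setIT.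
have -> : N `]-oo, (- c)]%classic = N [set x : R | x < - c].
  have -> : [set x : R | x < - c] = `]-oo, (- c)[%classic.
    by apply/seteqP; split => x /=; rewrite in_itv.
  transitivity (\int[leb]_(x in `]-oo, (- c)%R]) (normal_pdf 0 1 x)%:E)%E => //.
  transitivity (\int[leb]_(x in `]-oo, (- c)%R[) (normal_pdf 0 1 x)%:E)%E => //.
  by rewrite integral_itv_bndo_bndc//; apply: measurable_funTS; exact: measurable_std_normal_pdf.
have m3 : measurable [set x : R | x < - c].
  by rewrite (_ : [set x | x < - c] = `]-oo, (- c)[%classic)//; apply/seteqP; split => x /=; rewrite in_itv/=.
apply: (etrans (E1 _ m3)); apply: esym; apply: (etrans (E1 _ m1)).
have mI : measurable_fun [set: R] (fun x => (\1_[set x : R | x < - c] x : R)%:E).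
  by apply/measurable_EFinP; exact: measurable_indic.
rewrite -[RHS](ge0_integral_std_normalN mI)//.
apply: eq_integral => x _; rewrite !indicE.
congr ((nat_of_bool _)%:R%:E); apply/idP/idP; by rewrite !inE/= ltrN2.
Qed.

(** By symmetry this is an upper tail, and Chebyshev's inequality applies with second moment 1. *)
Lemma Phi_tail t : 0 < t -> Phi (- t) <= t ^- 2.
Proof.
move=> t0; rewrite PhiN -lee_fin -std_normal_itvy.
have mA : measurable [set x | t < x].
  by rewrite (_ : [set x | t < x] = `]t, +oo[%classic)//; apply/seteqP; split => x /=; rewrite in_itv/= andbT.
have -> : (t ^- 2)%:E = (\int[N]_x ((t ^- 2)%:E * (x ^+ 2)%:E))%E.
  rewrite ge0_integralTZl; first last.
  - by rewrite invr_ge0 exprn_ge0// ltW.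
  - by move=> x; rewrite lee_fin sqr_ge0.
  - by apply/measurable_EFinP; exact: measurable_funX.
  have F : (\int[N]_x (x ^+ 2)%:E)%E \is a fin_num.
    by apply: integrable_fin_num => //; exact: std_normal_integrableX.
  by rewrite -(fineK F) (_ : fine _ = 1) ?mule1//; exact: std_normal_moment2.
rewrite -[X in (N X <= _)%E]setIT -integral_indic//; apply: ge0_le_integralT.
- by apply/measurable_EFinP; exact: measurable_indic.
- apply: emeasurable_funM => //; apply/measurable_EFinP; exact: measurable_funX.
- by move=> x; rewrite lee_fin.
move=> x; rewrite -EFinM lee_fin indicE; case: (boolP (x \in _)) => [|_].
  rewrite inE/= => tx; rewrite ler_pdivlMl ?exprn_gt0// mulr1.
  by rewrite lerXn2r ?nnegrE ?(ltW t0)// ltW// (lt_trans t0).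
by rewrite mulr_ge0 ?sqr_ge0// invr_ge0 exprn_ge0// ltW.
Qed.

Lemma continuous_Phi : continuous (@Phi R).
Proof.
move=> x; apply/cvgrPdist_le => e e0; near=> y.
have xy : `|x - y| <= e by near: y; apply: cvgr_dist_le.
move: xy; rewrite !ler_norml => /andP[h1 h2].
have := @Phi_le_addr x y e; have := @Phi_le_addr y x e.
move=> A B; have {}A := A ltac:(lra) (ltW e0); have {}B := B ltac:(lra) (ltW e0).
by apply/andP; split; lra.
Unshelve. all: by end_near. Qed.

Lemma quantile_exists (p : R) : 0 < p < 1 -> exists H, Phi H = p.
Proof.
move=> /andP[p0 p1].
pose q := Num.min p (1 - p).
have q0 : 0 < q by rewrite /q lt_min p0 subr_gt0.
(* With this t, [Phi_tail] gives Phi (- t) <= q, so p lies between Phi (- t) and Phi t. *)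
pose t := (Num.sqrt q)^-1.
have t0 : 0 < t by rewrite invr_gt0 sqrtr_gt0.
have tq : Phi (- t) <= q.
  by apply: le_trans (Phi_tail t0) _; rewrite /t exprVn invrK sqr_sqrtr// ltW.
have ntt : - t <= t by lra.
have [| c _ <-] := @IVT R Phi (- t) t p ntt (continuous_subspaceT continuous_Phi); last by exists c.
have [qp qp'] : q <= p /\ q <= 1 - p by rewrite /q; split; rewrite ge_min lexx ?orbT.
have := PhiN t => E; rewrite minElt maxElt; have Pt : Phi (- t) <= Phi t by exact: Phi_nondecreasing.
by case: ltP => h; apply/andP; split; lra.
Qed.

End Phi_facts.

Section clt.
Context {R : realType}.
Notation N := (std_normal R).
Notation V := (seq_space R).
Variable mu : probability V R.
Hypothesis Hres : resampling mu.

Definition chi_sum (w : nat -> R) n (y : V) : R :=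
  \sum_(k < n) w k * ((y k : R) ^+ 2 - 1).

Lemma measurable_chi_sum w n : measurable_fun [set: V] (chi_sum w n).
Proof.
apply: (@measurable_coord_sum _ n (fun k x => w k * (x ^+ 2 - 1))) => k.
by apply: measurable_funM => //; apply: measurable_funB => //; exact: measurable_funX.
Qed.

Lemma measurable_gtset d (T : measurableType d) (h : T -> R) c :
  measurable_fun [set: T] h -> measurable [set t | c < h t].
Proof.
move=> mh; have := mh measurableT `]c, +oo[%classic (measurable_itv _).
by rewrite setTI; congr measurable; apply/seteqP; split => t /=; rewrite in_itv/= andbT.
Qed.

Lemma measurable_leset d (T : measurableType d) (h : T -> R) c :
  measurable_fun [set: T] h -> measurable [set t | c <= h t].
Proof.
move=> mh; have := @measurable_fun_le _ T R [set: T] (cst c) h measurableT (measurable_cst _) mh.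
by rewrite setTI.
Qed.

Lemma integral_indicT d (T : measurableType d) (P : probability T R) (A : set T) :
  measurable A -> (\int[P]_t (\1_A t)%:E = P A)%E.
Proof. by move=> mA; rewrite integral_indic// setIT. Qed.

(** The indicator of (c, +oo) is smoothed over a width 3 rho, which costs 3 rho because Phi is
    1-Lipschitz. The second error is Lindeberg's: rescaling by rho makes the Taylor constant 4 / 3 /
    rho^3, and the cubes of the weights add up to at most w0 / 2. *)
Lemma clt_bound (w : nat -> R) n (w0 rho c : R) :
  (forall k, 0 <= w k <= w0) -> \sum_(k < n) (w k) ^+ 2 = 2^-1 -> 0 < rho ->
  let e := 3 * rho + 2 / 3 / rho ^+ 3 * lindeberg_const * w0 in
  (mu [set y : V | (c < chi_sum w n y)%R] <= (1 - Phi c + e)%:E /\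
   (1 - Phi c - e)%:E <= mu [set y : V | (c < chi_sum w n y)%R])%E.
Proof.
move=> ww0 w2 rho0 e.
have w0' k : 0 <= w k by case/andP: (ww0 k).
have w00 : 0 <= w0 by case/andP: (ww0 0%N) => a b; exact: le_trans b.
set K := 4 / 3 / rho ^+ 3.
have K0 : 0 <= K by rewrite /K divr_ge0// ?exprn_ge0// ltW.
have lc0 := @lindeberg_const_ge0 R.
pose f c x : R := smooth_step ((x - c) / rho).
have mlin (b : R) : measurable_fun [set: R] (fun x => (x - b) / rho).
  by apply: measurable_funM => //; exact: measurable_funB.
have mf b : measurable_fun [set: R] (f b).
  exact: (measurableT_comp measurable_smooth_step (mlin b)).
have f01 b x : 0 <= f b x <= 1 by exact: smooth_step01.
have [s1 [s2 sT]] := @smooth_step_taylor R.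
have fT b a h : `|f b (a + h) - f b a - s1 ((a - b) / rho) / rho * h
     - s2 ((a - b) / rho) / rho ^+ 2 * h ^+ 2| <= K * `|h| ^+ 3.
  have := sT ((a - b) / rho) (h / rho).
  rewrite (_ : 4 / 3 * `|h / rho| ^+ 3 = K * `|h| ^+ 3); last first.
    by rewrite normrM normfV (gtr0_norm rho0) exprMn exprVn /K; ring.
  apply: le_trans; rewrite le_eqVlt; apply/orP; left; apply/eqP; congr `|_|.
  rewrite /f (_ : (a + h - b) / rho = (a - b) / rho + h / rho); last by rewrite -mulrDl addrAC.
  by rewrite exprMn exprVn; ring.
have sc : \sum_(k < n) K * lindeberg_const * w k ^+ 3 <= 2 / 3 / rho ^+ 3 * lindeberg_const * w0.
  apply: (@le_trans _ _ (\sum_(k < n) K * lindeberg_const * w0 * w k ^+ 2)).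
    apply: ler_sum => k _; rewrite -[leRHS]mulrA; apply: ler_wpM2l.
      exact: mulr_ge0.
    by rewrite exprS; apply: ler_wpM2r; [exact: sqr_ge0|case/andP: (ww0 k)].
  rewrite -mulr_sumr w2 /K le_eqVlt; apply/orP; left; apply/eqP; field.
  by rewrite gt_eqF.
set S := chi_sum w n; have mS : measurable_fun [set: V] S := measurable_chi_sum w n.
have lind b := lindeberg Hres (mf b) (f01 b) (fT b) K0 w0' n 0.
have tau1 : Num.sqrt (\sum_(k < n) 2 * w k ^+ 2) = 1 :> R.
  by rewrite -mulr_sumr w2 divff// sqrtr1.
have {}lind b : (\int[mu]_y (f b (S y))%:E <= \int[N]_x (f b x)%:E +
     (2 / 3 / rho ^+ 3 * lindeberg_const * w0)%:E /\
   \int[N]_x (f b x)%:E <= \int[mu]_y (f b (S y))%:E +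
     (2 / 3 / rho ^+ 3 * lindeberg_const * w0)%:E)%E.
  have := lind b; rewrite tau1.
  under eq_integral do rewrite add0r.
  under [(\int[N]_x _)%E]eq_integral do rewrite add0r mul1r.
  move=> [h1 h2]; split.
    by apply: (le_trans h1); rewrite leeD2l// lee_fin.
  by apply: (le_trans h2); rewrite leeD2l// lee_fin.
have flo b x : (\1_[set x | b + 3 * rho < x] x <= f b x)%R.
  rewrite indicE; case: (boolP (x \in _)); last by case/andP: (f01 b x).
  rewrite inE/= => bx; rewrite /f smooth_step_ge3// ler_pdivlMr//; lra.
have fup b x : (f b x <= \1_[set x | b < x] x)%R.
  rewrite indicE; case: (boolP (x \in _)); first by case/andP: (f01 b x).
  rewrite notin_setE/= => /negP; rewrite -leNgt => bx.
  by rewrite /f smooth_step_le0// ler_pdivrMr//; lra.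
have mEf b : measurable_fun [set: R] (EFin \o f b) by exact/measurable_EFinP.
have f0 b x : (0 <= (f b x)%:E)%E by rewrite lee_fin; case/andP: (f01 b x).
have mfS b : measurable_fun [set: V] (fun y => (f b (S y))%:E).
  exact: (measurableT_comp (mEf b) mS).
have mid b : measurable [set x : R | b < x] by exact: measurable_gtset.
have mIS b : measurable [set y : V | b < S y] by exact: measurable_gtset.
have mI d (T : measurableType d) (A : set T) : measurable A ->
    measurable_fun [set: T] (fun t => (\1_A t : R)%:E).
  by move=> mA; apply/measurable_EFinP; exact: measurable_indic.
split.
(* A step starting at c - 3 rho has reached 1 at c and lies above the indicator. For the other
   inequality the step starts at c and lies below it. *)
- apply: (@le_trans _ _ (\int[mu]_y (f (c - 3 * rho) (S y))%:E)%E).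
    rewrite -integral_indicT//; apply: ge0_le_integralT => //; try exact: mI.
    move=> y; rewrite lee_fin; apply: le_trans (flo _ _).
    by rewrite subrK !indicE.
  have [h1 _] := lind (c - 3 * rho); apply: (le_trans h1).
  apply: (@le_trans _ _ (N [set x : R | (c - 3 * rho < x)%R] + (2 / 3 / rho ^+ 3 * lindeberg_const * w0)%:E)%E).
    rewrite leeD2r// -(integral_indicT N (mid _)); apply: ge0_le_integralT => //; try exact: mEf; try (by apply: mI; exact: mid).
    by move=> x; rewrite lee_fin.
  rewrite std_normal_itvy -EFinD lee_fin /e.
  have := @Phi_le_addr R (c - 3 * rho) c (3 * rho); rewrite subrK => /(_ (lexx _)).
  have rho3 : 0 <= 3 * rho by rewrite mulr_ge0// ltW.
  by move=> /(_ rho3); lra.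
- apply: (@le_trans _ _ (\int[mu]_y (f c (S y))%:E)%E); last first.
    rewrite -integral_indicT//; apply: ge0_le_integralT => //; try exact: mI.
    by move=> y; rewrite lee_fin; apply: (le_trans (fup _ _)); rewrite !indicE.
  have [_ h2] := lind c.
  have h3 : ((1 - Phi (c + 3 * rho))%:E <= \int[N]_x (f c x)%:E)%E.
    rewrite -std_normal_itvy -(integral_indicT N (mid _)); apply: ge0_le_integralT => //; try exact: mEf; try (by apply: mI; exact: mid).
    by move=> x; rewrite lee_fin.
  have := le_trans h3 h2.
  have fin : (\int[mu]_y (f c (S y))%:E)%E \is a fin_num.
    rewrite ge0_fin_numE; last by apply: integral_ge0 => y _.
    apply: (@le_lt_trans _ _ (\int[mu]_y 1)%E); last by rewrite integral_probability_cst ltry.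
    apply: ge0_le_integralT => //.
    by move=> y; rewrite lee_fin; case/andP: (f01 c (S y)).
  rewrite -(fineK fin) -EFinD !lee_fin /e.
  have rho3 : 0 <= 3 * rho by rewrite mulr_ge0// ltW.
  have := @Phi_le_addr R c (c + 3 * rho) (3 * rho) (lexx _) rho3.
  lra.
Qed.

End clt.

Section uniform_clt.
Context {R : realType}.
Notation V := (seq_space R).

(** Half of [delta] pays for the smoothing and half for the replacement. The bound [om] is uniform
    in n, w and c, as needed for weights and critical values that vary with the noise level. *)
Lemma clt (delta : R) : 0 < delta -> exists2 om : R, 0 < om &
  forall (mu : probability V R), resampling mu ->
  forall (w : nat -> R) n, (forall k, 0 <= w k <= om) ->
    \sum_(k < n) (w k) ^+ 2 = 2^-1 -> forall c,
  (mu [set y : V | (c < chi_sum w n y)%R] <= (1 - Phi c + delta)%:E /\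
   (1 - Phi c - delta)%:E <= mu [set y : V | (c < chi_sum w n y)%R])%E.
Proof.
move=> d0; have lc0 := @lindeberg_const_ge0 R.
pose rho := delta / 6; have rho0 : 0 < rho by rewrite divr_gt0.
pose A : R := 2 / 3 / rho ^+ 3 * lindeberg_const.
have A0 : 0 <= A by rewrite mulr_ge0// divr_ge0// exprn_ge0// ltW.
exists (delta / 2 / (A + 1)); first by rewrite divr_gt0 ?divr_gt0//; lra.
move=> mu Hres w n ww w2 c.
have [h1 h2] := clt_bound Hres c ww w2 rho0.
have He : 3 * rho + 2 / 3 / rho ^+ 3 * lindeberg_const * (delta / 2 / (A + 1)) <= delta.
  rewrite -/A (_ : 3 * rho = delta / 2); last by rewrite /rho; field.
  rewrite (_ : A * _ = (delta / 2) * (A / (A + 1))); last by ring.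
  have : A / (A + 1) <= 1 by rewrite ler_pdivrMr; lra.
  move=> hA; have : delta / 2 * (A / (A + 1)) <= delta / 2 * 1 by rewrite ler_wpM2l//; lra.
  lra.
split; [apply: (le_trans h1)|apply: le_trans h2]; rewrite lee_fin; lra.
Qed.

End uniform_clt.

(** * Power of the threshold tests and sign mixtures *)

Section cosh_bound.
Context {R : realType}.
Implicit Types x y a b : R.

Lemma is_derive_le (f df : R -> R) a b :
  (forall x : R, is_derive x (1 : R) f (df x)) ->
  (forall x, a < x -> 0 <= df x) -> a <= b -> f a <= f b.
Proof.
move=> dF df0; rewrite le_eqVlt => /predU1P[->//|ab].
have cf : {within `[a, b], continuous f}.
  apply: continuous_subspaceT => x; apply: differentiable_continuous.
  by apply/derivable1_diffP; have [] := dF x.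
have [c] := MVT ab (fun x _ => dF x) cf.
rewrite in_itv/= => /andP[ac _] E; rewrite -subr_ge0 E mulr_ge0 ?df0// subr_ge0.
exact: ltW.
Qed.

Let is_derive_eE x : is_derive x (1 : R) expR (expR x).
Proof. exact: is_derive_expR. Qed.

(** The logarithmic derivative of the quotient is tanh x - (x - x^3 / 3), so it suffices that tanh x
    >= x - x^3 / 3 for x >= 0, which is [G]. Differentiating once more reduces [G] to x cosh x >=
    sinh x, which is [M]. Here [s] and [c] are twice sinh and cosh. *)
Lemma cosh_ge x : expR (x ^+ 2 / 2 - x ^+ 4 / 12) <= (expR x + expR (- x)) / 2.
Proof.
wlog x0 : x / 0 <= x.
  move=> H; have [/H//|x0] := lerP 0 x.
  have := H (- x); rewrite oppr_ge0 (ltW x0) => /(_ isT).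
  by rewrite opprK sqrrN (exprNn x 4) -[(-1) ^+ 4]signr_odd/= mul1r (addrC (expR (- x))).
pose s y : R := expR y - expR (- y).
pose c y : R := expR y + expR (- y).
have dN y : is_derive y (1 : R) (fun y => expR (- y)) (- expR (- y)).
  by apply: is_derive_eq; rewrite /GRing.scale/=; ring.
have ds y : is_derive y (1 : R) s (c y).
  by have h1 := is_derive_eE y; have h2 := dN y; apply: is_derive_eq; rewrite /c; ring.
have dc y : is_derive y (1 : R) c (s y).
  by have h1 := is_derive_eE y; have h2 := dN y; apply: is_derive_eq; rewrite /s; ring.
have s0 : s 0 = 0 by rewrite /s oppr0 subrr.
have c0 y : 0 < c y by rewrite addr_gt0 ?expR_gt0.
have sge0 y : 0 <= y -> 0 <= s y.
  by move=> y0; rewrite -s0; apply: (is_derive_le ds) => // z _; exact: ltW.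
have M y : 0 <= y -> 0 <= y * c y - s y.
  move=> y0; have dM (z : R) : is_derive z (1 : R) (fun z => z * c z - s z) (z * s z).
    have h1 := ds z; have h2 := dc z; apply: is_derive_eq.
    by rewrite /GRing.scale/=; ring.
  have -> : 0 = 0 * c 0 - s 0 by rewrite s0; ring.
  apply: (is_derive_le dM) => // z z0; rewrite mulr_ge0 ?sge0//; exact: ltW.
have G y : 0 <= y -> 0 <= s y - (y - y ^+ 3 / 3) * c y.
  move=> y0; have dG (z : R) : is_derive z (1 : R) (fun z => s z - (z - z ^+ 3 / 3) * c z)
      (z * (z * c z - s z) + z ^+ 3 / 3 * s z).
    have h1 := ds z; have h2 := dc z; apply: is_derive_eq.
    by rewrite /GRing.scale/=; field.
  have -> : 0 = s 0 - (0 - 0 ^+ 3 / 3) * c 0 by rewrite s0; ring.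
  apply: (is_derive_le dG) => // z z0.
  by rewrite addr_ge0 ?mulr_ge0 ?divr_ge0 ?exprn_ge0 ?sge0 ?M//; exact: ltW.
pose F y : R := c y * expR (- (y ^+ 2 / 2 - y ^+ 4 / 12)).
have dF (z : R) : is_derive z (1 : R) F
    ((s z - (z - z ^+ 3 / 3) * c z) * expR (- (z ^+ 2 / 2 - z ^+ 4 / 12))).
  have h1 := ds z; have h2 := dc z; apply: is_derive_eq.
  by rewrite /GRing.scale/=; field.
have : F 0 <= F x.
  apply: (is_derive_le dF) => // z z0; rewrite mulr_ge0 ?expR_ge0// G//; exact: ltW.
rewrite /F /c !(expr0n, mul0r, oppr0, subr0, expR0, mulr1)/= [expR (- (_ - _))]expRN.
by rewrite ler_pdivlMr ?expR_gt0// => h; rewrite ler_pdivlMr//; lra.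
Qed.

End cosh_bound.

Section second_moments.
Context {R : realType}.
Notation N := (std_normal R).

Lemma integral_sqr_quadratic (a b w : R) :
  (\int[N]_x ((a + (w * (x ^+ 2 - 1) + b * x)) ^+ 2)%:E =
   (a ^+ 2 + (2 * w ^+ 2 + b ^+ 2))%:E)%E.
Proof.
have [i v] := integral_std_normal_poly4 ((a - w) ^+ 2) (2 * (a - w) * b)
  (b ^+ 2 + 2 * (a - w) * w) (2 * b * w) (w ^+ 2).
under eq_integral => x _.
  rewrite (_ : (a + (w * (x ^+ 2 - 1) + b * x)) ^+ 2 = (a - w) ^+ 2 + 2 * (a - w) * b * x +
   (b ^+ 2 + 2 * (a - w) * w) * x ^+ 2 + 2 * b * w * x ^+ 3 + w ^+ 2 * x ^+ 4); last by ring.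
  over.
rewrite -[LHS]fineK; last exact: integrable_fin_num i.
by congr EFin; apply: (etrans v); ring.
Qed.

(** The variance of x^4 under N(0, 1), which controls the quartic remainder left by [cosh_ge]. *)
Definition quartic_variance : R := \int[N]_x ((x ^+ 4 - 3) ^+ 2).

Lemma integral_sqr_quartic (a b : R) :
  (\int[N]_x ((a + b * (x ^+ 4 - 3)) ^+ 2)%:E =
   (a ^+ 2 + b ^+ 2 * quartic_variance)%:E)%E.
Proof.
have [i v] := integral_std_normal_poly4 (a ^+ 2 - 6 * a * b) 0 0 0 (2 * a * b).
have Pi : N.-integrable [set: R] (EFin \o (fun x : R => (x ^+ 4 - 3) ^+ 2)).
  have := std_normal_integrable_poly (('X^4 - 3%:P) ^+ 2 : {poly R}).
  by apply: eq_integrable => // x _; rewrite /= !hornerE.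
have Pi' : N.-integrable [set: R] (EFin \o (fun x : R => b ^+ 2 * (x ^+ 4 - 3) ^+ 2)).
  by have := integrableZl measurableT (b ^+ 2) Pi; apply: eq_integrable.
have E : (fun x : R => (a + b * (x ^+ 4 - 3)) ^+ 2) = (fun x =>
  (a ^+ 2 - 6 * a * b + 0 * x + 0 * x ^+ 2 + 0 * x ^+ 3 + 2 * a * b * x ^+ 4) +
    b ^+ 2 * (x ^+ 4 - 3) ^+ 2) by apply/funext => x; ring.
rewrite (_ : (fun x : R => ((a + b * (x ^+ 4 - 3)) ^+ 2)%:E) =
  EFin \o (fun x => (a + b * (x ^+ 4 - 3)) ^+ 2))// E.
have iE := integrableD measurableT i Pi'.
rewrite -[LHS]fineK; last by apply: integrable_fin_num => //; move: iE; apply: eq_integrable.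
congr EFin; apply: (etrans (RintegralD measurableT i Pi')).
by rewrite v RintegralZl// /quartic_variance; ring.
Qed.

Lemma quartic_variance_ge0 : 0 <= quartic_variance.
Proof. by apply: Rintegral_ge0 => x _; exact: sqr_ge0. Qed.

End second_moments.

Section power.
Context {R : realType}.
Notation V := (seq_space R).

Lemma measurable_lesetr d (T : measurableType d) (h : T -> R) c :
  measurable_fun [set: T] h -> measurable [set t | h t <= c].
Proof.
move=> mh; have := @measurable_fun_le _ T R [set: T] h (cst c) measurableT mh (measurable_cst _).
by rewrite setTI.
Qed.

(** The statistic is S + L + h: centred chi-squares, a linear cross term and the mean h. While h <=
    C the cross term is negligible and the central limit theorem handles S. For h > C the cross term
    may dominate, but the threshold is then at least h / 4 below the mean and Chebyshev's inequality
    suffices. *)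
Lemma power_bound (delta K : R) : 0 < delta -> exists2 om : R, 0 < om &
  forall (mu : probability V R), resampling mu ->
  forall (w e : nat -> R) n H, (forall k, 0 <= w k <= om) ->
    \sum_(k < n) (w k) ^+ 2 = 2^-1 ->
    let h := \sum_(k < n) w k * e k ^+ 2 in
    H <= h / 2 + K ->
  (mu [set y : V | (\sum_(k < n) w k * ((e k + y k) ^+ 2 - 1) <= H)%R]
     <= (Phi (H - h) + delta)%:E)%E.
Proof.
move=> d0; have d30 : 0 < delta / 3 by rewrite divr_gt0.
have [om1 om10 Hclt] := @clt R _ d30.
(* 4 |K| gives h - H >= h / 4 once h > C, 32 / delta makes 16 / C at most delta / 2, and 1 ensures h
   <= h^2. *)
pose C : R := 4 * `|K| + 32 / delta + 1.
have C1 : 1 <= C by rewrite lerDr addr_ge0 ?mulr_ge0 ?invr_ge0// ltW.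
have CK : 4 * K <= C.
  have : K <= `|K| by rewrite ler_norm.
  have : 0 <= 32 / delta by rewrite divr_ge0// ltW.
  by rewrite /C; lra.
have Cd : 16 / C <= delta / 2.
  rewrite ler_pdivrMr; last lra.
  have : 32 / delta <= C by rewrite /C; have := normr_ge0 K; lra.
  rewrite ler_pdivrMr//; lra.
(* For h <= C the error has three equal parts: the central limit theorem, the shift of Phi by rho,
   and P(|L| >= rho), where [om3] makes the variance of L at most rho^2 delta / 3. *)
pose rho := delta / 3.
have rho2 : 0 < rho ^+ 2 by rewrite exprn_gt0.
pose om2 := delta / 128; pose om3 := delta * rho ^+ 2 / (12 * C).
have om20 : 0 < om2 by rewrite divr_gt0.
have om30 : 0 < om3 by rewrite divr_gt0 ?mulr_gt0//; lra.
exists (Num.min om1 (Num.min om2 om3)); first by rewrite !lt_min om10 om20.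
move=> mu Hres w e n H ww w2 h HhK.
have [ww1 ww2 ww3] : [/\ forall k, 0 <= w k <= om1, forall k, 0 <= w k <= om2 & forall k, 0 <= w k <= om3].
  by split=> k; have /andP[-> /=] := ww k; rewrite !le_min => /and3P[].
have w0 k : 0 <= w k by case/andP: (ww k).
have h0 : 0 <= h by apply: sumr_ge0 => k _; rewrite mulr_ge0// sqr_ge0.
(* The left side is the variance of the cross term. *)
have cross (om : R) : (forall k, 0 <= w k <= om) ->
    \sum_(k < n) (2 * w k * e k) ^+ 2 <= 4 * om * h.
  move=> wom; rewrite /h mulr_sumr; apply: ler_sum => k _.
  have /andP[_ wo] := wom k.
  rewrite (_ : (2 * w k * e k) ^+ 2 = w k * (4 * (w k * e k ^+ 2))); last by ring.
  rewrite (_ : 4 * om * _ = om * (4 * (w k * e k ^+ 2))); last by ring.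
  by rewrite ler_wpM2r// mulr_ge0// mulr_ge0// sqr_ge0.
have mchi : forall k, measurable_fun [set: R] (fun x : R => w k * (x ^+ 2 - 1)).
  by move=> k; apply: measurable_funM => //; apply: measurable_funB => //; exact: measurable_funX.
have mlin : forall k, measurable_fun [set: R] (fun x : R => 2 * w k * e k * x).
  by move=> k; exact: measurable_funM.
pose S := chi_sum w n; pose L (y : V) : R := \sum_(k < n) 2 * w k * e k * (y k : R).
have tE (y : V) : \sum_(k < n) w k * ((e k + y k) ^+ 2 - 1) = S y + L y + h.
  by rewrite /S /chi_sum /L /h -!big_split/=; apply: eq_bigr => k _; ring.
have mS : measurable_fun [set: V] S := measurable_chi_sum w n.
have mL : measurable_fun [set: V] L := measurable_coord_sum n mlin.
have -> : [set y : V | (\sum_(k < n) w k * ((e k + y k) ^+ 2 - 1) <= H)%R] =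
    [set y : V | (S y + L y <= H - h)%R].
  by apply/seteqP; split => y /=; rewrite tE lerBrDr.
have mA : measurable [set y : V | (S y + L y <= H - h)%R].
  by apply: measurable_lesetr; exact: measurable_funD.
have [hC|hC] := lerP h C.
- have mB : measurable [set y : V | (S y <= H - h + rho)%R] by exact: measurable_lesetr.
  have mD : measurable [set y : V | (rho <= `|L y|)%R].
    by apply: measurable_leset; exact: measurableT_comp.
  apply: (@le_trans _ _ (mu [set y : V | (S y <= H - h + rho)%R] + mu [set y : V | (rho <= `|L y|)%R])%E).
    apply: (le_trans _ (measureU2 mu mB mD)).
    apply: le_measure; rewrite ?inE//; first exact: measurableU.
    move=> y /= SL; have [?|b] := lerP rho `|L y|; [by right|left].
    by move: b; rewrite ltr_norml => /andP[? ?]; lra.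
  have -> : [set y : V | (S y <= H - h + rho)%R] = ~` [set y : V | (H - h + rho < S y)%R].
    by apply/seteqP; split => y /=; [move=> a; apply/negP; rewrite -leNgt|move/negP; rewrite -leNgt].
  rewrite probability_setC; last exact: measurable_gtset.
  have [_ c1] := Hclt mu Hres w n ww1 w2 (H - h + rho).
  have c2 := @chebyshev_coord_sum R mu Hres n _ (fun k => (2 * w k * e k) ^+ 2) rho mlin _ d30.
  have {}c2 : (mu [set y : V | (rho <= `|L y|)%R] <= (delta / 3)%:E)%E.
    apply: le_trans (c2 _) _.
      move=> k a; have := @integral_sqr_quadratic R a (2 * w k * e k) 0.
      under eq_integral do rewrite mul0r add0r.
      by move=> ->; congr EFin; ring.
    rewrite lee_fin ler_pdivrMr//; apply: (le_trans (cross om3 ww3)).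
    apply: (@le_trans _ _ (4 * om3 * C)).
      by rewrite ler_wpM2l// mulr_ge0// ltW.
    rewrite /om3 le_eqVlt; apply/orP; left; apply/eqP; field.
    by apply/eqP; lra.
  have pl : Phi (H - h + rho) <= Phi (H - h) + rho.
    by apply: Phi_le_addr => //; exact: ltW.
  have fS : mu [set y : V | (H - h + rho < S y)%R] \is a fin_num by rewrite fin_num_measure//; exact: measurable_gtset.
  have fL : mu [set y : V | (rho <= `|L y|)%R] \is a fin_num by rewrite fin_num_measure.
  move: c1 c2; rewrite -/S -(fineK fS) -(fineK fL) -EFinB -EFinD !lee_fin.
  by rewrite /rho in pl *; lra.
- have mg k : measurable_fun [set: R] (fun x : R => w k * (x ^+ 2 - 1) + 2 * w k * e k * x).
    exact: measurable_funD.
  have gap : h / 4 <= h - H by lra.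
  have gap0 : 0 < h - H by lra.
  have c := @chebyshev_coord_sum R mu Hres n _ (fun k => 2 * w k ^+ 2 + (2 * w k * e k) ^+ 2)
    (h - H) mg (fun k a => integral_sqr_quadratic a _ _) gap0.
  apply: (@le_trans _ _ (mu [set y : V | (h - H <= `|\sum_(k < n) (w k * ((y k : R) ^+ 2 - 1) + 2 * w k * e k * y k)|)%R])).
    apply: le_measure; rewrite ?inE//.
      by apply: measurable_leset; apply: measurableT_comp => //; exact: (measurable_coord_sum n mg).
    move=> y /=; rewrite big_split/= -/(chi_sum w n y) -/S -/(L y) => SL.
    by rewrite ler_normr; apply/orP; right; lra.
  apply: (le_trans c); rewrite lee_fin.
  apply: (@le_trans _ _ delta); last by rewrite lerDr Phi_ge0.
  rewrite ler_pdivrMr ?exprn_gt0// big_split/= -mulr_sumr w2 divff//.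
  have c4 := cross om2 ww2.
  apply: (@le_trans _ _ (1 + 4 * om2 * h)); first by rewrite lerD2l.
  apply: (@le_trans _ _ (delta * (h / 4) ^+ 2)); last first.
    by rewrite ler_pM2l// lerXn2r ?nnegrE//; lra.
  rewrite (_ : delta * (h / 4) ^+ 2 = delta / 2 * h ^+ 2 / 16 + delta / 2 * h ^+ 2 / 16); last by field.
  have h1 : 1 <= h by lra.
  have hh : h <= h ^+ 2 by rewrite expr2 ler_peMl.
  apply: lerD.
    rewrite ler_pdivlMr// mul1r.
    apply: (@le_trans _ _ (16 / C * h ^+ 2)); last by rewrite ler_wpM2r// sqr_ge0.
    rewrite mulrAC ler_pdivlMr; last lra.
    by rewrite ler_pM2l//; lra.
  rewrite (_ : 4 * om2 * h = delta / 2 * h / 16); last by rewrite /om2; field.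
  by rewrite ler_pM2r ?invr_gt0// ler_pM2l ?divr_gt0.
Qed.

End power.

(** * Lower bound for the risk against a sign mixture *)

Section layers.
Context {R : realType}.
Implicit Types r c : R.

(** The sum counts the integers among 1, ..., M below r. Together with [le_sum_thresholds] it
    recovers r up to 1, which is the layer-cake formula at unit steps. *)
Lemma sum_thresholds_le M r : 0 <= r -> \sum_(i < M) (i.+1%:R < r)%R%:R <= r.
Proof.
move=> r0; elim: M => [|M IH]; first by rewrite big_ord0.
rewrite big_ord_recr/=; have [Mr|_] := ltrP M.+1%:R r; last by rewrite addr0.
apply: le_trans (ltW Mr); rewrite -[M.+1]addn1 natrD lerD2r.
rewrite -[leRHS]mulr1 mulr_natl -[M in leRHS]card_ord -sumr_const.
by apply: ler_sum => i _; rewrite lern1 leq_b1.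
Qed.

Lemma le_sum_thresholds M r : r <= M.+1%:R ->
  r <= 1 + \sum_(i < M) (i.+1%:R < r)%R%:R.
Proof.
elim: M => [|M IH] rM; first by rewrite big_ord0 addr0.
rewrite big_ord_recr/=; have [Mr|rM1] := ltrP M.+1%:R r; last first.
  by rewrite addr0; exact: IH.
rewrite (eq_bigr (fun=> 1)) => [|i _]; last first.
  by rewrite (lt_trans _ Mr)// ltr_nat ltnS.
by rewrite sumr_const card_ord [X in _ + X]natr1 addrC natr1.
Qed.

Lemma integral_sum_indic d (T : measurableType d) (P : probability T R) M c
    (A : nat -> set T) : 0 <= c -> (forall i, measurable (A i)) ->
  (\int[P]_t (c * \sum_(i < M) \1_(A i) t)%:E =
   (c * \sum_(i < M) fine (P (A i)))%:E)%E.
Proof.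
move=> c0 mA; have mI i : measurable_fun [set: T] (\1_(A i) : T -> R).
  exact: measurable_indic.
elim: M => [|M IH].
  by under eq_integral do rewrite big_ord0 mulr0; rewrite integral0 big_ord0 mulr0.
under eq_integral do rewrite big_ord_recr/= mulrDr EFinD.
rewrite ge0_integralTD; first last.
- by move=> t; rewrite lee_fin mulr_ge0.
- by move=> t; rewrite lee_fin mulr_ge0// sumr_ge0.
- by apply/measurable_EFinP; exact: measurable_funM.
- by apply/measurable_EFinP; apply: measurable_funM => //; apply: measurable_sum.
rewrite IH big_ord_recr/= mulrDr EFinD; congr (_ + _)%E.
under eq_integral do rewrite EFinM.
rewrite ge0_integralTZl//; last by apply/measurable_EFinP.
by rewrite integral_indicT// EFinM fineK// fin_num_measure.
Qed.

End layers.

Section truncated_exponential.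
Context {R : realType}.
Notation N := (std_normal R).
Implicit Types u H x : R.

(* Truncated likelihood ratio of N(u, 1) against N(0, 1); its integral is the
   Neyman-Pearson risk with critical value H. *)
Definition trunc_expR u H x : R := Num.min (expR (u * H - u ^+ 2 / 2)) (expR (u * x - u ^+ 2 / 2)).

Lemma measurable_expR_lin u (c : R) : measurable_fun [set: R] (fun x => expR (u * x - c)).
Proof. by apply: measurableT_comp => //; apply: measurable_funB. Qed.

(** The two arguments of the minimum cross at x = H. Below H the integrand is the likelihood ratio
    of N(u, 1), and the shift formula gives Phi (H - u); above H it is constant. *)
Lemma integral_trunc_expR u H : 0 < u ->
  (\int[N]_x (trunc_expR u H x)%:E =
   (Phi (H - u) + expR (u * H - u ^+ 2 / 2) * (1 - Phi H))%:E)%E.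
Proof.
move=> u0; set T := expR _.
have mle : measurable [set x : R | x <= H] by exact: measurable_lesetr.
have mgt : measurable [set x : R | H < x] by exact: measurable_gtset.
have mI (A : set R) : measurable A -> measurable_fun [set: R] (fun x => (\1_A x : R)%:E).
  by move=> mA; apply/measurable_EFinP; exact: measurable_indic.
have mIe : measurable_fun [set: R] (fun x => (\1_[set x | x <= H] x)%:E * (expR (u * x - u ^+ 2 / 2))%:E)%E.
  apply: emeasurable_funM; first exact: mI.
  by apply/measurable_EFinP; exact: measurable_expR_lin.
have E x : (trunc_expR u H x)%:E = ((\1_[set x | x <= H] x)%:E * (expR (u * x - u ^+ 2 / 2))%:E +
    T%:E * (\1_[set x | H < x] x)%:E)%E.
  rewrite -!EFinM -EFinD !indicE; congr EFin; rewrite /trunc_expR.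
  case: (lerP x H) => xH.
    rewrite mem_set// memNset//=; last by apply/negP; rewrite -leNgt.
    rewrite mul1r mulr0 addr0 min_r// ler_expR lerD2r ler_pM2l//.
  rewrite memNset//=; last by apply/negP; rewrite -ltNge.
  rewrite mem_set// mul0r add0r mulr1 min_l// ler_expR lerD2r ler_pM2l//.
  exact: ltW.
under eq_integral do rewrite E.
have T0 : 0 <= T by exact: expR_ge0.
rewrite ge0_integralTD; first last.
- by move=> x; rewrite mule_ge0// lee_fin.
- by move=> x; rewrite mule_ge0// lee_fin ?expR_ge0.
- by apply: emeasurable_funM => //; exact: mI.
- exact: mIe.
rewrite ge0_integralTZl//; last exact: mI.
rewrite integral_indicT// std_normal_itvy [in RHS]EFinD [in RHS]EFinM; congr (_ + _)%E.
rewrite -(@ge0_integral_std_normal_shift R (fun x => (\1_[set x | x <= H] x)%:E) u)//; last exact: mI.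
rewrite -std_normal_itvNy -integral_indicT//.
apply: eq_integral => x _; rewrite !indicE; congr ((nat_of_bool _)%:R%:E).
by apply/idP/idP; rewrite !inE/= in_itv/= lerBrDr.
Qed.

Lemma gt_trunc_expR u H x (t : R) : 0 < u -> 0 < t -> t < expR (u * H - u ^+ 2 / 2) ->
  (t < trunc_expR u H x) = ((ln t + u ^+ 2 / 2) / u < x).
Proof.
move=> u0 t0 tT; rewrite /trunc_expR lt_min tT/= ltr_pdivrMr// (mulrC x).
have E : expR (ln t) = t by rewrite lnK// posrE.
by rewrite -{1}E ltr_expR ltrBrDr.
Qed.

(** Superlevel sets of a nondecreasing function are half-lines, so slicing the range into M + 1
    layers of height T / (M + 1) sandwiches the function between combinations of tail indicators.
    Its expectation under any law is thereby reduced to M tail probabilities. *)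
Lemma trunc_expR_layers u H M : 0 < u ->
  exists2 xs : nat -> R,
    forall x, expR (u * H - u ^+ 2 / 2) / M.+1%:R * \sum_(i < M) \1_[set z | xs i < z] x
      <= trunc_expR u H x
  & forall x, trunc_expR u H x <= expR (u * H - u ^+ 2 / 2) / M.+1%:R +
      expR (u * H - u ^+ 2 / 2) / M.+1%:R * \sum_(i < M) \1_[set z | xs i < z] x.
Proof.
move=> u0; set T := expR _; have T0 : 0 < T by exact: expR_gt0.
pose tau := T / M.+1%:R; have tau0 : 0 < tau by rewrite divr_gt0.
pose xs i := (ln (tau * i.+1%:R) + u ^+ 2 / 2) / u.
have E x : \sum_(i < M) \1_[set z | xs i < z] x = \sum_(i < M) (i.+1%:R < trunc_expR u H x / tau)%R%:R :> R.
  apply: eq_bigr => i _; rewrite indicE; congr ((nat_of_bool _)%:R).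
  rewrite ltr_pdivlMr// mulrC gt_trunc_expR//.
  - by apply/idP/idP; rewrite inE.
  - by rewrite mulr_gt0.
  - rewrite -/T /tau mulrAC ltr_pdivrMr// ltr_pM2l// ltr_nat ltnS.
    exact: ltn_ord.
have g0 x : 0 <= trunc_expR u H x by rewrite le_min !expR_ge0.
exists xs => x; rewrite E -/tau.
  rewrite -ler_pdivlMl// [leRHS]mulrC; apply: sum_thresholds_le.
  by rewrite divr_ge0// ltW.
rewrite -{1}[tau]mulr1 -mulrDr -ler_pdivrMl// [leLHS]mulrC; apply: le_sum_thresholds.
rewrite ler_pdivrMr// /tau mulrC divfK// /trunc_expR ge_min lexx //.
Qed.

End truncated_exponential.

Section mixture_lower.
Context {R : realType}.
Notation N := (std_normal R).
Notation V := (seq_space R).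

(** [cosh_ge] is applied factor by factor. Since v_k^4 = 4 u^2 w_k^2, the means 3 v_k^4 / 12 of the
    quartic terms add up to u^2 / 2, and what remains of them is centred. *)
Lemma mixture_lr_ge (v w : nat -> R) n (u : R) (y : V) :
  (forall k, v k ^+ 2 = 2 * u * w k) -> \sum_(k < n) (w k) ^+ 2 = 2^-1 ->
  expR (u * chi_sum w n y - u ^+ 2 / 2 -
    \sum_(k < n) v k ^+ 4 / 12 * ((y k : R) ^+ 4 - 3)) <= mixture_lr v n y.
Proof.
move=> vw w2.
have -> : u * chi_sum w n y - u ^+ 2 / 2 -
    \sum_(k < n) v k ^+ 4 / 12 * ((y k : R) ^+ 4 - 3) =
    \sum_(k < n) ((v k * (y k : R)) ^+ 2 / 2 - (v k * (y k : R)) ^+ 4 / 12 - v k ^+ 2 / 2).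
  have -> : u ^+ 2 / 2 = \sum_(k < n) v k ^+ 4 / 4.
    under eq_bigr => k _.
      rewrite (_ : v k ^+ 4 / 4 = u ^+ 2 * w k ^+ 2); last first.
        by rewrite (exprM _ 2 2) vw; field.
      over.
    by rewrite -mulr_sumr w2.
  rewrite /chi_sum mulr_sumr -sumrB -sumrB; apply: eq_bigr => k _.
  by rewrite !exprMn vw; field.
rewrite expR_sum; apply: ler_prod => k _; rewrite expR_ge0/=.
rewrite expRD /cosh_factor mulNr ler_wpM2r ?expR_ge0//.
exact: cosh_ge.
Qed.

(** When |Q| < rho, exp (- Q) >= 1 - rho, so replacing the Gaussian ratio by L loses at most a
    fraction rho of the truncation level. Otherwise the whole truncation level is given up. *)
Lemma trunc_expR_le_mixture (u H S Q L rho : R) : 0 <= rho ->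
  expR (u * S - u ^+ 2 / 2 - Q) <= L ->
  trunc_expR u H S <= Num.min (expR (u * H - u ^+ 2 / 2)) L +
    expR (u * H - u ^+ 2 / 2) * rho +
    expR (u * H - u ^+ 2 / 2) * (rho <= `|Q|)%R%:R.
Proof.
rewrite /trunc_expR; set T := expR (u * H - _); set X := expR (u * S - _) => rho0 XL.
have T0 : 0 < T by exact: expR_gt0.
have X0 : 0 < X by exact: expR_gt0.
have TX : Num.min T X <= T by rewrite ge_min lexx.
have TX' : Num.min T X <= X by rewrite ge_min lexx orbT.
have L0 : 0 <= L by apply: le_trans XL; exact: expR_ge0.
have [hQ|hQ] := lerP rho `|Q|.
  rewrite mulr1; apply: (le_trans TX); rewrite lerDr addr_ge0 ?mulr_ge0//.
    by rewrite le_min L0 ltW.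
  exact: ltW.
rewrite mulr0 addr0.
have LX : (1 - rho) * X <= L.
  apply: le_trans XL; rewrite expRD mulrC ler_pM2l//.
  apply: le_trans (expR_ge1Dx _); rewrite lerD2l lerN2.
  by move: hQ; rewrite ltr_norml => /andP[_ /ltW].
have T'rho : 0 <= T * rho by rewrite mulr_ge0// ltW.
case: (lerP T L) => TL; first by lra.
have : Num.min T X * (1 - rho) <= L \/ Num.min T X * (1 - rho) <= 0.
  have [r1|r1] := lerP rho 1; last first.
    by right; rewrite pmulr_rle0 ?lt_min ?T0//; lra.
  left; apply: le_trans LX; rewrite mulrC ler_wpM2l//; lra.
have : Num.min T X * rho <= T * rho by rewrite ler_wpM2r.
by move=> h1 [h2|h2]; lra.
Qed.

(** Four errors of at most T d4 <= delta / 4 each: the height of one layer, the central limit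
    theorem on the layers, the factor 1 - d4, and the event that the quartic remainder exceeds d4.
    [Tm] bounds the truncation level T over u <= C and H <= Hm. *)
Lemma mixture_lower (delta C Hm : R) : 0 < delta -> 0 < C -> exists2 om : R, 0 < om &
  forall (mu : probability V R), resampling mu ->
  forall (w v : nat -> R) n (u H : R), (forall k, 0 <= w k <= om) ->
    \sum_(k < n) (w k) ^+ 2 = 2^-1 -> 0 < u <= C -> H <= Hm ->
    (forall k, v k ^+ 2 = 2 * u * w k) ->
  ((Phi (H - u) + expR (u * H - u ^+ 2 / 2) * (1 - Phi H) - delta)%:E <=
   \int[mu]_y (Num.min (expR (u * H - u ^+ 2 / 2)) (mixture_lr v n y))%:E)%E.
Proof.
move=> d0 C0; pose Tm := expR (C * `|Hm|).
have Tm0 : 0 < Tm by exact: expR_gt0.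
pose d4 := delta / 4 / Tm; have d40 : 0 < d4 by rewrite !divr_gt0.
have [om1 om10 Hclt] := @clt R _ d40.
have qv0 := @quartic_variance_ge0 R.
(* The variance of the quartic remainder is then at most d4^3, so Chebyshev's inequality at d4
   leaves probability d4. *)
pose om2 := d4 ^+ 2 * d4 / (quartic_variance * C ^+ 4 + 1).
have qC : 0 < quartic_variance * C ^+ 4 + 1 :> R.
  by rewrite ltr_wpDl// mulr_ge0// exprn_ge0// ltW.
have om20 : 0 < om2 by rewrite divr_gt0// mulr_gt0// exprn_gt0.
have [M HM] : exists M : nat, 1 / d4 <= M.+1%:R.
  exists (Num.truncn (1 / d4)); apply: ltW; rewrite truncnS_gt//.
exists (Num.min om1 (Num.min om2 1)); first by rewrite !lt_min om10 om20 ltr01.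
move=> mu Hres w v n u H ww w2 /andP[u0 uC] HHm vw.
have [ww1 ww2 ww3] : [/\ forall k, 0 <= w k <= om1, forall k, w k <= om2 & forall k, w k <= 1].
  by split=> k; have /andP[a] := ww k; rewrite !le_min => /and3P[]; rewrite ?a.
have w0 k : 0 <= w k by case/andP: (ww k).
set T := expR _; have T0 : 0 < T by exact: expR_gt0.
have TTm : T <= Tm.
  rewrite ler_expR; apply: (@le_trans _ _ (u * H)).
    by rewrite gerBl divr_ge0// sqr_ge0.
  apply: (@le_trans _ _ (u * `|Hm|)).
    by rewrite ler_pM2l// (le_trans HHm)// ler_norm.
  by rewrite ler_wpM2r.
have Td4 : T * d4 <= delta / 4.
  have -> : delta / 4 = Tm * d4 by rewrite /d4 [RHS]mulrC divfK// gt_eqF.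
  by rewrite ler_wpM2r// ltW.
have [xs xs1 xs2] := @trunc_expR_layers R u H M u0.
set tau := T / M.+1%:R in xs1 xs2.
have tau0 : 0 < tau by rewrite divr_gt0.
have taud : tau <= T * d4.
  rewrite /tau ler_pM2l// -[d4]invrK lef_pV2 ?posrE ?invr_gt0// -div1r; exact: HM.
set S := chi_sum w n; have mS : measurable_fun [set: V] S := measurable_chi_sum w n.
pose b k := v k ^+ 4 / 12.
pose Q (y : V) : R := \sum_(k < n) b k * ((y k : R) ^+ 4 - 3).
have mq k : measurable_fun [set: R] (fun x : R => b k * (x ^+ 4 - 3)).
  by apply: measurable_funM => //; apply: measurable_funB => //; exact: measurable_funX.
have mQ : measurable_fun [set: V] Q := measurable_coord_sum n mq.
have mB : measurable [set y : V | (d4 <= `|Q y|)%R].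
  by apply: measurable_leset; exact: measurableT_comp.
have mA i : measurable [set y : V | (xs i < S y)%R] by exact: measurable_gtset.
have mAN i : measurable [set x : R | (xs i < x)%R] by exact: measurable_gtset.
set L := mixture_lr v n; have mL : measurable_fun [set: V] L := measurable_mixture_lr v n.
have L0 y : 0 <= L y by exact: mixture_lr_ge0.
have muQ : (mu [set y : V | (d4 <= `|Q y|)%R] <= d4%:E)%E.
  have c := @chebyshev_coord_sum R mu Hres n _ (fun k => b k ^+ 2 * quartic_variance) d4 mq
    (fun k a => integral_sqr_quartic a (b k)) d40.
  apply: (le_trans c); rewrite lee_fin ler_pdivrMr ?exprn_gt0//.
  apply: (@le_trans _ _ (\sum_(k < n) quartic_variance * C ^+ 4 * om2 * w k ^+ 2)).
    apply: ler_sum => k _.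
    have -> : b k ^+ 2 * quartic_variance = quartic_variance * (u ^+ 4 / 9 * (w k * w k)) * w k ^+ 2.
      by rewrite /b (exprM _ 2 2) vw; field.
    rewrite ler_wpM2r ?sqr_ge0// -[leRHS]mulrA ler_wpM2l//.
    have u4 : u ^+ 4 <= C ^+ 4 by rewrite lerXn2r// nnegrE ltW.
    have u40 : 0 <= u ^+ 4 by rewrite exprn_ge0// ltW.
    have ww' : w k * w k <= om2.
      by rewrite -[leRHS]mul1r ler_pM.
    apply: ler_pM => //; first by rewrite divr_ge0.
      by rewrite mulr_ge0.
    by lra.
  rewrite -mulr_sumr w2.
  have -> : d4 * d4 ^+ 2 = (quartic_variance * C ^+ 4 + 1) * om2.
    by rewrite /om2 [LHS]mulrC [RHS]mulrC divfK// gt_eqF.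
  have : 0 <= quartic_variance * C ^+ 4 * om2.
    by apply: mulr_ge0; [apply: mulr_ge0 => //; rewrite exprn_ge0// ltW|exact: ltW].
  by lra.
have mInt : measurable_fun [set: V] (fun y => (Num.min T (L y))%:E).
  by apply/measurable_EFinP; apply: measurable_minr.
have Int0 y : (0 <= (Num.min T (L y))%:E)%E by rewrite lee_fin le_min L0 ltW.
have step1 : (\int[mu]_y (tau * \sum_(i < M) \1_[set y | (xs i < S y)%R] y)%:E <=
    \int[mu]_y (Num.min T (L y))%:E + (T * d4)%:E + T%:E * mu [set y : V | (d4 <= `|Q y|)%R])%E.
  have mI : measurable_fun [set: V] (fun y => (\1_[set y : V | (d4 <= `|Q y|)%R] y : R)%:E).
    by apply/measurable_EFinP; exact: measurable_indic.
  have -> : (\int[mu]_y (Num.min T (L y))%:E + (T * d4)%:E + T%:E * mu [set y : V | (d4 <= `|Q y|)%R] =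
     \int[mu]_y ((Num.min T (L y))%:E + (T * d4)%:E + T%:E * (\1_[set y : V | (d4 <= `|Q y|)%R] y)%:E))%E.
    have Td0 : 0 <= T * d4 by rewrite mulr_ge0// ltW.
    rewrite ge0_integralTD; first last.
    - by move=> y; rewrite mule_ge0// lee_fin// ltW.
    - by move=> y; rewrite adde_ge0// lee_fin.
    - by apply: emeasurable_funM => //.
    - by apply: emeasurable_funD => //.
    rewrite ge0_integralTD//.
    by rewrite integral_probability_cst ge0_integralTZl ?integral_indicT// ltW.
  apply: ge0_le_integralT.
  - apply/measurable_EFinP; apply: measurable_funM => //; apply: measurable_sum => i.
    exact: measurable_indic.
  - apply: emeasurable_funD; first by apply: emeasurable_funD.
    by apply: emeasurable_funM.
  - by move=> y; rewrite lee_fin mulr_ge0 ?sumr_ge0// ltW.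
  - move=> y; rewrite -EFinM -!EFinD lee_fin.
    have := xs1 (S y) => h; apply: le_trans (h) _.
    have := @trunc_expR_le_mixture u H (S y) (Q y) (L y) d4 (ltW d40) (mixture_lr_ge y vw w2).
    rewrite -/T indicE (_ : (y \in _) = (d4 <= `|Q y|)); first exact.
    by apply/idP/idP; rewrite inE.
have step2 : (\int[N]_x (trunc_expR u H x)%:E <= (tau + tau * \sum_(i < M) fine (N [set x : R | (xs i < x)%R]))%:E)%E.
  have iN := @integral_sum_indic R _ _ N M tau (fun i => [set x : R | xs i < x]) (ltW tau0) mAN.
  rewrite EFinD -iN.
  rewrite -[X in (_ <= X + _)%E](@integral_probability_cst _ _ _ N) -ge0_integralTD//; first last.
  - by move=> x; rewrite lee_fin mulr_ge0 ?sumr_ge0// ltW.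
  - by move=> x; rewrite lee_fin ltW.
  - apply/measurable_EFinP; apply: measurable_funM => //; apply: measurable_sum => i.
    exact: measurable_indic.
  apply: ge0_le_integralT.
  - apply/measurable_EFinP; apply: measurable_minr => //; exact: measurable_expR_lin.
  - apply: emeasurable_funD => //.
    apply/measurable_EFinP; apply: measurable_funM => //; apply: measurable_sum => i.
    exact: measurable_indic.
  - by move=> x; rewrite lee_fin le_min !expR_ge0.
  - by move=> x; rewrite -EFinD lee_fin.
rewrite integral_trunc_expR// lee_fin -/T in step2.
rewrite (@integral_sum_indic R _ _ mu M tau (fun i => [set y : V | xs i < S y]) (ltW tau0) mA) in step1.
have fI : (\int[mu]_y (Num.min T (L y))%:E)%E \is a fin_num.
  rewrite ge0_fin_numE; last exact: integral_ge0.
  apply: (@le_lt_trans _ _ (\int[mu]_y T%:E)%E); last by rewrite integral_probability_cst ltry.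
  by apply: ge0_le_integralT => // y; rewrite lee_fin ge_min lexx.
have fQ : mu [set y : V | (d4 <= `|Q y|)%R] \is a fin_num by rewrite fin_num_measure.
rewrite -(fineK fQ) lee_fin in muQ.
rewrite -(fineK fI) lee_fin; rewrite -(fineK fI) -(fineK fQ) -EFinM -!EFinD lee_fin in step1.
(* Each of the M layers contributes an error tau d4, and (M + 1) tau = T. *)
have step3 : tau * \sum_(i < M) fine (N [set x : R | (xs i < x)%R]) <=
    tau * \sum_(i < M) fine (mu [set y : V | (xs i < S y)%R]) + T * d4.
  have -> : T * d4 = tau * (\sum_(i < M.+1) d4).
    by rewrite sumr_const card_ord -mulr_natl /tau mulrA divfK.
  rewrite -mulrDr ler_pM2l// big_ord_recr/= addrA -big_split/=.
  apply: (@le_trans _ _ (\sum_(i < M) (fine (mu [set y : V | (xs i < S y)%R]) + d4))); last first.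
    by rewrite lerDl ltW.
  apply: ler_sum => i _.
  have [_ h] := Hclt mu Hres w n ww1 w2 (xs i).
  have fA : mu [set y : V | (xs i < S y)%R] \is a fin_num by rewrite fin_num_measure.
  rewrite -/S -(fineK fA) lee_fin in h.
  have := std_normal_itvy (xs i) => /(congr1 fine) /= ->.
  by lra.
have : T * fine (mu [set y : V | (d4 <= `|Q y|)%R]) <= T * d4 by rewrite ler_pM2l.
lra.
Qed.

End mixture_lower.

(** * The extreme problem *)

Section power_sums.
Context {R : realType}.
Implicit Types s t x y m q : R.

Lemma le_powR x y s : 0 <= s -> 0 <= x -> x <= y -> x `^ s <= y `^ s.
Proof. by move=> s0 x0 xy; apply: ge0_ler_powR => //; rewrite nnegrE//; exact: le_trans xy. Qed.

(* Young's inequality [conjugate_powR] at b = 1. *)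
Lemma bernoulli_powR t s : 0 <= t -> 1 < s -> 1 + s * (t - 1) <= t `^ s.
Proof.
move=> t0 s1; have s0 : 0 < s by lra.
have s10 : 0 < s - 1 by lra.
have q0 : 0 < s / (s - 1) by rewrite divr_gt0.
have := @conjugate_powR R t 1 s (s / (s - 1)) t0 ler01 s0 q0.
rewrite powR1 mulr1 mul1r invf_div => H.
have {}H := H ltac:(field; by rewrite gt_eqF).
have : s * t <= s * (t `^ s / s + (s - 1) / s) by rewrite ler_pM2l.
by rewrite mulrDr ![s * (_ / s)]mulrC !divfK ?gt_eqF//; lra.
Qed.

(** Bernoulli's inequality at x / y, multiplied by y^s: the power function lies above its tangent at
    y. *)
Lemma powR_tangent_le x y s : 0 <= x -> 0 < y -> 1 < s ->
  y `^ s - x `^ s <= s * y `^ (s - 1) * (y - x).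
Proof.
move=> x0 y0 s1; have := @bernoulli_powR (x / y) s (divr_ge0 x0 (ltW y0)) s1.
have ys : 0 < y `^ s by exact: powR_gt0.
rewrite -(ler_pM2l ys) -powRM ?divr_ge0// ?(ltW y0)// [y * _]mulrC divfK ?gt_eqF//.
have -> : y `^ s = y * y `^ (s - 1) by rewrite mulr_powRB1// ?ltW//; lra.
rewrite (_ : _ * _ * (1 + _) = y * y `^ (s - 1) + s * y `^ (s - 1) * (x - y)).
  by move=> h; lra.
by field; rewrite gt_eqF.
Qed.

Lemma powR_tangent_ge x y s : 0 < x -> 0 <= y -> 1 < s ->
  s * x `^ (s - 1) * (y - x) <= y `^ s - x `^ s.
Proof.
move=> x0 y0 s1; have := @powR_tangent_le y x s y0 x0 s1.
by rewrite -[in leLHS](opprB (y `^ s)) -[x - y]opprB mulrN lerN2.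
Qed.

(** The tangent inequalities place (q + 1) k^q between two consecutive increments of k^(q+1), and
    both sides telescope. *)
Lemma power_sum_bounds (q : R) n : 0 < q ->
  n%:R `^ (q + 1) / (q + 1) <= \sum_(k < n) (k.+1%:R : R) `^ q <= n.+1%:R `^ (q + 1) / (q + 1).
Proof.
move=> q0; have q1 : 0 < q + 1 by lra.
have q11 : 1 < q + 1 by lra.
elim: n => [|n /andP[IH1 IH2]].
  by rewrite big_ord0 powR0 ?gt_eqF// mul0r lexx/= divr_ge0 ?powR_ge0// ltW.
rewrite big_ord_recr/=.
have n1 : (0 : R) < n.+1%:R by rewrite ltr0n.
apply/andP; split.
  have := @powR_tangent_le n%:R n.+1%:R (q + 1) (ler0n _ _) n1 q11.
  rewrite -[n.+1%:R - n%:R]natrB// subSnn mulr1 addrK => h.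
  have : (n.+1%:R `^ (q + 1) - n%:R `^ (q + 1)) / (q + 1) <= n.+1%:R `^ q.
    by rewrite ler_pdivrMr// mulrC.
  rewrite mulrBl; lra.
have := @powR_tangent_ge n.+1%:R n.+2%:R (q + 1) n1 (ler0n _ _) q11.
rewrite -[n.+2%:R - n.+1%:R]natrB// subSnn mulr1 addrK => h.
have : n.+1%:R `^ q <= (n.+2%:R `^ (q + 1) - n.+1%:R `^ (q + 1)) / (q + 1).
  by rewrite ler_pdivlMr// mulrC.
rewrite mulrBl; lra.
Qed.

Lemma power_sum_asymp (q : R) : 0 < q -> exists C : R, forall m, 1 <= m ->
  `|(\sum_(k < Num.truncn m) (k.+1%:R : R) `^ q) / m `^ (q + 1) - (q + 1)^-1| <= C / m.
Proof.
move=> q0; have q1 : 0 < q + 1 by lra.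
have q11 : 1 < q + 1 by lra.
(* The lower deviation is at most 1 / m and the upper one at most 2^q / m, the latter from (1 + 1 /
   m)^q <= 2^q. *)
exists (2 `^ q + 1) => m m1; have m0 : 0 < m by lra.
have /andP[t1 t2] := truncn_itv (ltW m0).
set n := Num.truncn m in t1 t2 *.
have /andP[S1 S2] := @power_sum_bounds q n q0.
set S := \sum_(k < n) _ in S1 S2 *.
have ms : 0 < m `^ (q + 1) by exact: powR_gt0.
have lo : (1 - (q + 1) / m) / (q + 1) <= S / m `^ (q + 1).
  rewrite ler_pdivlMr// (le_trans _ S1)// mulrAC ler_pM2r ?invr_gt0//.
  have B := @bernoulli_powR (n%:R / m) (q + 1) (divr_ge0 (ler0n _ _) (ltW m0)) q11.
  have -> : n%:R `^ (q + 1) = (n%:R / m) `^ (q + 1) * m `^ (q + 1).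
    by rewrite -powRM ?divr_ge0 ?(ltW m0)// divfK// gt_eqF.
  rewrite ler_pM2r//; apply: le_trans B; rewrite lerD2l -mulrN ler_pM2l//.
  by rewrite lerBrDr ler_pdivlMr// mulrDl mulNr mulVf ?gt_eqF// mul1r; lra.
have up : S / m `^ (q + 1) <= (1 + (q + 1) * 2 `^ q / m) / (q + 1).
  rewrite ler_pdivrMr// (le_trans S2)// mulrAC ler_pM2r ?invr_gt0//.
  apply: (@le_trans _ _ ((1 + m^-1) `^ (q + 1) * m `^ (q + 1))).
    rewrite -powRM ?addr_ge0 ?invr_ge0 ?(ltW m0)//; apply: le_powR => //; first exact: ltW.
    by rewrite mulrDl mul1r mulVf ?gt_eqF// -natr1 lerD2r.
  rewrite ler_pM2r//.
  have y0 : 0 < 1 + m^-1 by rewrite addr_gt0// invr_gt0.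
  have := @powR_tangent_le 1 (1 + m^-1) (q + 1) ler01 y0 q11.
  rewrite powR1 (addrC 1 m^-1) addrK addrK => h.
  have : (m^-1 + 1) `^ q <= 2 `^ q.
    apply: le_powR; [exact: ltW|by rewrite addr_ge0// invr_ge0 ltW|].
    have : m^-1 <= 1 by rewrite invf_le1.
    by lra.
  move=> h2.
  have : (q + 1) * (m^-1 + 1) `^ q * m^-1 <= (q + 1) * 2 `^ q * m^-1.
    by rewrite ler_pM2r ?invr_gt0// ler_pM2l.
  by lra.
rewrite ler_norml; apply/andP; split.
  apply: (@le_trans _ _ ((1 - (q + 1) / m) / (q + 1) - (q + 1)^-1)); last by lra.
  have -> : (1 - (q + 1) / m) / (q + 1) - (q + 1)^-1 = - m^-1.
    by field; rewrite !gt_eqF//.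
  rewrite lerN2 mulrDl mul1r lerDr divr_ge0 ?powR_ge0// ltW//.
apply: (@le_trans _ _ ((1 + (q + 1) * 2 `^ q / m) / (q + 1) - (q + 1)^-1)); first by lra.
have -> : (1 + (q + 1) * 2 `^ q / m) / (q + 1) - (q + 1)^-1 = 2 `^ q / m.
  by field; rewrite !gt_eqF//.
by rewrite ler_pM2r ?invr_gt0// lerDl.
Qed.

End power_sums.

Section cut_sums.
Context {R : realType}.
Variables c : R.
Hypothesis c0 : 0 < c.
Implicit Types m p : R.

Definition cut m k : R := Num.max 0 (1 - (idx k / m) `^ c).

(** The two equations for (z, m) and the minimal sum of fourth powers are all expressed by such
    sums, with c = 2 alpha and p = 4 beta or p = 4 beta + 2 alpha. *)
Definition cut_sum p m : R := \sum_(k < Num.truncn m) idx k `^ p * cut m k.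

Lemma idx_gt0 k : 0 < idx k :> R. Proof. by rewrite ltr0n. Qed.

Lemma cut_ge0 m k : 0 <= cut m k. Proof. by rewrite le_max lexx. Qed.

Lemma cut_eq0 m k : 0 < m -> m <= idx k -> cut m k = 0.
Proof.
move=> m0 mk; apply/max_idPl; rewrite subr_le0 -[leLHS](_ : 1 `^ c = 1); last by rewrite powR1.
by apply: le_powR; [exact: ltW|exact: ler01|rewrite ler_pdivlMr// mul1r].
Qed.

Lemma cut_lt m k : 0 < m -> idx k <= m -> cut m k = 1 - idx k `^ c / m `^ c.
Proof.
move=> m0 km; rewrite /cut powRM ?invr_ge0 ?(ltW m0) ?(ltW (idx_gt0 k))//.
have -> : m^-1 `^ c = (m `^ c)^-1 by rewrite -powRN -powR_inv1 ?(ltW m0)// -powRrM mulN1r.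
apply/max_idPr; rewrite subr_ge0 ler_pdivrMr ?powR_gt0// mul1r.
by apply: le_powR => //; exact: ltW.
Qed.

Lemma cut_gt0 m k : 0 < m -> idx k < m -> 0 < cut m k.
Proof.
move=> m0 km; rewrite cut_lt ?ltW// subr_gt0 ltr_pdivrMr ?powR_gt0// mul1r.
by apply: gt0_ltr_powR; rewrite ?nnegrE ?(ltW m0) ?(ltW (idx_gt0 k)).
Qed.

Lemma cut_trunc m k : 0 < m -> (Num.truncn m <= k)%N -> cut m k = 0.
Proof.
move=> m0 mk; apply: cut_eq0 => //; rewrite /idx.
have /andP[_ h] := truncn_itv (ltW m0); apply: (le_trans (ltW h)).
by rewrite ler_nat ltnS.
Qed.

Lemma sum_widen (F : nat -> R) n n' : (n <= n')%N -> (forall k, (n <= k)%N -> F k = 0) ->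
  \sum_(k < n') F k = \sum_(k < n) F k.
Proof.
move=> nn F0; rewrite -!(big_mkord xpredT) (big_cat_nat (leq0n n) nn)//= [X in _ + X]big_nat_cond.
by rewrite [X in _ + X]big1 ?addr0// => i /andP[/andP[/F0]].
Qed.

Lemma cut_sumE p m n : 0 < m -> (Num.truncn m <= n)%N ->
  \sum_(k < n) idx k `^ p * cut m k = cut_sum p m.
Proof.
by move=> m0 mn; apply: (sum_widen (F := fun k => idx k `^ p * cut m k)) => // k mk; rewrite cut_trunc ?mulr0.
Qed.

Lemma trunc_idx m (k : 'I_(Num.truncn m)) : 0 < m -> idx k <= m.
Proof.
move=> m0; have /andP[h _] := truncn_itv (ltW m0); apply: le_trans h.
by rewrite /idx ler_nat.
Qed.

(** The integral of t^p (1 - t^c) over [0, 1]. *)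
Definition cut_limit p : R := (p + 1)^-1 - (p + c + 1)^-1.

Lemma cut_sum_asymp p : 0 < p ->
  cut_sum p m / m `^ (p + 1) @[m --> +oo] --> cut_limit p.
Proof.
move=> p0; have pc0 : 0 < p + c by rewrite addr_gt0.
have [C1 H1] := @power_sum_asymp R p p0; have [C2 H2] := @power_sum_asymp R (p + c) pc0.
apply/cvgrPdist_le => e e0; near=> m.
have m1 : 1 <= m by near: m; exact: nbhs_pinfty_ge.
have m0 : 0 < m by lra.
have mC : (C1 + C2) / e <= m by near: m; apply: nbhs_pinfty_ge; exact: num_real.
have -> : cut_sum p m / m `^ (p + 1) =
   (\sum_(k < Num.truncn m) (k.+1%:R : R) `^ p) / m `^ (p + 1) -
   (\sum_(k < Num.truncn m) (k.+1%:R : R) `^ (p + c)) / m `^ (p + c + 1).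
  rewrite !mulr_suml -sumrB; apply: eq_bigr => k _; rewrite cut_lt//; last exact: trunc_idx.
  have -> : m `^ (p + c + 1) = m `^ (p + 1) * m `^ c.
    by rewrite -powRD; [rewrite addrAC|rewrite (gt_eqF m0) implybT].
  rewrite /idx [_ `^ (p + c)]powRD; last by rewrite pnatr_eq0 implybT.
  by field; rewrite !gt_eqF ?powR_gt0.
have h1 := H1 m m1; have h2 := H2 m m1; rewrite /cut_limit.
rewrite (_ : _ - _ - (_ - _) = - (\sum_(k < Num.truncn m) (k.+1%:R : R) `^ p / m `^ (p + 1) - (p + 1)^-1) +
  (\sum_(k < Num.truncn m) (k.+1%:R : R) `^ (p + c) / m `^ (p + c + 1) - (p + c + 1)^-1)); last first.
  by rewrite !mulr_suml; ring.
rewrite -!mulr_suml; apply: (le_trans (ler_normD _ _)); rewrite normrN.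
apply: (le_trans (lerD h1 h2)); rewrite -mulrDl ler_pdivrMr// mulrC -ler_pdivrMr//.
Unshelve. all: by end_near. Qed.

Lemma cut_limit_gt0 p : 0 < p -> 0 < cut_limit p.
Proof.
by move=> p0; have c0' := c0; rewrite subr_gt0 ltf_pV2 ?posrE; lra.
Qed.

(** The gap between these limits governs the minimal sum of fourth powers, which is a difference of
    the two cut sums; it makes the leading constant positive and the weights small. *)
Lemma cut_limit_lt p : 0 < p -> cut_limit (p + c) < cut_limit p.
Proof.
move=> p0; have c0' := c0; rewrite -subr_gt0.
have -> : cut_limit p - cut_limit (p + c) =
    2 * c ^+ 2 / ((p + 1) * (p + c + 1) * (p + c + c + 1)).
  by rewrite /cut_limit; field; rewrite !gt_eqF//; lra.
by rewrite divr_gt0 ?mulr_gt0 ?exprn_gt0//; lra.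
Qed.

End cut_sums.

Section nonneg_series.
Context {R : realType}.
Implicit Types F : nat -> R.

Lemma eseries_finite_support F n : (forall k, (n <= k)%N -> F k = 0) ->
  (\sum_(0 <= k <oo) (F k)%:E = (\sum_(k < n) F k)%:E)%E.
Proof.
move=> F0; apply: lim_near_cst => //; near=> N.
rewrite /= big_mkord sumEFin; congr EFin; apply: (sum_widen (F := F)) => //.
by near: N; exact: nbhs_infty_ge.
Unshelve. all: by end_near. Qed.

Lemma partial_sum_le_eseries F n : (forall k, 0 <= F k) ->
  ((\sum_(k < n) F k)%:E <= \sum_(0 <= k <oo) (F k)%:E)%E.
Proof.
move=> F0; rewrite -sumEFin -(big_mkord xpredT (fun k => (F k)%:E)).
by apply: nneseries_lim_ge => k _ _; rewrite lee_fin.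
Qed.

Lemma eseries_le_bound F (B : \bar R) : (forall k, 0 <= F k) ->
  (forall n, ((\sum_(k < n) F k)%:E <= B)%E) -> (\sum_(0 <= k <oo) (F k)%:E <= B)%E.
Proof.
move=> F0 FB; apply: lime_le.
  by apply: is_cvg_nneseries => k _ _; rewrite lee_fin.
by apply: nearW => n /=; rewrite big_mkord sumEFin.
Qed.

End nonneg_series.

Section extreme_problem.
Context {R : realType}.
Variables alpha beta : R.
Hypotheses (halpha : 0 < alpha) (hbeta : 0 < beta).
Implicit Types (r z m eps : R) (eta : nat -> R).

Notation a := (a_poly alpha).
Notation sigma := (sigma_poly beta).
Notation c := (2 * alpha).
Notation x := (eta_tilde2 alpha beta).
Notation NN := (cut_sum c (4 * beta)).
Notation DD := (cut_sum c (4 * beta + c)).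

Let c0 : 0 < c. Proof. by rewrite mulr_gt0. Qed.

Lemma idx_powRD k (s t : R) : idx k `^ (s + t) = idx k `^ s * idx k `^ t.
Proof. by rewrite powRD// (gt_eqF (idx_gt0 k)) implybT. Qed.

Lemma eta_tilde2E z m k : x z m k = z ^+ 2 * (idx k `^ (2 * beta) * cut c m k).
Proof. by rewrite /eta_tilde2 -mulrA. Qed.

Lemma eta_tilde2_ge0 z m k : 0 <= x z m k.
Proof. by rewrite eta_tilde2E mulr_ge0 ?sqr_ge0// mulr_ge0 ?powR_ge0 ?cut_ge0. Qed.

Lemma eta_tilde2_eq0 z m k : 0 < m -> (Num.truncn m <= k)%N -> x z m k = 0.
Proof. by move=> m0 mk; rewrite eta_tilde2E cut_trunc// !mulr0. Qed.

Lemma sigma_sqr k : sigma k ^+ 2 = idx k `^ (2 * beta).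
Proof. by rewrite /sigma_poly -powR_mulrn ?powR_ge0// -powRrM mulrC. Qed.

Lemma a_sigma_sqr eta k :
  `|a k * sigma k * eta k| ^+ 2 = idx k `^ (c + 2 * beta) * eta k ^+ 2.
Proof.
rewrite real_normK ?num_real// !exprMn sigma_sqr idx_powRD; congr (_ * _ * _).
by rewrite /a_poly -powR_mulrn ?powR_ge0// -powRrM mulrC.
Qed.

Lemma eta_tilde2_sigma z m k : idx k `^ (2 * beta) * x z m k = z ^+ 2 * (idx k `^ (4 * beta) * cut c m k).
Proof.
rewrite eta_tilde2E (_ : 4 * beta = 2 * beta + 2 * beta) ?idx_powRD; last by ring.
by ring.
Qed.

Lemma eta_tilde2_a_sigma z m k : idx k `^ (c + 2 * beta) * x z m k =
  z ^+ 2 * (idx k `^ (4 * beta + c) * cut c m k).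
Proof.
rewrite eta_tilde2E (_ : 4 * beta + c = c + 2 * beta + 2 * beta) ?idx_powRD; last by ring.
by ring.
Qed.

(** The cut vanishes from index [Num.truncn m] on, so both series are finite sums. *)
Lemma solvesP r z m : solves_extreme_system alpha beta r z m <->
  [/\ 0 < z, 0 < m, z ^+ 2 * NN m = r ^+ 2 & z ^+ 2 * DD m = 1].
Proof.
have E (m0 : 0 < m) :
    (\sum_(0 <= k <oo) (idx k `^ (2 * beta) * x z m k)%:E = (z ^+ 2 * NN m)%:E)%E /\
    (\sum_(0 <= k <oo) (idx k `^ (c + 2 * beta) * x z m k)%:E = (z ^+ 2 * DD m)%:E)%E.
  split; rewrite (@eseries_finite_support _ _ (Num.truncn m)) /cut_sum ?mulr_sumr.
  - by congr EFin; apply: eq_bigr => k _; exact: eta_tilde2_sigma.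
  - by move=> k mk; rewrite eta_tilde2_eq0// mulr0.
  - by congr EFin; apply: eq_bigr => k _; exact: eta_tilde2_a_sigma.
  - by move=> k mk; rewrite eta_tilde2_eq0// mulr0.
split=> -[z0 m0 h1 h2]; have [E1 E2] := E m0; split => //.
- by apply: EFin_inj; rewrite -E1.
- by apply: EFin_inj; rewrite -E2.
- by rewrite E1 h1.
- by rewrite E2 h2.
Qed.

Lemma idx_div_powR m k : 0 < m -> (idx k / m) `^ c = idx k `^ c / m `^ c.
Proof.
move=> m0; rewrite powRM ?invr_ge0 ?(ltW m0) ?(ltW (idx_gt0 k))//.
by congr (_ * _); rewrite -powRN -powR_inv1 ?(ltW m0)// -powRrM mulN1r.
Qed.

(** Only one factor of the squared cut is expanded, as 1 - k^c / m^c; the other stays and produces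
    the two cut sums. *)
Lemma sum_eta_tilde4 z m : 0 < m ->
  \sum_(k < Num.truncn m) x z m k ^+ 2 = z ^+ 4 * (NN m - DD m / m `^ c).
Proof.
move=> m0; rewrite /cut_sum mulr_suml -sumrB mulr_sumr; apply: eq_bigr => k _.
rewrite eta_tilde2E cut_lt//; last exact: trunc_idx.
rewrite !idx_powRD (_ : 4 * beta = 2 * beta + 2 * beta) ?idx_powRD; last by ring.
by field; rewrite gt_eqF// powR_gt0.
Qed.

Section solution.
Variables r z m : R.
Hypothesis sol : solves_extreme_system alpha beta r z m.

Let z0 : 0 < z. Proof. by have [] := (solvesP r z m).1 sol. Qed.
Let m0 : 0 < m. Proof. by have [] := (solvesP r z m).1 sol. Qed.
Let h1 : z ^+ 2 * NN m = r ^+ 2. Proof. by have [] := (solvesP r z m).1 sol. Qed.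
Let h2 : z ^+ 2 * DD m = 1. Proof. by have [] := (solvesP r z m).1 sol. Qed.
Let n := Num.truncn m.

Definition min_pow4 : R := \sum_(k < n) x z m k ^+ 2.

Lemma min_pow4E : min_pow4 = z ^+ 2 * (r ^+ 2 - (m `^ c)^-1).
Proof.
rewrite /min_pow4 sum_eta_tilde4// -h1.
rewrite [X in _ = _ * (_ - X)](_ : _ = z ^+ 2 * DD m / m `^ c); last by rewrite h2 mul1r.
by ring.
Qed.

Lemma DD_gt0 : 0 < DD m.
Proof.
have : 0 < z ^+ 2 * DD m by rewrite h2.
by rewrite pmulr_rgt0// exprn_gt0.
Qed.

Lemma solution_dim_gt1 : 1 < m.
Proof.
rewrite ltNge; apply/negP => m1; have := DD_gt0.
rewrite /cut_sum big1 ?ltxx// => k _; rewrite cut_eq0 ?mulr0//.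
by apply: (le_trans m1); rewrite /idx ler1n.
Qed.

Lemma min_pow4_gt0 : 0 < min_pow4.
Proof.
have m1 := solution_dim_gt1.
have n0 : (0 < n)%N by rewrite truncn_gt0 ltW.
rewrite /min_pow4; case: {+}n n0 => // n' _; rewrite big_ord_recl/=.
apply: ltr_pwDl; last by apply: sumr_ge0 => k _; exact: sqr_ge0.
rewrite exprn_gt0// eta_tilde2E mulr_gt0 ?exprn_gt0// mulr_gt0 ?powR_gt0 ?idx_gt0//.
by apply: cut_gt0.
Qed.

(* As x_k >= z^2 sigma_k^2 (1 - m^-c a_k^2), the two constraints on eta enter with
   Lagrange multipliers z^2 and z^2 m^-c. *)
Lemma eta_tilde2_sum_ge eta : Theta2_r a sigma r eta ->
  min_pow4 <= \sum_(k < n) x z m k * eta k ^+ 2.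
Proof.
move=> [[_ e1] e2]; rewrite min_pow4E.
have mc : 0 < m `^ c by exact: powR_gt0.
set B := \sum_(k < n) _; rewrite -ler_pdivlMl ?exprn_gt0// lerBlDr -lee_fin.
apply: (le_trans e2); apply: eseries_le_bound => [k|N].
  by rewrite mulr_ge0 ?sqr_ge0.
rewrite lee_fin.
pose N' := maxn n N.
apply: (@le_trans _ _ (\sum_(k < N') sigma k ^+ 2 * eta k ^+ 2)).
  rewrite -!(big_mkord xpredT (fun k => sigma k ^+ 2 * eta k ^+ 2)).
  rewrite (big_cat_nat (leq0n N) (leq_maxr n N))//= lerDl.
  by apply: sumr_ge0 => k _; rewrite mulr_ge0 ?sqr_ge0.
have BE : B = \sum_(k < N') x z m k * eta k ^+ 2.
  apply/esym/(sum_widen (F := fun k => x z m k * eta k ^+ 2) (leq_maxl n N)) => k nk.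
  by rewrite eta_tilde2_eq0 ?mul0r.
have S1 : \sum_(k < N') idx k `^ (c + 2 * beta) * eta k ^+ 2 <= 1.
  rewrite -lee_fin; apply: le_trans e1.
  under eq_eseriesr do rewrite a_sigma_sqr.
  apply: partial_sum_le_eseries => k.
  by rewrite mulr_ge0 ?powR_ge0 ?sqr_ge0.
have : \sum_(k < N') sigma k ^+ 2 * eta k ^+ 2 -
    (\sum_(k < N') idx k `^ (c + 2 * beta) * eta k ^+ 2) / m `^ c <= (z ^+ 2)^-1 * B.
  rewrite BE mulr_suml -sumrB mulr_sumr; apply: ler_sum => k _.
  have -> : (z ^+ 2)^-1 * (x z m k * eta k ^+ 2) = idx k `^ (2 * beta) * cut c m k * eta k ^+ 2.
    by rewrite eta_tilde2E; field; rewrite gt_eqF.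
  rewrite sigma_sqr.
  rewrite [leLHS](_ : _ = idx k `^ (2 * beta) * (1 - idx k `^ c / m `^ c) * eta k ^+ 2).
    rewrite ler_wpM2r ?sqr_ge0// ler_wpM2l ?powR_ge0// /cut idx_div_powR//.
    by rewrite le_max lexx orbT.
  by rewrite idx_powRD; field; rewrite gt_eqF.
have : (\sum_(k < N') idx k `^ (c + 2 * beta) * eta k ^+ 2) / m `^ c <= (m `^ c)^-1.
  by rewrite ler_piMl// invr_ge0 ltW.
by rewrite addrC; lra.
Qed.

(** Expand eta_k^4 = (eta_k^2 - x_k)^2 + 2 x_k eta_k^2 - x_k^2 and apply [eta_tilde2_sum_ge] to the
    cross term. The squares are kept because they force uniqueness of the minimizer. *)
Lemma pow4_ge eta N : Theta2_r a sigma r eta ->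
  ((min_pow4 + \sum_(k < N) (eta k ^+ 2 - x z m k) ^+ 2)%:E <= sum_pow4 eta)%E.
Proof.
move=> he; have H := eta_tilde2_sum_ge he.
pose N' := maxn n N.
apply: (@le_trans _ _ (\sum_(k < N') eta k ^+ 4)%:E); last first.
  by apply: partial_sum_le_eseries => k; rewrite (exprM _ 2 2) sqr_ge0.
rewrite lee_fin; apply: (@le_trans _ _ (min_pow4 + \sum_(k < N') (eta k ^+ 2 - x z m k) ^+ 2)).
  rewrite lerD2l -!(big_mkord xpredT (fun k => (eta k ^+ 2 - x z m k) ^+ 2)).
  rewrite [leRHS](big_cat_nat (leq0n N) (leq_maxr n N))//= lerDl.
  by apply: sumr_ge0 => k _; exact: sqr_ge0.
have -> : \sum_(k < N') eta k ^+ 4 = \sum_(k < N') (eta k ^+ 2 - x z m k) ^+ 2 +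
   2 * \sum_(k < N') x z m k * eta k ^+ 2 - \sum_(k < N') x z m k ^+ 2.
  by rewrite mulr_sumr -big_split -sumrB/=; apply: eq_bigr => k _; ring.
have -> : \sum_(k < N') x z m k * eta k ^+ 2 = \sum_(k < n) x z m k * eta k ^+ 2.
  apply: (sum_widen (F := fun k => x z m k * eta k ^+ 2) (leq_maxl n N)) => k nk.
  by rewrite eta_tilde2_eq0 ?mul0r.
have -> : \sum_(k < N') x z m k ^+ 2 = min_pow4.
  apply: (sum_widen (F := fun k => x z m k ^+ 2) (leq_maxl n N)) => k nk.
  by rewrite eta_tilde2_eq0 ?expr0n.
by move: H; lra.
Qed.

Section realization.
Variable eta : nat -> R.
Hypothesis etaE : forall k, eta k ^+ 2 = x z m k.

Lemma pow4_realization : sum_pow4 eta = min_pow4%:E.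
Proof.
rewrite /sum_pow4 (@eseries_finite_support _ _ n) => [|k nk].
  by congr EFin; apply: eq_bigr => k _; rewrite (exprM _ 2 2) etaE.
by rewrite (exprM _ 2 2) etaE eta_tilde2_eq0// expr0n.
Qed.

(** The signs of eta are free, which is what makes every point of the sign mixture an
    alternative. *)
Lemma feasible_realization : Theta2_r a sigma r eta.
Proof.
have [_ _ s1 s2] := sol; split; [split|].
- rewrite /ell2/= (@eseries_finite_support _ _ n) ?ltry// => k nk.
  by rewrite etaE eta_tilde2_eq0.
- under eq_eseriesr do rewrite a_sigma_sqr etaE.
  by rewrite s2.
- under eq_eseriesr do rewrite sigma_sqr etaE.
  by rewrite s1.
Qed.

End realization.

Lemma sqrt_realization k : Num.sqrt (x z m k) ^+ 2 = x z m k.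
Proof. by rewrite sqr_sqrtr// eta_tilde2_ge0. Qed.

Lemma extreme_sequenceP eta : is_extreme_sequence a sigma r eta <->
  (forall k, eta k ^+ 2 = x z m k).
Proof.
split=> [[he hmin] k|etaE]; last first.
  split=> [|eta' he']; first exact: feasible_realization.
  rewrite pow4_realization//; apply: le_trans (pow4_ge 0 he').
  by rewrite big_ord0 addr0.
have := hmin _ (feasible_realization sqrt_realization).
rewrite (pow4_realization sqrt_realization) => le4.
have := le_trans (pow4_ge k.+1 he) le4.
rewrite lee_fin gerDl big_ord_recr/= => h.
have s0 : 0 <= \sum_(i < k) (eta i ^+ 2 - x z m i) ^+ 2.
  by apply: sumr_ge0 => i _; exact: sqr_ge0.
have : (eta k ^+ 2 - x z m k) ^+ 2 <= 0 by lra.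
move=> h'; apply/eqP; rewrite -subr_eq0 -sqrf_eq0 eq_le h' sqr_ge0//.
Qed.

Lemma extreme_valueE eps :
  extreme_value a sigma eps r = Num.sqrt ((2 * eps ^+ 4)^-1 * min_pow4).
Proof.
rewrite /extreme_value; congr (Num.sqrt (_ * _)).
suff -> : ereal_inf [set sum_pow4 eta | eta in Theta2_r a sigma r] = min_pow4%:E by [].
apply/eqP; rewrite eq_le; apply/andP; split.
  apply: ereal_inf_lbound; exists (fun k => Num.sqrt (x z m k)).
    exact: feasible_realization sqrt_realization.
  exact: pow4_realization sqrt_realization.
apply: le_ereal_inf_tmp => _ [eta he <-]; apply: le_trans (pow4_ge 0 he).
by rewrite big_ord0 addr0.
Qed.

Lemma weightsE k : weights alpha beta z m k = x z m k / Num.sqrt (2 * min_pow4).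
Proof.
rewrite /weights (@eseries_finite_support _ _ n)// => j nj.
by rewrite eta_tilde2_eq0// expr0n.
Qed.

Lemma weights_ge0 k : 0 <= weights alpha beta z m k.
Proof. by rewrite weightsE divr_ge0 ?eta_tilde2_ge0 ?sqrtr_ge0. Qed.

Lemma weights_eq0 k : (n <= k)%N -> weights alpha beta z m k = 0.
Proof. by move=> nk; rewrite weightsE eta_tilde2_eq0// mul0r. Qed.

Lemma sum_weights_sqr : \sum_(k < n) weights alpha beta z m k ^+ 2 = 2^-1.
Proof.
have V0 := min_pow4_gt0.
under eq_bigr do rewrite weightsE exprMn exprVn sqr_sqrtr ?mulr_ge0 ?(ltW V0)//.
by rewrite -mulr_suml -/min_pow4; field; rewrite gt_eqF.
Qed.

Lemma extreme_value_gt0 eps : 0 < eps -> 0 < extreme_value a sigma eps r.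
Proof.
move=> e0; rewrite extreme_valueE sqrtr_gt0 mulr_gt0 ?min_pow4_gt0//.
by rewrite invr_gt0 mulr_gt0// exprn_gt0.
Qed.

(** This form shows the normalizing root of the weights, so that x_k / eps^2 = 2 u w_k. *)
Lemma extreme_value_sqrt eps : 0 < eps ->
  extreme_value a sigma eps r = eps ^- 2 * (Num.sqrt (2 * min_pow4) / 2).
Proof.
move=> e0; have V0 := min_pow4_gt0; rewrite extreme_valueE.
have s0 : 0 <= eps ^- 2 * (Num.sqrt (2 * min_pow4) / 2).
  by rewrite mulr_ge0 ?divr_ge0 ?sqrtr_ge0// invr_ge0 sqr_ge0.
rewrite -[RHS]ger0_norm// -sqrtr_sqr; congr Num.sqrt.
rewrite exprMn expr_div_n sqr_sqrtr ?mulr_ge0 ?(ltW V0)//.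
by field; rewrite gt_eqF.
Qed.

Lemma eta_tilde2_weights eps k : 0 < eps ->
  x z m k / eps ^+ 2 = 2 * extreme_value a sigma eps r * weights alpha beta z m k.
Proof.
move=> e0; have V0 := min_pow4_gt0; rewrite extreme_value_sqrt// weightsE.
by field; rewrite !gt_eqF// sqrtr_gt0 mulr_gt0.
Qed.

Lemma weighted_sum_ge eps eta : 0 < eps -> Theta2_r a sigma r eta ->
  extreme_value a sigma eps r <= \sum_(k < n) weights alpha beta z m k * (eta k / eps) ^+ 2.
Proof.
move=> e0 he; have V0 := min_pow4_gt0; have H := eta_tilde2_sum_ge he.
have s0 : 0 < Num.sqrt (2 * min_pow4) by rewrite sqrtr_gt0 mulr_gt0.
have -> : \sum_(k < n) weights alpha beta z m k * (eta k / eps) ^+ 2 =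
   eps ^- 2 * ((\sum_(k < n) x z m k * eta k ^+ 2) / Num.sqrt (2 * min_pow4)).
  rewrite mulr_suml mulr_sumr; apply: eq_bigr => k _; rewrite weightsE.
  by field; rewrite !gt_eqF.
rewrite extreme_value_sqrt// ler_pM2l ?invr_gt0 ?exprn_gt0// ler_pdivlMr//.
rewrite mulrAC -expr2 sqr_sqrtr ?mulr_ge0 ?(ltW V0)// mulrC mulKf//.
Qed.

End solution.

End extreme_problem.

(** * Solutions (z, m) of the extreme system and their behaviour as r -> 0 *)

Section solution_existence.
Context {R : realType}.
Variables alpha beta : R.
Hypotheses (halpha : 0 < alpha) (hbeta : 0 < beta).
Implicit Types (r z m : R).

Notation c := (2 * alpha).
Notation x := (eta_tilde2 alpha beta).
Notation p := (4 * beta).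
Notation NN := (cut_sum c p).
Notation DD := (cut_sum c (p + c)).
Notation solves := (solves_extreme_system alpha beta).

Let c0 : 0 < c. Proof. by rewrite mulr_gt0. Qed.
Let p0 : 0 < p. Proof. by rewrite mulr_gt0. Qed.
Let pc0 : 0 < p + c. Proof. by rewrite addr_gt0. Qed.

(** For m <= 2 only the first term survives; its index is 1, so both equations have the same left
    side and force r = 1. *)
Lemma solution_dim_gt2 r z m : 0 < r < 1 -> solves r z m -> 2 < m.
Proof.
move=> /andP[r0 r1] sol; have [z0 m0 h1 h2] := (solvesP beta halpha r z m).1 sol.
rewrite ltNge; apply/negP => m2.
have : r ^+ 2 = 1.
  rewrite -h1 -[RHS]h2; congr (_ * _); apply: eq_bigr => -[[|k] hk] _ /=.
    by rewrite /idx !powR1.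
  by rewrite !(@cut_eq0 _ _ c0 m k.+1 m0) ?mulr0//; apply: (le_trans m2); rewrite /idx ler_nat.
by move/eqP; rewrite sqrf_eq1 => /orP[] /eqP ?; lra.
Qed.

(** Both solutions describe the unique squared minimizer of the extreme problem. As m > 2 its first
    two terms are not cut off, and they give linear equations for z^2 and z^2 m^-c. *)
Lemma solution_unique r z m z' m' : 0 < r < 1 ->
  solves r z m -> solves r z' m' -> (z, m) = (z', m').
Proof.
move=> r01 sol sol'.
have m2 := solution_dim_gt2 r01 sol; have m2' := solution_dim_gt2 r01 sol'.
have [z0 m0 _ _] := (solvesP beta halpha r z m).1 sol.
have [z0' m0' _ _] := (solvesP beta halpha r z' m').1 sol'.
have xE k : x z m k = x z' m' k.
  pose eta k := Num.sqrt (x z m k).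
  have etaE : forall k, eta k ^+ 2 = x z m k by exact: sqrt_realization.
  have := (extreme_sequenceP halpha sol eta).2 etaE.
  by move/(extreme_sequenceP halpha sol') => /(_ k) <-; rewrite etaE.
have e0 := xE 0%N; have e1 := xE 1%N.
have i0 (M : R) : 2 < M -> idx 0 <= M by rewrite /idx; lra.
have i1 (M : R) : 2 < M -> idx 1 <= M by rewrite /idx; lra.
rewrite !eta_tilde2E (cut_lt c0 m0 (i0 _ m2)) (cut_lt c0 m0' (i0 _ m2')) in e0.
rewrite !eta_tilde2E (cut_lt c0 m0 (i1 _ m2)) (cut_lt c0 m0' (i1 _ m2')) in e1.
rewrite /idx !powR1 in e0.
set A := (m `^ c)^-1 in e0 e1; set A' := (m' `^ c)^-1 in e0 e1.
set b := (2 : R) `^ (2 * beta) in e1.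
have b0 : 0 < b by exact: powR_gt0.
have g1 : 1 < (2 : R) `^ c.
  rewrite -[ltLHS](_ : 1 `^ c = 1); last by rewrite powR1.
  by apply: gt0_ltr_powR; rewrite ?nnegrE//; lra.
set g := (2 : R) `^ c in e1 g1.
have {}e0 : z ^+ 2 - z ^+ 2 * A = z' ^+ 2 - z' ^+ 2 * A' by move: e0; rewrite !mul1r; lra.
have {}e1 : z ^+ 2 - g * (z ^+ 2 * A) = z' ^+ 2 - g * (z' ^+ 2 * A').
  apply: (mulfI (lt0r_neq0 b0)).
  rewrite (_ : b * _ = z ^+ 2 * (b * (1 - g * A))); last by ring.
  by rewrite e1; ring.
have zz : z ^+ 2 = z' ^+ 2.
  have : (g - 1) * (z ^+ 2 - z' ^+ 2) = 0.
    have -> : (g - 1) * (z ^+ 2 - z' ^+ 2) = g * (z ^+ 2 - z ^+ 2 * A) - g * (z' ^+ 2 - z' ^+ 2 * A')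
      - ((z ^+ 2 - g * (z ^+ 2 * A)) - (z' ^+ 2 - g * (z' ^+ 2 * A'))) by ring.
    by rewrite e0 e1 !subrr.
  move/eqP; rewrite mulf_eq0 subr_eq0 (gt_eqF g1)/= subr_eq0 => /eqP//.
have -> : z = z' by apply: (pexpIrn (n := 2)) => //; rewrite nnegrE ltW.
have AA : A = A'.
  apply: (mulfI (lt0r_neq0 (exprn_gt0 2 z0))).
  by rewrite [in RHS]zz; move: e0; rewrite zz; lra.
congr pair; apply: (powR_injective c0); rewrite ?nnegrE ?ltW//.
exact: (invr_inj AA).
Qed.

Lemma near_pinfty_large (P : R -> Prop) : (\forall m \near +oo, P m) ->
  exists2 M, 0 < M & forall m, M <= m -> P m.
Proof.
move=> [M [Mr MP]]; exists (`|M| + 1); first by rewrite ltr_wpDl.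
by move=> m hm; apply: MP; have := ler_norm M; lra.
Qed.

Lemma continuous_cut k m : 0 < m -> {for m, continuous (fun m => cut c m k)}.
Proof.
move=> m0; apply: (@continuous_max _ _ (cst 0) (fun m => 1 - (idx k / m) `^ c)).
  exact: cvg_cst.
apply: cvgB; first exact: cvg_cst.
have i0 : 0 < idx k / m by rewrite divr_gt0 ?idx_gt0.
have cp : {for (idx k / m), continuous (fun t : R => t `^ c)}.
  apply: differentiable_continuous; apply/derivable1_diffP.
  by apply: derivable_powR; rewrite in_itv/= i0.
apply: (cvg_comp (fun m => idx k / m) (fun t => t `^ c)); last exact: cp.
by apply: cvgM; [exact: cvg_cst|apply: cvgV; [rewrite gt_eqF|exact: cvg_id]].
Qed.

(** Eliminating z leaves the equation NN m = r^2 DD m. At m = 2 only the first term remains and r <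
    1 fixes the sign; for large m the extra factor of order m^c in DD reverses it. *)
Lemma solution_exists r : 0 < r < 1 -> exists z m, solves r z m.
Proof.
move=> /andP[r0 r1].
have [M M0 HM] : exists2 M, 0 < M & forall m, M <= m -> NN m <= r ^+ 2 * DD m.
  apply: near_pinfty_large.
  pose A := cut_limit c p; pose D := cut_limit c (p + c).
  have A0 : 0 < A := cut_limit_gt0 c0 p0.
  have D0 : 0 < D := cut_limit_gt0 c0 pc0.
  have HA := @cut_sum_asymp _ c c0 _ p0; have HD := @cut_sum_asymp _ c c0 _ pc0.
  near=> m.
  have m0 : 0 < m by near: m; exact: nbhs_pinfty_gt.
  have ha : NN m / m `^ (p + 1) <= A + A.
    by near: m; apply: (cvgr_le _ HA); rewrite ltrDr.
  have hd : D / 2 <= DD m / m `^ (p + c + 1).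
    by near: m; apply: (cvgr_ge _ HD); rewrite ltr_pdivrMr// mulr_natr mulr2n ltrDr.
  have hm : ((A + A) / (r ^+ 2 * (D / 2))) `^ (c^-1) <= m.
    by near: m; apply: nbhs_pinfty_ge; exact: num_real.
  have mp : 0 < m `^ (p + 1) by exact: powR_gt0.
  have mc : (A + A) <= m `^ c * (r ^+ 2 * (D / 2)).
    have q0 : 0 < r ^+ 2 * (D / 2) by rewrite mulr_gt0 ?exprn_gt0 ?divr_gt0.
    rewrite -ler_pdivrMr//.
    have := le_powR (ltW c0) (powR_ge0 _ _) hm.
    rewrite -powRrM mulVf ?(gt_eqF c0)// powRr1//.
    by apply: divr_ge0; [rewrite addr_ge0// ltW|exact: ltW].
  move: ha hd; rewrite ler_pdivrMr// ler_pdivlMr ?powR_gt0// => ha hd.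
  apply: (le_trans ha).
  apply: (@le_trans _ _ (r ^+ 2 * (D / 2 * m `^ (p + c + 1)))); last first.
    by rewrite ler_pM2l ?exprn_gt0.
  have -> : m `^ (p + c + 1) = m `^ c * m `^ (p + 1).
    by rewrite -powRD ?(gt_eqF m0) ?implybT//; congr (_ `^ _); ring.
  rewrite (_ : r ^+ 2 * _ = m `^ c * (r ^+ 2 * (D / 2)) * m `^ (p + 1)); last by ring.
  by rewrite ler_pM2r.
pose M' := Num.max 2 M.
have M'2 : 2 <= M' by rewrite le_max lexx.
have M'0 : 0 < M' by lra.
pose n := Num.truncn M'.
(* The number of terms is frozen at the largest one needed on [2, M'], so that continuity is that of
   a finite sum; the additional terms are zero. *)
pose F m := \sum_(k < n) (r ^+ 2 * idx k `^ (p + c) - idx k `^ p) * cut c m k.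
have FE m : 0 < m -> m <= M' -> F m = r ^+ 2 * DD m - NN m.
  move=> m0 mM.
  have tn : (Num.truncn m <= n)%N by rewrite le_truncn.
  rewrite -(cut_sumE c0 (p + c) m0 tn) -(cut_sumE c0 p m0 tn) mulr_sumr -sumrB.
  by apply: eq_bigr => k _; ring.
have F2 : F 2 <= 0.
  apply: sumr_le0 => -[[|k] hk] _ /=.
    rewrite /idx !powR1 mulr1; apply: mulr_le0_ge0; last exact: cut_ge0.
    by rewrite subr_le0 exprn_ile1// ltW.
  by rewrite (cut_eq0 c0)// ?mulr0// /idx ler_nat.
have FM : 0 <= F M'.
  by rewrite FE// subr_ge0; apply: HM; rewrite le_max lexx orbT.
have cF : {within `[2, M'], continuous F}.
  apply: continuous_in_subspaceT => m /[!inE]/=; rewrite in_itv/= => /andP[m2 _].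
  have m0 : 0 < m by lra.
  rewrite /F; elim: (n) => [|n' IH].
    under [X in continuous_at _ X]eq_fun do rewrite big_ord0; exact: cvg_cst.
  under [X in continuous_at _ X]eq_fun do rewrite big_ord_recr/=.
  by apply: cvgD; [exact: IH|apply: cvgMr; exact: continuous_cut].
have [|m] := @IVT R F 2 M' 0 M'2 cF.
  by rewrite ge_min le_max F2 FM orbT.
rewrite in_itv/= => /andP[m2 mM] Fm.
have m0 : 0 < m by lra.
have D0 : 0 < DD m.
  have n0 : (0 < Num.truncn m)%N by rewrite truncn_gt0; lra.
  rewrite /cut_sum; case: {+}(Num.truncn m) n0 => // n' _; rewrite big_ord_recl/=.
  apply: ltr_pwDl; last by apply: sumr_ge0 => k _; rewrite mulr_ge0 ?powR_ge0 ?cut_ge0.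
  by rewrite mulr_gt0 ?powR_gt0 ?idx_gt0// cut_gt0// /idx; lra.
exists (Num.sqrt (DD m)^-1), m; apply/(solvesP beta halpha).
have ND : NN m = r ^+ 2 * DD m by move: Fm; rewrite FE//; lra.
rewrite sqrtr_gt0 invr_gt0 sqr_sqrtr ?invr_ge0 ?(ltW D0)//; split => //.
  by rewrite ND mulrCA mulVf ?mulr1// gt_eqF.
by rewrite mulVf// gt_eqF.
Unshelve. all: by end_near. Qed.

(** DD m <= m^c NN m term by term, so the two equations give 1 <= m^c r^2. *)
Lemma solution_dim_ge r z m M : 0 < r -> 0 < M -> r <= M `^ (- alpha) ->
  solves r z m -> M <= m.
Proof.
move=> r0 M0 rM sol; have [z0 m0 h1 h2] := (solvesP beta halpha r z m).1 sol.
rewrite leNgt; apply/negP => mM.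
have DN : DD m <= m `^ c * NN m.
  rewrite /cut_sum mulr_sumr; apply: ler_sum => k _.
  rewrite idx_powRD [leRHS]mulrA (mulrC (m `^ c)) -[leLHS]mulrA -[leRHS]mulrA.
  rewrite ler_wpM2l ?powR_ge0// ler_wpM2r ?cut_ge0//.
  exact: le_powR (ltW c0) (ltW (idx_gt0 _)) (trunc_idx _ m0).
have h3 : 1 <= m `^ c * r ^+ 2.
  have : z ^+ 2 * DD m <= z ^+ 2 * (m `^ c * NN m) by rewrite ler_pM2l ?exprn_gt0.
  by rewrite h2 mulrCA h1.
have h4 : m `^ c < M `^ c.
  by apply: gt0_ltr_powR; rewrite ?nnegrE ?(ltW m0) ?(ltW M0).
have r2 : r ^+ 2 <= (M `^ c)^-1.
  have -> : (M `^ c)^-1 = (M `^ (- alpha)) ^+ 2.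
    by rewrite -powR_mulrn ?powR_ge0// -powRrM -powRN; congr (_ `^ _); ring.
  by rewrite lerXn2r ?nnegrE ?powR_ge0// ltW.
have Mc : 0 < M `^ c by exact: powR_gt0.
have : m `^ c * r ^+ 2 < 1.
  apply: (@le_lt_trans _ _ (m `^ c * (M `^ c)^-1)).
    by rewrite ler_wpM2l ?powR_ge0.
  by rewrite ltr_pdivrMr// mul1r.
by rewrite ltNge h3.
Qed.

(** Turns limits as m -> +oo into bounds uniform over small r. *)
Lemma solution_dim_large (P : R -> Prop) : (\forall m \near +oo, P m) ->
  exists2 r0, 0 < r0 & forall r z m, 0 < r < r0 -> solves r z m -> P m.
Proof.
move=> /near_pinfty_large[M M0 MP]; exists (M `^ (- alpha)); first exact: powR_gt0.
move=> r z m /andP[r0 rM] sol; apply: MP.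
exact: (solution_dim_ge r0 M0 (ltW rM) sol).
Qed.

Let A := cut_limit c p.
Let D := cut_limit c (p + c).
Let A0 : 0 < A. Proof. exact: cut_limit_gt0. Qed.
Let D0 : 0 < D. Proof. exact: cut_limit_gt0. Qed.
Let DA : D < A. Proof. exact: cut_limit_lt. Qed.
Let HA := @cut_sum_asymp _ c c0 _ p0.
Let HD := @cut_sum_asymp _ c c0 _ pc0.

(** x_k^2 is at most z^4 m^p, whereas the sum of all x_k^2 is z^4 (NN m - DD m / m^c), of order z^4
    m^(p+1) because D < A. Hence w_k^2 is of order at most 1 / m. *)
Lemma weights_small (delta : R) : 0 < delta -> exists2 r0 : R, 0 < r0 &
  forall r z m, 0 < r < r0 -> solves r z m ->
    forall k, weights alpha beta z m k <= delta.
Proof.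
move=> d0.
have H : \forall m \near +oo, m `^ p * 2^-1 <= delta ^+ 2 * (NN m - DD m / m `^ c).
  pose e := (A - D) / 4.
  have e0 : 0 < e by rewrite divr_gt0// subr_gt0.
  near=> m.
  have m0 : 0 < m by near: m; exact: nbhs_pinfty_gt.
  have ha : A - e <= NN m / m `^ (p + 1).
    by near: m; apply: (cvgr_ge _ HA); rewrite ltrBlDr ltrDl.
  have hd : DD m / m `^ (p + c + 1) <= D + e.
    by near: m; apply: (cvgr_le _ HD); rewrite ltrDl.
  have hm : (delta ^+ 2 * (A - D))^-1 <= m.
    by near: m; apply: nbhs_pinfty_ge; exact: num_real.
  have mp1 : 0 < m `^ (p + 1) by exact: powR_gt0.
  have mc : 0 < m `^ c by exact: powR_gt0.
  have E1 : m `^ (p + c + 1) = m `^ (p + 1) * m `^ c.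
    by rewrite -powRD ?(gt_eqF m0) ?implybT//; congr (_ `^ _); ring.
  have E2 : m `^ (p + 1) = m `^ p * m.
    by rewrite powRD ?(gt_eqF m0) ?implybT// powRr1// ltW.
  have hNN : (A - e) * m `^ (p + 1) <= NN m by rewrite -ler_pdivlMr.
  have hDD : DD m / m `^ c <= (D + e) * m `^ (p + 1).
    by move: hd; rewrite E1 invfM mulrA mulrAC ler_pdivrMr.
  have diff : (A - D) / 2 * m `^ (p + 1) <= NN m - DD m / m `^ c.
    have -> : (A - D) / 2 = (A - e) - (D + e) by rewrite /e; field.
    by rewrite mulrBl lerB.
  apply: (@le_trans _ _ (delta ^+ 2 * ((A - D) / 2 * m `^ (p + 1)))); last first.
    by rewrite ler_pM2l// exprn_gt0.
  rewrite E2 (_ : delta ^+ 2 * _ = m `^ p * 2^-1 * (delta ^+ 2 * (A - D) * m)); last by ring.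
  rewrite ler_peMr ?mulr_ge0 ?powR_ge0//.
  have q0 : 0 < delta ^+ 2 * (A - D) by rewrite mulr_gt0 ?exprn_gt0// subr_gt0.
  by rewrite mulrC -ler_pdivrMr// mul1r.
have [r0 r00 Hr] := solution_dim_large H.
exists r0 => // r z m rr sol k.
have [z0 m0 h1 h2] := (solvesP beta halpha r z m).1 sol.
have hm := Hr r z m rr sol.
have V0 := min_pow4_gt0 halpha sol.
have [mk|km] := leqP (Num.truncn m) k; first by rewrite (weights_eq0 halpha sol)// ltW.
rewrite (weightsE halpha sol) ler_pdivrMr ?sqrtr_gt0 ?mulr_gt0//.
have x0 : 0 <= x z m k by exact: eta_tilde2_ge0.
rewrite -(@ler_pXn2r _ 2) ?nnegrE// ?mulr_ge0 ?sqrtr_ge0// ?(ltW d0)//.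
rewrite [leRHS]exprMn sqr_sqrtr ?mulr_ge0 ?(ltW V0)//.
rewrite [min_pow4 _ _ _ _](sum_eta_tilde4 _ _ _ m0).
apply: (@le_trans _ _ (z ^+ 4 * m `^ p)).
  have -> : z ^+ 4 * m `^ p = (z ^+ 2 * m `^ (2 * beta)) ^+ 2.
    rewrite exprMn -exprM -[(m `^ _) ^+ 2]powR_mulrn ?powR_ge0// -powRrM.
    by congr (_ * _ `^ _); ring.
  have zm0 : 0 <= z ^+ 2 * m `^ (2 * beta) by rewrite mulr_ge0 ?sqr_ge0 ?powR_ge0.
  apply: lerXn2r; rewrite ?nnegrE//.
  rewrite eta_tilde2E ler_wpM2l ?sqr_ge0//.
  have im : idx k <= m by exact: (trunc_idx (Ordinal km)).
  rewrite cut_lt// -[leRHS]mulr1; apply: ler_pM; rewrite ?powR_ge0//.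
  - by rewrite -(cut_lt c0 m0 im) cut_ge0.
  - by apply: le_powR => //; rewrite mulr_ge0// ltW.
  - by rewrite gerBl divr_ge0// powR_ge0.
rewrite (_ : delta ^+ 2 * _ = z ^+ 4 * (2 * (delta ^+ 2 * (NN m - DD m / m `^ c)))); last by ring.
by rewrite ler_pM2l ?exprn_gt0//; lra.
Unshelve. all: by end_near. Qed.

Let kappa : R := (4 * alpha + 4 * beta + 1) / (2 * alpha).

(* Half of [min_pow4] divided by r^(2 kappa), in terms of the normalized sums
   a = NN m / m^(p+1) and d = DD m / m^(p+c+1), since r^2 = (a / d) m^-c. *)
Let X (a d : R) : R := (a / d - 1) / d / 2 / (a / d) `^ kappa.

(** Substitute z^2 = 1 / DD m and r^2 = (a / d) m^-c into z^2 (r^2 - m^-c). The powers of m collect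
    to m^-(p + 2 c + 1), which is (m^-c)^kappa because c kappa = p + 2 c + 1. *)
Lemma min_pow4_normalized r z m : 0 < r -> solves r z m ->
  Num.sqrt (2 * min_pow4 alpha beta z m) / 2 =
  Num.sqrt (X (NN m / m `^ (p + 1)) (DD m / m `^ (p + c + 1))) * r `^ kappa.
Proof.
move=> r0 sol; have [z0 m0 h1 h2] := (solvesP beta halpha r z m).1 sol.
have V0 := min_pow4_gt0 halpha sol.
set a := NN m / _; set d := DD m / _.
have DD0 : 0 < DD m := DD_gt0 halpha sol.
have mp1 : 0 < m `^ (p + 1) by exact: powR_gt0.
have mc : 0 < m `^ c by exact: powR_gt0.
have E1 : m `^ (p + c + 1) = m `^ (p + 1) * m `^ c.
  by rewrite -powRD ?(gt_eqF m0) ?implybT//; congr (_ `^ _); ring.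
have d0 : 0 < d by rewrite divr_gt0// powR_gt0.
have NN0 : 0 < NN m.
  have : 0 < z ^+ 2 * NN m by rewrite h1 exprn_gt0.
  by rewrite pmulr_rgt0// exprn_gt0.
have a0 : 0 < a by rewrite divr_gt0.
have ad : r ^+ 2 = a / d / m `^ c.
  have -> : r ^+ 2 = NN m / DD m.
    apply: (canRL (mulfK (lt0r_neq0 DD0))).
    by rewrite -h1 mulrAC h2 mul1r.
  by rewrite /a /d E1; field; rewrite !gt_eqF.
have ad0 : 0 < a / d by rewrite divr_gt0.
have HV : 2 * min_pow4 alpha beta z m / 4 = X a d * (r `^ kappa) ^+ 2.
  have -> : (r `^ kappa) ^+ 2 = (r ^+ 2) `^ kappa.
    by rewrite -(powR_mulrn 2 (powR_ge0 r kappa)) -(powR_mulrn 2 (ltW r0)) -!powRrM mulrC.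
  rewrite ad (powRM _ (ltW ad0)) ?invr_ge0 ?(ltW mc)//.
  have -> : (m `^ c)^-1 `^ kappa = (m `^ (p + 1) * m `^ c * m `^ c)^-1.
    rewrite -!powRD ?(gt_eqF m0) ?implybT// -!powRN -powRrM; congr (_ `^ _).
    by rewrite /kappa; field; rewrite gt_eqF.
  rewrite [min_pow4 _ _ _ _](min_pow4E halpha sol) ad.
  have -> : z ^+ 2 = (DD m)^-1 by apply: (mulIf (lt0r_neq0 DD0)); rewrite h2 mulVf// gt_eqF.
  have -> : DD m = d * (m `^ (p + 1) * m `^ c) by rewrite /d E1 divfK// gt_eqF// mulr_gt0.
  have adk : 0 < (a / d) `^ kappa by rewrite powR_gt0// divr_gt0.
  by rewrite /X; field; rewrite !gt_eqF.
have X0 : 0 < X a d.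
  have : 0 < X a d * (r `^ kappa) ^+ 2 by rewrite -HV divr_gt0// mulr_gt0.
  by rewrite pmulr_lgt0// exprn_gt0// powR_gt0.
rewrite -[RHS]ger0_norm ?mulr_ge0 ?sqrtr_ge0 ?powR_ge0// -[RHS]sqrtr_sqr.
rewrite exprMn (sqr_sqrtr (ltW X0)) -HV.
rewrite [RHS]sqrtrM ?mulr_ge0 ?(ltW V0)//; congr (_ * _).
by rewrite -[4](_ : 2 ^+ 2 = _) -?exprVn ?sqrtr_sqr ?ger0_norm ?invr_ge0//; ring.
Qed.

(** As m -> +oo the normalized sums tend to A and D and X is continuous there; the constant is the
    root of X A D, positive because D < A. *)
Lemma min_pow4_asymp : exists2 c1 : R, 0 < c1 &
  forall e, 0 < e -> exists2 r0 : R, 0 < r0 &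
  forall r z m, 0 < r < r0 -> solves r z m ->
    `|Num.sqrt (2 * min_pow4 alpha beta z m) / 2 / (c1 * r `^ kappa) - 1| <= e.
Proof.
have AD0 : 0 < A / D by rewrite divr_gt0.
have X0 : 0 < X A D.
  rewrite /X !divr_gt0 ?powR_gt0// subr_gt0 ltr_pdivlMr// mul1r; exact: DA.
exists (Num.sqrt (X A D)); first by rewrite sqrtr_gt0.
move=> e e0; set c1 := Num.sqrt _; have c10 : 0 < c1 by rewrite sqrtr_gt0.
pose a m := NN m / m `^ (p + 1); pose d m := DD m / m `^ (p + c + 1).
have cad : a m / d m @[m --> +oo] --> A / D.
  by apply: cvgM; [exact: HA|apply: cvgV; [rewrite gt_eqF|exact: HD]].
have ckap : {for (A / D), continuous (fun t : R => t `^ kappa)}.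
  apply: differentiable_continuous; apply/derivable1_diffP.
  by apply: derivable_powR; rewrite in_itv/= AD0.
have cX : X (a m) (d m) @[m --> +oo] --> X A D.
  apply: cvgM; last first.
    apply: cvgV; first by rewrite gt_eqF// powR_gt0.
    exact: (cvg_comp (fun m => a m / d m) (fun t : R => t `^ kappa) cad ckap).
  apply: cvgM; last exact: cvg_cst.
  apply: cvgM; last by apply: cvgV; [rewrite gt_eqF|exact: HD].
  by apply: cvgB; [exact: cad|exact: cvg_cst].
have csX : Num.sqrt (X (a m) (d m)) @[m --> +oo] --> c1.
  exact: (cvg_comp (fun m => X (a m) (d m)) Num.sqrt cX (@sqrt_continuous R _)).
have ec1 : 0 < e * c1 by rewrite mulr_gt0.
have H : \forall m \near +oo, `|c1 - Num.sqrt (X (a m) (d m))| <= e * c1.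
  exact: (cvgrPdist_le _ _).1 csX _ ec1.
have [r0 r00 Hr] := solution_dim_large H.
exists r0 => // r z m rr sol.
have rk : 0 < r `^ kappa by apply: powR_gt0; case/andP: rr.
rewrite (min_pow4_normalized _ sol); last by case/andP: rr.
rewrite -/(a m) -/(d m) (_ : _ / _ - 1 = - ((c1 - Num.sqrt (X (a m) (d m))) / c1)); last first.
  by field; rewrite !gt_eqF.
by rewrite normrN normrM normfV (gtr0_norm c10) ler_pdivrMr//; exact: (Hr r z m rr sol).
Qed.

End solution_existence.

(** * Risk of tests *)

Section expectation.
Context {d : measure_display} {T : measurableType d} {R : realType}.
Variables (P : probability T R) (xi : nat -> {RV P >-> R}).
Implicit Types (eps : R) (eta : nat -> R) (psi : R^nat -> R).

Notation V := (seq_space R).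
Notation mu := (seq_law xi).

Definition observed eps eta (y : V) : V := fun k => eta k + eps * y k.

Lemma measurable_observed eps eta : measurable_fun [set: V] (observed eps eta).
Proof.
apply: measurable_to_seq => k; apply: measurable_funD => //.
by apply: measurable_funM => //; exact: measurable_coord.
Qed.

Lemma measurable_test psi : is_test psi -> measurable_fun [set: V] psi.
Proof. by move=> [mpsi _] _ B mB; rewrite setTI; exact: mpsi. Qed.

Lemma testP psi : measurable_fun [set: V] psi -> (forall y, 0 <= psi y <= 1) ->
  is_test psi.
Proof.
move=> mpsi h; split => // B mB.
by have := mpsi measurableT B mB; rewrite setTI.
Qed.

Lemma is_test_compl psi : is_test psi -> is_test (fun y => 1 - psi y).
Proof.
move=> tpsi; apply: testP => [|y]; first by apply: measurable_funB => //; exact: measurable_test.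
by have := tpsi.2 y; lra.
Qed.

Lemma is_test_scale t psi : 0 <= t <= 1 -> is_test psi -> is_test (fun y => t * psi y).
Proof.
move=> t01 tpsi; apply: testP => [|y]; first by apply: measurable_funM => //; exact: measurable_test.
have := tpsi.2 y => /andP[p0 p1]; case/andP: t01 => t0 t1.
by rewrite mulr_ge0//= mulr_ile1.
Qed.

Lemma measurable_test_observed psi eps eta : is_test psi ->
  measurable_fun [set: V] (fun y => (psi (observed eps eta y))%:E).
Proof.
move=> /measurable_test mpsi; apply/measurable_EFinP.
exact: (measurableT_comp mpsi (measurable_observed eps eta)).
Qed.

(** Moves expectations to the law of the noise on [seq_space]; [fine] loses nothing because tests
    take values in [0, 1]. *)
Lemma expectE psi eps eta : is_test psi ->
  (expect xi eps eta psi)%:E = (\int[mu]_y (psi (observed eps eta y))%:E)%E.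
Proof.
move=> tpsi; have mpsi := measurable_test_observed eps eta tpsi.
have E : (\int[mu]_y (psi (observed eps eta y))%:E)%E =
    ('E_P[fun w => psi (observation xi eps eta w)])%E.
  rewrite unlock /seq_law ge0_integral_distribution// => y.
  by rewrite lee_fin; case/andP: (tpsi.2 (observed eps eta y)).
rewrite /expect -E fineK// ge0_fin_numE; last first.
  by apply: integral_ge0 => y _; rewrite lee_fin; case/andP: (tpsi.2 (observed eps eta y)).
apply: (@le_lt_trans _ _ 1%E); last exact: ltry.
rewrite -[leRHS](integral_probability_cst mu).
apply: ge0_le_integralT => // y; rewrite lee_fin; by case/andP: (tpsi.2 (observed eps eta y)).
Qed.

Lemma expect_ge0 psi eps eta : is_test psi -> 0 <= expect xi eps eta psi.
Proof.
move=> tpsi; rewrite -lee_fin expectE//; apply: integral_ge0 => y _.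
by rewrite lee_fin; case/andP: (tpsi.2 (observed eps eta y)).
Qed.

Lemma expect_compl psi eps eta : is_test psi ->
  expect xi eps eta (fun y => 1 - psi y) = 1 - expect xi eps eta psi.
Proof.
move=> tpsi; have tc := is_test_compl tpsi.
apply/eqP; rewrite eq_sym subr_eq eq_sym -eqe EFinD !expectE//.
rewrite -ge0_integralTD; [|exact: (measurable_test_observed _ _ tc)|exact: (measurable_test_observed _ _ tpsi)| |].
- under eq_integral do rewrite -EFinD subrK.
  by rewrite integral_probability_cst.
- by move=> y; rewrite lee_fin; case/andP: (tc.2 (observed eps eta y)).
- by move=> y; rewrite lee_fin; case/andP: (tpsi.2 (observed eps eta y)).
Qed.

Lemma expect_le1 psi eps eta : is_test psi -> expect xi eps eta psi <= 1.
Proof.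
move=> tpsi; have := expect_ge0 eps eta (is_test_compl tpsi).
by rewrite expect_compl// subr_ge0.
Qed.

Lemma expect_scale t psi eps eta : 0 <= t <= 1 -> is_test psi ->
  expect xi eps eta (fun y => t * psi y) = t * expect xi eps eta psi.
Proof.
move=> t01 tpsi; apply: EFin_inj; rewrite EFinM !expectE//; last exact: is_test_scale.
rewrite -ge0_integralTZl//; first exact: (measurable_test_observed _ _ tpsi).
  by move=> y; rewrite lee_fin; case/andP: (tpsi.2 (observed eps eta y)).
by case/andP: t01.
Qed.

Lemma expect_indic (A : set V) eps eta : measurable A ->
  (expect xi eps eta (\1_A))%:E = mu [set y | A (observed eps eta y)].
Proof.
move=> mA; have mA' : measurable ([set y | A (observed eps eta y)] : set V).
  by have := measurable_observed eps eta measurableT mA; rewrite setTI.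
rewrite -(integral_indicT mu mA') expectE.
  by apply: eq_integral => y _; rewrite !indicE.
apply: testP => [|y]; first exact: measurable_indic.
by rewrite indicE; case: (_ \in _); rewrite lexx ler01.
Qed.

Lemma beta_error_ge (Th : set (R^nat)) psi eps eta : is_test psi -> Th eta ->
  expect xi eps eta (fun y => 1 - psi y) <= beta_error xi eps Th psi.
Proof.
move=> tpsi The; apply: ub_le_sup; last by exists eta.
by exists 1 => _ [eta' _ <-]; apply: expect_le1; exact: is_test_compl.
Qed.

Lemma beta_error_le (Th : set (R^nat)) psi eps b : Th !=set0 ->
  (forall eta, Th eta -> expect xi eps eta (fun y => 1 - psi y) <= b) ->
  beta_error xi eps Th psi <= b.
Proof.
move=> [eta The] h; apply: sup_le_ub.
  by exists (expect xi eps eta (fun y => 1 - psi y)); exists eta.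
by move=> _ [eta' /h ? <-].
Qed.

Lemma beta_error_ge0 (Th : set (R^nat)) psi eps : Th !=set0 -> is_test psi ->
  0 <= beta_error xi eps Th psi.
Proof.
move=> [eta The] tpsi; apply: le_trans (beta_error_ge _ tpsi The).
by apply: expect_ge0; exact: is_test_compl.
Qed.

End expectation.

Lemma ge_inf_image (R : realType) (U : Type) (A : set U) (F : U -> R) b :
  A !=set0 -> (forall t, A t -> b <= F t) -> b <= inf [set F t | t in A].
Proof.
move=> [t At] h; apply: lb_le_inf; first by exists (F t), t.
by move=> _ [s /h ? <-].
Qed.

Lemma inf_image_le (R : realType) (U : Type) (A : set U) (F : U -> R) b t :
  (forall t, A t -> b <= F t) -> A t -> inf [set F t | t in A] <= F t.
Proof.
move=> h At; apply: ge_inf; last by exists t.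
by exists b => _ [s /h ? <-].
Qed.

Section risk_bounds.
Context {d : measure_display} {T : measurableType d} {R : realType}.
Variables (P : probability T R) (xi : nat -> {RV P >-> R}).
Hypothesis iid : iid_standard_normal xi.
Variables alpha beta : R.
Hypotheses (halpha : 0 < alpha) (hbeta : 0 < beta).
Implicit Types (eps r z m H : R) (eta : nat -> R) (psi : R^nat -> R).

Notation V := (seq_space R).
Notation mu := (seq_law xi).
Notation alt := (Theta2_r (a_poly alpha) (sigma_poly beta)).
Notation u := (extreme_value (a_poly alpha) (sigma_poly beta)).
Notation w := (weights alpha beta).
Notation threshold := (threshold_test alpha beta).
Notation solves := (solves_extreme_system alpha beta).

Lemma test_statisticE r z m eps y : solves r z m ->
  test_statistic alpha beta eps z m y =
  \sum_(k < Num.truncn m) w z m k * ((y k / eps) ^+ 2 - 1).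
Proof.
move=> sol; apply: lim_near_cst => //; near=> N.
rewrite /series/= big_mkord.
apply: (sum_widen (F := fun k => w z m k * ((y k / eps) ^+ 2 - 1))).
  by near: N; exact: nbhs_infty_ge.
by move=> k mk; rewrite (weights_eq0 halpha sol mk) mul0r.
Unshelve. all: by end_near. Qed.

Lemma test_statistic_observed r z m eps eta (y : V) : solves r z m -> 0 < eps ->
  test_statistic alpha beta eps z m (observed eps eta y) =
  \sum_(k < Num.truncn m) w z m k * ((eta k / eps + y k) ^+ 2 - 1).
Proof.
move=> sol e0; rewrite (test_statisticE _ _ sol); apply: eq_bigr => k _.
by rewrite /observed mulrDl [eps * _]mulrC mulfK// gt_eqF.
Qed.

Lemma measurable_test_statistic r z m eps : solves r z m ->
  measurable_fun [set: V] (fun y => test_statistic alpha beta eps z m y).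
Proof.
move=> sol; apply: (eq_measurable_fun
    (fun y : V => \sum_(k < Num.truncn m) w z m k * (((y k : R) / eps) ^+ 2 - 1))).
  by move=> y _; rewrite (test_statisticE _ _ sol).
apply: (@measurable_coord_sum _ _ (fun k x => w z m k * ((x / eps) ^+ 2 - 1))) => k.
apply: measurable_funM => //; apply: measurable_funB => //.
by apply: measurable_funX; exact: measurable_funM.
Qed.

Lemma is_test_threshold r z m eps H : solves r z m -> is_test (threshold eps z m H).
Proof.
move=> sol; apply: testP => [|y].
  by apply: measurable_indic; exact: measurable_gtset (measurable_test_statistic _ sol).
by rewrite /threshold_test indicE; case: (_ \in _); rewrite lexx ler01.
Qed.

Lemma alternatives_nonempty r z m : solves r z m -> alt r !=set0.
Proof.
move=> sol; exists (fun k => Num.sqrt (eta_tilde2 alpha beta z m k)).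
by apply: (feasible_realization halpha sol) => k; exact: sqrt_realization.
Qed.

Lemma expect_threshold r z m eps eta H : solves r z m -> 0 < eps ->
  (expect xi eps eta (threshold eps z m H))%:E =
  mu [set y | H < \sum_(k < Num.truncn m) w z m k * ((eta k / eps + y k) ^+ 2 - 1)].
Proof.
move=> sol e0; rewrite expect_indic; last first.
  exact: measurable_gtset (measurable_test_statistic _ sol).
congr (mu _); apply/seteqP; split => y /=; by rewrite (test_statistic_observed _ _ sol).
Qed.

(** The condition on H covers both criteria: K = |H| for a fixed H, and K = 0 for H = u / 2. It
    passes to the actual mean h >= u of the statistic, as [power_bound] requires. *)
Lemma risk_upper (delta K : R) : 0 < delta -> exists2 r0 : R, 0 < r0 &
  forall eps r z m H, 0 < eps -> 0 < r < r0 -> solves r z m -> H <= u eps r / 2 + K ->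
  alpha_error xi eps (threshold eps z m H) <= 1 - Phi H + delta /\
  (forall eta, alt r eta ->
     expect xi eps eta (fun y => 1 - threshold eps z m H y) <= Phi (H - u eps r) + delta).
Proof.
move=> d0; have [om1 om10 Hclt] := clt d0.
have [om2 om20 Hpow] := power_bound K d0.
have om0 : 0 < Num.min om1 om2 by rewrite lt_min om10.
have [r0 r00 Hw] := weights_small halpha hbeta om0.
exists r0 => // eps r z m H e0 rr sol HK.
have wle := Hw r z m rr sol.
have w1 k : 0 <= w z m k <= om1.
  by rewrite (weights_ge0 halpha sol)/= (le_trans (wle k))// ge_min lexx.
have w2 k : 0 <= w z m k <= om2.
  by rewrite (weights_ge0 halpha sol)/= (le_trans (wle k))// ge_min lexx orbT.
have ws := sum_weights_sqr halpha sol.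
have res := seq_law_resampling iid.
have tH := is_test_threshold eps H sol.
split.
  rewrite -lee_fin /alpha_error (expect_threshold _ _ sol)//.
  have [h _] := Hclt _ res (w z m) _ w1 ws H.
  apply: le_trans h; rewrite le_eqVlt; apply/orP; left; apply/eqP; congr (mu _).
  by apply/seteqP; split => y /=; under eq_bigr do rewrite mul0r add0r.
move=> eta Ath; set h := \sum_(k < Num.truncn m) w z m k * (eta k / eps) ^+ 2.
have uh : u eps r <= h by exact: (weighted_sum_ge halpha sol).
have Hh : H <= h / 2 + K by apply: (le_trans HK); lra.
have := Hpow _ res (w z m) (fun k => eta k / eps) (Num.truncn m) H w2 ws Hh.
rewrite -/h => hp.
apply: (@le_trans _ _ (Phi (H - h) + delta)); last first.
  by rewrite lerD2r; apply: Phi_nondecreasing; lra.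
rewrite -lee_fin; apply: le_trans hp.
rewrite expect_compl// EFinB (expect_threshold _ _ sol)// -probability_setC; last first.
  apply: measurable_gtset.
  apply: (@measurable_coord_sum _ _ (fun k x => w z m k * ((eta k / eps + x) ^+ 2 - 1))) => k.
  apply: measurable_funM => //; apply: measurable_funB => //.
  by apply: measurable_funX; exact: measurable_funD.
rewrite le_eqVlt; apply/orP; left; apply/eqP; congr (mu _).
by apply/seteqP; split => y /=; rewrite leNgt => /negP.
Qed.

(** The multiplier t is the Gaussian likelihood ratio at the critical value H. For H = u / 2 it
    equals 1 and the bound concerns the total error; for fixed H it weighs a constraint on the
    level. *)
Lemma risk_lower (delta C Hm : R) : 0 < delta -> 0 < C -> exists2 r0 : R, 0 < r0 &
  forall eps r z m H psi, 0 < eps -> 0 < r < r0 -> solves r z m ->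
  u eps r <= C -> H <= Hm -> is_test psi ->
  let t := expR (u eps r * H - u eps r ^+ 2 / 2) in
  Phi (H - u eps r) + t * (1 - Phi H) - delta <=
  beta_error xi eps (alt r) psi + t * alpha_error xi eps psi.
Proof.
move=> d0 C0; have [om om0 Hmix] := mixture_lower Hm d0 C0.
have [r0 r00 Hw] := weights_small halpha hbeta om0.
exists r0 => // eps r z m H psi e0 rr sol uC HHm tpsi /=; set t := expR _.
have w1 k : 0 <= w z m k <= om.
  by rewrite (weights_ge0 halpha sol)/= (Hw r z m rr sol).
have ws := sum_weights_sqr halpha sol.
have res := seq_law_resampling iid.
have u0 := extreme_value_gt0 halpha sol e0.
pose v k := Num.sqrt (eta_tilde2 alpha beta z m k) / eps.
have vE k : v k ^+ 2 = 2 * u eps r * w z m k.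
  by rewrite /v exprMn exprVn sqrt_realization (eta_tilde2_weights halpha sol).
have uC' : 0 < u eps r <= C by rewrite u0.
have := Hmix _ res (w z m) v (Num.truncn m) (u eps r) H w1 ws uC' HHm vE.
rewrite -/t -lee_fin => h; apply: (le_trans h) => {h}.
set n := Num.truncn m.
have tc := is_test_compl tpsi.
pose f (y : V) := (1 - psi (observed eps (fun=> 0) y))%:E.
have mf : measurable_fun [set: V] f := measurable_test_observed eps (fun=> 0) tc.
have mp := measurable_test_observed eps (fun=> 0) tpsi.
have f0 y : (0 <= f y)%E by rewrite lee_fin; case/andP: (tc.2 (observed eps (fun=> 0) y)).
have p0 y : 0 <= psi (observed eps (fun=> 0) y) by case/andP: (tpsi.2 (observed eps (fun=> 0) y)).
have t0 : 0 < t by exact: expR_gt0.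
have mL := measurable_mixture_lr v n.
have mLE : measurable_fun [set: V] (fun y : V => (mixture_lr v n y)%:E) by apply/measurable_EFinP.
have mfL : measurable_fun [set: V] (fun y : V => f y * (mixture_lr v n y)%:E)%E.
  exact: emeasurable_funM.
have fL0 (y : V) : (0 <= f y * (mixture_lr v n y)%:E)%E.
  by rewrite mule_ge0// lee_fin mixture_lr_ge0.
have bound : (\int[mu]_y (f y * (mixture_lr v n y)%:E) <=
    (beta_error xi eps (alt r) psi)%:E)%E.
  apply: integral_mixture_le => // s.
  (* Each choice of signs is an alternative of the test, so the type II error there is at most
     [beta_error]. *)
  pose eta k := eps * (if (k < n)%N then (-1) ^+ s k * v k else 0).
  have Aeta : alt r eta.
    apply: (feasible_realization halpha sol) => k; rewrite /eta.
    have [_ m0 _ _] := sol.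
    case: ltnP => nk; last by rewrite mulr0 expr0n/= eta_tilde2_eq0.
    rewrite !exprMn -exprM mulnC exprM sqrrN expr1n expr1n mul1r exprVn sqrt_realization.
    by rewrite mulrC mulfVK// sqrf_eq0 gt_eqF.
  apply: (@le_trans _ _ (expect xi eps eta (fun y => 1 - psi y))%:E).
    rewrite expectE// le_eqVlt; apply/orP; left; apply/eqP; apply: eq_integral => y _.
    congr (1 - psi _)%:E; apply/funext => k.
    by rewrite /observed /signed_shift /eta add0r mulrDr addrC.
  by rewrite lee_fin; apply: beta_error_ge.
rewrite EFinD EFinM.
apply: (@le_trans _ _ (\int[mu]_y (f y * (mixture_lr v n y)%:E) +
    t%:E * (alpha_error xi eps psi)%:E)%E); last by rewrite leeD2r.
have tp0 (y : V) : (0 <= t%:E * (psi (observed eps (fun=> 0) y))%:E)%E.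
  by rewrite mule_ge0// lee_fin// ltW.
have mtp : measurable_fun [set: V] (fun y : V => t%:E * (psi (observed eps (fun=> 0) y))%:E)%E.
  exact: measurable_funeM.
rewrite /alpha_error expectE// -ge0_integralTZl//; last by rewrite ltW.
rewrite -ge0_integralTD//.
apply: ge0_le_integralT => //.
- apply/measurable_EFinP; exact: measurable_minr.
- exact: emeasurable_funD.
- by move=> y; rewrite lee_fin le_min (ltW t0) mixture_lr_ge0.
move=> y; rewrite /f -!EFinM -EFinD lee_fin.
have p1 : psi (observed eps (fun=> 0) y) <= 1 by case/andP: (tpsi.2 (observed eps (fun=> 0) y)).
set q := psi _ in p1 *; have q0 : 0 <= q by exact: p0.
set mi := Num.min _ _.
have h1 : mi <= t by rewrite ge_min lexx.
have h2 : mi <= mixture_lr v n y by rewrite ge_min lexx orbT.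
(* The share 1 - q of the minimum is bounded by L and the share q by t. *)
have -> : mi = (1 - q) * mi + q * mi by ring.
by rewrite (mulrC t) lerD// ler_wpM2l// subr_ge0.
Qed.

End risk_bounds.

Lemma Phi_far (R : realType) (delta : R) : 0 < delta ->
  exists2 M, 0 < M & forall t, M <= t -> Phi (- t) <= delta.
Proof.
move=> d0; exists (Num.max 1 delta^-1); first by rewrite lt_max ltr01.
move=> t; rewrite ge_max => /andP[t1 td].
have t0 : 0 < t by lra.
apply: (le_trans (Phi_tail t0)); rewrite -[leRHS]invrK lef_pV2 ?posrE ?invr_gt0 ?exprn_gt0//.
by apply: (le_trans td); rewrite expr2 ler_peMr// ltW.
Qed.

(** * Minimax risks, uniformly over small radii *)

Section minimax_risk.
Context {d : measure_display} {T : measurableType d} {R : realType}.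
Variables (P : probability T R) (xi : nat -> {RV P >-> R}).
Hypothesis iid : iid_standard_normal xi.
Variables alpha beta : R.
Hypotheses (halpha : 0 < alpha) (hbeta : 0 < beta).
Implicit Types (eps r z m H : R) (psi : R^nat -> R).

Notation a := (a_poly alpha).
Notation sigma := (sigma_poly beta).
Notation alt := (Theta2_r a sigma).
Notation u := (extreme_value a sigma).
Notation threshold := (threshold_test alpha beta).
Notation solves := (solves_extreme_system alpha beta).

(** For u > C the left side is not positive. For u <= C the multiplier is at most B, so exceeding
    the level by delta' = delta / (2 B) costs at most delta / 2. This slack admits threshold tests,
    whose level is only asymptotically right. *)
Lemma level_risk_lower (delta level H : R) : 0 < delta -> Phi H = 1 - level ->
  exists2 delta' : R, 0 < delta' & exists2 r0 : R, 0 < r0 &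
  forall eps r z m psi, 0 < eps -> 0 < r < r0 -> solves r z m -> is_test psi ->
  alpha_error xi eps psi <= level + delta' ->
  Phi (H - u eps r) - delta <= beta_error xi eps (alt r) psi.
Proof.
move=> d0 PH; have [M M0 HM] := Phi_far d0.
pose C := M + `|H|; have C0 : 0 < C by rewrite ltr_pwDl.
pose B := expR (C * `|H|); have B0 : 0 < B by exact: expR_gt0.
have d2 : 0 < delta / 2 by rewrite divr_gt0.
have [r0 r00 Hr] := risk_lower iid halpha hbeta H d2 C0.
exists (delta / 2 / B); first by rewrite divr_gt0.
exists r0 => // eps r z m psi e0 rr sol tpsi ha.
have u0 := extreme_value_gt0 halpha sol e0.
have [uC|uC] := leP (u eps r) C; last first.
  apply: (@le_trans _ _ 0); last exact: beta_error_ge0 (alternatives_nonempty halpha sol) tpsi.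
  rewrite subr_le0 -opprB; apply: HM.
  by have := ler_norm H; rewrite /C in uC; lra.
have := Hr eps r z m H psi e0 rr sol uC (lexx _) tpsi.
rewrite PH /=; set t := expR _; set b := beta_error _ _ _ _ => h.
have tB : t <= B.
  rewrite ler_expR; apply: (@le_trans _ _ (u eps r * H)).
    by rewrite gerBl divr_ge0// sqr_ge0.
  apply: (le_trans (ler_norm _)); rewrite normrM (gtr0_norm u0).
  by rewrite ler_wpM2r.
have t0 : 0 <= t by exact: expR_ge0.
have h1 : t * (alpha_error xi eps psi - level) <= delta / 2.
  apply: (@le_trans _ _ (t * (delta / 2 / B))).
    by rewrite ler_wpM2l// lerBlDl.
  by rewrite mulrA ler_pdivrMr// mulrC ler_pM2l.
lra.
Qed.

Lemma level_risk (delta level H : R) : 0 < delta -> 0 < level < 1 ->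
  Phi H = 1 - level -> exists2 r0 : R, 0 < r0 &
  forall eps r z m, 0 < eps -> 0 < r < r0 -> solves r z m ->
  [/\ alpha_error xi eps (threshold eps z m H) <= level + delta,
      `|beta_error xi eps (alt r) (threshold eps z m H) - Phi (H - u eps r)| <= delta
    & `|beta_minimax xi a sigma eps r level - Phi (H - u eps r)| <= delta].
Proof.
move=> d0 /andP[l0 l1] PH.
have [d1 d10 [r1 r10 low]] := level_risk_lower d0 PH.
pose s := Num.min 1 (delta / 2).
have s0 : 0 < s by rewrite lt_min ltr01 divr_gt0.
have s1 : s <= 1 by rewrite ge_min lexx.
have sd : s <= delta / 2 by rewrite ge_min lexx orbT.
(* [d1] lets the lower bound apply to the threshold test itself, [s * level] yields (1 - s) (level +
   e) <= level, and [delta / 2] controls the risks. *)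
pose e := Num.min d1 (Num.min (s * level) (delta / 2)).
have e0 : 0 < e by rewrite !lt_min d10 mulr_gt0//= divr_gt0.
have ed1 : e <= d1 by rewrite ge_min lexx.
have es : e <= s * level by rewrite !ge_min lexx orbT.
have ed : e <= delta / 2 by rewrite !ge_min lexx !orbT.
have [r2 r20 upp] := risk_upper iid halpha hbeta `|H| e0.
exists (Num.min r1 r2); first by rewrite lt_min r10.
move=> eps r z m eps0 /andP[rp]; rewrite lt_min => /andP[rr1 rr2] sol.
have rp1 : 0 < r < r1 by rewrite rp.
have rp2 : 0 < r < r2 by rewrite rp.
have u0 := extreme_value_gt0 halpha sol eps0.
have HK : H <= u eps r / 2 + `|H|.
  by rewrite ler_wpDl ?ler_norm// divr_ge0// ltW.
have [ha hb] := upp eps r z m H eps0 rp2 sol HK.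
have tH := is_test_threshold halpha eps H sol.
have ne := alternatives_nonempty halpha sol.
set psi := threshold eps z m H in ha hb tH *.
have ha' : alpha_error xi eps psi <= level + e by move: ha; rewrite PH; lra.
have hb' : beta_error xi eps (alt r) psi <= Phi (H - u eps r) + e by exact: beta_error_le.
have lowpsi := low eps r z m psi eps0 rp1 sol tH.
have s01 : 0 <= 1 - s <= 1 by rewrite subr_ge0 s1/= gerBl ltW.
(* Shrinking psi by 1 - s brings its level below [level] exactly, at a cost of
   at most s in the type II error. *)
have ts := is_test_scale s01 tH.
have als : alpha_error xi eps (fun y => (1 - s) * psi y) <= level.
  rewrite /alpha_error expect_scale// -/(alpha_error xi eps psi).
  apply: (@le_trans _ _ ((1 - s) * (level + e))).
    by rewrite ler_wpM2l//; case/andP: s01.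
  have h : 0 <= s * e by rewrite mulr_ge0// ltW.
  by nra.
have bes : beta_error xi eps (alt r) (fun y => (1 - s) * psi y) <=
    Phi (H - u eps r) + delta.
  apply: beta_error_le => // eta Ath.
  have := hb eta Ath; rewrite !expect_compl// expect_scale//.
  have q1 := expect_le1 xi eps eta tH; have q0 := expect_ge0 xi eps eta tH.
  set q := expect _ _ _ _ in q0 q1 *.
  have : s * q <= s by rewrite ler_piMr// ltW.
  by nra.
split.
- by apply: (le_trans ha'); lra.
- rewrite ler_norml; apply/andP; split; last by lra.
  have /lowpsi : alpha_error xi eps psi <= level + d1 by lra.
  by lra.
have lb psi' : is_test psi' /\ alpha_error xi eps psi' <= level ->
    Phi (H - u eps r) - delta <= beta_error xi eps (alt r) psi'.
  by move=> [tp ap]; apply: (low eps r z m psi' eps0 rp1 sol tp); lra.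
rewrite ler_norml; apply/andP; split.
  rewrite lerBrDr addrC; apply: ge_inf_image => //.
  by exists (fun y => (1 - s) * psi y); split.
rewrite lerBlDr addrC; apply: le_trans bes.
exact: (inf_image_le (F := beta_error xi eps (alt r)) lb).
Qed.

(** At H = u / 2 the multiplier of [risk_lower] is exp 0 = 1 and the two Gaussian error
    probabilities coincide by symmetry. For u > 2 M the value 2 Phi (- u / 2) is below [delta], so
    the lower bound holds trivially. *)
Lemma total_risk (delta : R) : 0 < delta -> exists2 r0 : R, 0 < r0 &
  forall eps r z m, 0 < eps -> 0 < r < r0 -> solves r z m ->
  `|gamma_error xi eps (alt r) (threshold eps z m (u eps r / 2)) -
    2 * Phi (- u eps r / 2)| <= delta /\
  `|gamma_minimax xi a sigma eps r - 2 * Phi (- u eps r / 2)| <= delta.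
Proof.
move=> d0; have d2 : 0 < delta / 2 by rewrite divr_gt0.
have [M M0 HM] := Phi_far d2.
have C0 : 0 < 2 * M by rewrite mulr_gt0.
have [r1 r10 low] := risk_lower iid halpha hbeta M d0 C0.
have [r2 r20 upp] := risk_upper iid halpha hbeta 0 d2.
exists (Num.min r1 r2); first by rewrite lt_min r10.
move=> eps r z m eps0 /andP[rp]; rewrite lt_min => /andP[rr1 rr2] sol.
have rp1 : 0 < r < r1 by rewrite rp.
have rp2 : 0 < r < r2 by rewrite rp.
have u0 := extreme_value_gt0 halpha sol eps0.
have ne := alternatives_nonempty halpha sol.
have EN : Phi (- u eps r / 2) = 1 - Phi (u eps r / 2) by rewrite mulNr PhiN.
have EU : u eps r / 2 - u eps r = - u eps r / 2 by field.
have tH := is_test_threshold halpha eps (u eps r / 2) sol.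
have HK : u eps r / 2 <= u eps r / 2 + 0 by rewrite addr0.
have [ha hb] := upp eps r z m _ eps0 rp2 sol HK.
have up : gamma_error xi eps (alt r) (threshold eps z m (u eps r / 2)) <=
    2 * Phi (- u eps r / 2) + delta.
  have := beta_error_le ne hb; rewrite EU /gamma_error; lra.
have lb psi : is_test psi -> 2 * Phi (- u eps r / 2) - delta <=
    gamma_error xi eps (alt r) psi.
  move=> tpsi; have [uC|uC] := leP (u eps r) (2 * M); last first.
    apply: (@le_trans _ _ 0); last by rewrite addr_ge0 ?beta_error_ge0 ?expect_ge0.
    have : Phi (- u eps r / 2) <= delta / 2.
      by rewrite mulNr; apply: HM; rewrite ler_pdivlMr// mulrC ltW.
    by lra.
  have HM' : u eps r / 2 <= M by lra.
  have /= := low eps r z m _ psi eps0 rp1 sol uC HM' tpsi.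
  rewrite (_ : u eps r * _ - _ = 0); last by field.
  by rewrite expR0 !mul1r EU /gamma_error EN; lra.
split; rewrite ler_norml; apply/andP; split.
- by have := lb _ tH; lra.
- by lra.
- by rewrite lerBrDr addrC; apply: ge_inf_image => //; exists (threshold eps z m (u eps r / 2)).
- rewrite lerBlDr addrC; apply: le_trans up.
  exact: (inf_image_le (F := gamma_error xi eps (alt r)) lb).
Qed.

End minimax_risk.

(** * Small noise limits *)

Section small_noise.
Context {R : realType}.
Variables alpha beta : R.
Hypotheses (halpha : 0 < alpha) (hbeta : 0 < beta).
Implicit Types (eps z m H : R) (r : R -> R).

Notation a := (a_poly alpha).
Notation sigma := (sigma_poly beta).
Notation u := (extreme_value a sigma).
Notation threshold := (threshold_test alpha beta).
Notation solves := (solves_extreme_system alpha beta).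
Notation kappa := ((4 * alpha + 4 * beta + 1) / (2 * alpha)).

Lemma near_radius r (r0 : R) : radius_family r -> 0 < r0 ->
  \forall eps \near 0^'+, 0 < eps /\ 0 < r eps < r0.
Proof.
move=> [rpos rcvg] r00; near=> eps.
have e0 : 0 < eps by near: eps; exact: nbhs_right_gt.
split => //; rewrite rpos//=; near: eps.
exact: (cvgr_lt _ rcvg).
Unshelve. all: by end_near. Qed.

(** For facts about the radius alone: once r < 1 a solution exists and may serve in the argument. *)
Lemma near_solution r (r0 : R) (Q : R -> R -> Prop) : radius_family r -> 0 < r0 ->
  (forall eps rho z m, 0 < eps -> 0 < rho < r0 -> solves rho z m -> Q eps rho) ->
  \forall eps \near 0^'+, Q eps (r eps).
Proof.
move=> rr r00 H; have m0 : 0 < Num.min 1 r0 by rewrite lt_min ltr01.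
apply: filterS (near_radius rr m0) => eps [e0 /andP[rp]]; rewrite lt_min => /andP[r1 rr0].
have r01 : 0 < r eps < 1 by rewrite rp.
have [z [m sol]] := solution_exists halpha hbeta r01.
by apply: (H _ _ z m) => //; rewrite rp.
Qed.

(** For facts about the tests, which are built from a prescribed family of solutions. *)
Lemma near_given_solution r (z0 m0 : R -> R) (r0 : R) (Q : R -> R -> R -> R -> Prop) :
  radius_family r -> 0 < r0 ->
  (\forall eps \near 0^'+, solves (r eps) (z0 eps) (m0 eps)) ->
  (forall eps rho z m, 0 < eps -> 0 < rho < r0 -> solves rho z m -> Q eps rho z m) ->
  \forall eps \near 0^'+, Q eps (r eps) (z0 eps) (m0 eps).
Proof.
move=> rr r00 sol H; apply: filterS2 sol (near_radius rr r00) => eps s [e0 re].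
exact: H.
Qed.

Lemma near_solution_unique r : radius_family r ->
  \forall eps \near 0^'+, exists! zm : R * R, solves (r eps) zm.1 zm.2.
Proof.
move=> rr; apply: filterS (near_radius rr ltr01) => eps [_ r01].
have [z [m sol]] := solution_exists halpha hbeta r01.
exists (z, m); split => // -[z' m'] /= sol'.
exact: (solution_unique halpha r01 sol sol').
Qed.

Lemma cvg_dist_le (f g : R -> R) :
  (forall delta, 0 < delta -> \forall eps \near 0^'+, `|f eps - g eps| <= delta) ->
  f eps - g eps @[eps --> 0^'+] --> (0 : R).
Proof.
move=> H; apply/cvgrPdist_le => delta /H; apply: filterS => eps.
by rewrite sub0r normrN.
Qed.

Lemma cvg_dist0 (f g : R -> R) (l : R) : f eps - g eps @[eps --> 0^'+] --> (0 : R) ->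
  g eps @[eps --> 0^'+] --> l -> f eps @[eps --> 0^'+] --> l.
Proof.
move=> fg gl; have -> : f = fun eps => f eps - g eps + g eps.
  by apply/funext => eps; rewrite subrK.
by rewrite -[l]add0r; exact: cvgD.
Qed.

Lemma extreme_value_asymp : exists2 c1 : R, 0 < c1 &
  forall r, radius_family r ->
  u eps (r eps) / (c1 * eps ^- 2 * r eps `^ kappa) @[eps --> 0^'+] --> (1 : R).
Proof.
have [c1 c10 H] := min_pow4_asymp halpha hbeta.
exists c1 => // r rr; apply/cvgrPdist_le => e /H[r0 r00 Hr].
apply: (near_solution (Q := fun eps rho =>
  `|1 - u eps rho / (c1 * eps ^- 2 * rho `^ kappa)| <= e) rr r00) => eps rho z m e0 rp sol.
rewrite distrC (extreme_value_sqrt halpha sol e0).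
have := Hr rho z m rp sol; set S := _ / 2; congr (`|_ - 1| <= e).
have rk : 0 < rho `^ kappa by apply: powR_gt0; case/andP: rp.
by field; rewrite !gt_eqF.
Qed.

Definition separation_rate (eps : R) : R :=
  eps `^ (4 * alpha / (4 * alpha + 4 * beta + 1)).

Lemma separation_rate_radius : radius_family separation_rate.
Proof.
split; first by move=> eps e0; exact: powR_gt0.
apply: powR_cvg0; have := halpha; have := hbeta => hb ha.
by rewrite divr_gt0//; lra.
Qed.

(** The exponent of the rate is 2 / kappa, chosen so that its power -kappa is eps^-2. *)
Lemma separation_rateE (c1 eps rho : R) : 0 < eps -> 0 < rho ->
  c1 * eps ^- 2 * rho `^ kappa = c1 * (rho / separation_rate eps) `^ kappa.
Proof.
move=> e0 r0; rewrite powRM ?ltW ?invr_gt0 ?powR_gt0//.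
have -> : (separation_rate eps)^-1 = eps `^ (- (4 * alpha / (4 * alpha + 4 * beta + 1))).
  by rewrite powRN.
rewrite -[X in _ = c1 * (_ * X)]powRrM (_ : _ * kappa = -2); last first.
  have ha := halpha; have hb := hbeta.
  have h : 4 * alpha + 4 * beta + 1 != 0 by apply/lt0r_neq0; lra.
  by field; rewrite h gt_eqF.
rewrite powRN [eps `^ 2]powR_mulrn ?ltW//.
by ring.
Qed.

Lemma kappa_gt0 : 0 < kappa.
Proof. by have := halpha; have := hbeta => hb ha; rewrite divr_gt0//; lra. Qed.

Lemma extreme_value_below r : radius_family r ->
  r eps / separation_rate eps @[eps --> 0^'+] --> (0 : R) ->
  u eps (r eps) @[eps --> 0^'+] --> (0 : R).
Proof.
move=> rr rcvg; have [c1 c10 /(_ r rr) Hu] := extreme_value_asymp.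
apply/cvgrPdist_le => delta d0.
(* Eventually u <= 2 c1 (r / rate)^kappa, so this value of t yields u <= [delta]. *)
pose t := delta / (2 * c1); have t0 : 0 < t by rewrite divr_gt0// mulr_gt0.
near=> eps.
have e0 : 0 < eps by near: eps; exact: nbhs_right_gt.
have r0 : 0 < r eps by case: rr => h _; exact: h.
have s0 : 0 < separation_rate eps by exact: powR_gt0.
have x0 : 0 < r eps / separation_rate eps by rewrite divr_gt0.
have : u eps (r eps) / (c1 * eps ^- 2 * r eps `^ kappa) <= 2.
  by near: eps; apply: (cvgr_le _ Hu); lra.
have : r eps / separation_rate eps <= t `^ (kappa^-1).
  by near: eps; apply: (cvgr_le _ rcvg); exact: powR_gt0.
move=> /(le_powR (ltW kappa_gt0) (ltW x0)).
rewrite -powRrM mulVf ?gt_eqF ?kappa_gt0// powRr1 ?(ltW t0)// => h1.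
rewrite separation_rateE// ler_pdivrMr ?mulr_gt0 ?powR_gt0// => h2.
have u0 : 0 <= u eps (r eps) by exact: sqrtr_ge0.
rewrite sub0r normrN ger0_norm//; apply: (le_trans h2).
rewrite mulrA mulrC -ler_pdivlMr ?mulr_gt0//; exact: h1.
Unshelve. all: by end_near. Qed.

Lemma extreme_value_above r : radius_family r ->
  r eps / separation_rate eps @[eps --> 0^'+] --> +oo ->
  u eps (r eps) @[eps --> 0^'+] --> +oo.
Proof.
move=> rr rcvg; have [c1 c10 /(_ r rr) Hu] := extreme_value_asymp.
apply/cvgryPge => A.
(* Eventually u >= (c1 / 2) (r / rate)^kappa, so this t yields u >= A; the maximum with 1 keeps t
   positive when A is not. *)
pose t := 2 * Num.max 1 A / c1.
have m0 : 0 < Num.max 1 A by rewrite lt_max ltr01.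
have t0 : 0 < t by rewrite divr_gt0// mulr_gt0.
near=> eps.
have e0 : 0 < eps by near: eps; exact: nbhs_right_gt.
have r0 : 0 < r eps by case: rr => h _; exact: h.
have s0 : 0 < separation_rate eps by exact: powR_gt0.
have : 2^-1 <= u eps (r eps) / (c1 * eps ^- 2 * r eps `^ kappa).
  by near: eps; apply: (cvgr_ge _ Hu); lra.
have : t `^ (kappa^-1) <= r eps / separation_rate eps.
  by near: eps; move/cvgryPge : rcvg; apply.
move=> /(le_powR (ltW kappa_gt0) (powR_ge0 _ _)).
rewrite -powRrM mulVf ?gt_eqF ?kappa_gt0// powRr1 ?(ltW t0)// => h1.
rewrite separation_rateE// ler_pdivlMr ?mulr_gt0 ?powR_gt0 ?divr_gt0// => h2.
apply: le_trans h2; apply: (@le_trans _ _ (Num.max 1 A)); first by rewrite le_max lexx orbT.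
by move: h1; rewrite ler_pdivrMr//; lra.
Unshelve. all: by end_near. Qed.

Lemma Phi_cvg0 (f : R -> R) : f eps @[eps --> 0^'+] --> +oo ->
  Phi (- f eps) @[eps --> 0^'+] --> (0 : R).
Proof.
move=> /cvgryPge fy; apply/cvgrPdist_le => delta /Phi_far[M _ HM].
apply: filterS (fy M) => eps /HM h.
by rewrite sub0r normrN ger0_norm// Phi_ge0.
Qed.

Section model.
Context {d : measure_display} {T : measurableType d}.
Variables (P : probability T R) (xi : nat -> {RV P >-> R}).
Hypothesis iid : iid_standard_normal xi.

Lemma beta_minimax_sharp r (level H : R) : radius_family r -> 0 < level < 1 ->
  Phi H = 1 - level ->
  beta_minimax xi a sigma eps (r eps) level - Phi (H - u eps (r eps))
    @[eps --> 0^'+] --> (0 : R).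
Proof.
move=> rr l01 PH; apply: cvg_dist_le => delta d0.
have [r0 r00 Hr] := level_risk iid halpha hbeta d0 l01 PH.
apply: (near_solution (Q := fun eps rho =>
  `|beta_minimax xi a sigma eps rho level - Phi (H - u eps rho)| <= delta) rr r00).
by move=> eps rho z m e0 rp sol; have [] := Hr eps rho z m e0 rp sol.
Qed.

Lemma gamma_minimax_sharp r : radius_family r ->
  gamma_minimax xi a sigma eps (r eps) - 2 * Phi (- u eps (r eps) / 2)
    @[eps --> 0^'+] --> (0 : R).
Proof.
move=> rr; apply: cvg_dist_le => delta d0.
have [r0 r00 Hr] := total_risk iid halpha hbeta d0.
apply: (near_solution (Q := fun eps rho =>
  `|gamma_minimax xi a sigma eps rho - 2 * Phi (- u eps rho / 2)| <= delta) rr r00).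
by move=> eps rho z m e0 rp sol; have [] := Hr eps rho z m e0 rp sol.
Qed.

Lemma near_is_test r (z0 m0 : R -> R) (H : R -> R) : radius_family r ->
  (\forall eps \near 0^'+, solves (r eps) (z0 eps) (m0 eps)) ->
  \forall eps \near 0^'+, is_test (threshold eps (z0 eps) (m0 eps) (H eps)).
Proof. by move=> rr; apply: filterS => eps sol; exact: (is_test_threshold halpha _ _ sol). Qed.

Lemma threshold_minimax_level r (z0 m0 : R -> R) (level H : R) : radius_family r ->
  (\forall eps \near 0^'+, solves (r eps) (z0 eps) (m0 eps)) ->
  0 < level < 1 -> Phi H = 1 - level ->
  asymptotically_minimax_level xi a sigma r level
    (fun eps => threshold eps (z0 eps) (m0 eps) H).
Proof.
move=> rr sol l01 PH; split; first exact: (near_is_test _ rr sol).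
  move=> delta d0; have [r0 r00 Hr] := level_risk iid halpha hbeta d0 l01 PH.
  apply: (near_given_solution (Q := fun eps rho z m =>
    alpha_error xi eps (threshold eps z m H) <= level + delta) rr r00 sol).
  by move=> eps rho z m e0 rp s; have [] := Hr eps rho z m e0 rp s.
apply: cvg_dist_le => delta d0; have d2 : 0 < delta / 2 by rewrite divr_gt0.
have [r0 r00 Hr] := level_risk iid halpha hbeta d2 l01 PH.
apply: (near_given_solution (Q := fun eps rho z m =>
  `|beta_error xi eps (Theta2_r a sigma rho) (threshold eps z m H)
     - beta_minimax xi a sigma eps rho level| <= delta) rr r00 sol).
move=> eps rho z m e0 rp s; have [_ h1 h2] := Hr eps rho z m e0 rp s.
rewrite distrC in h2; apply: (le_trans (ler_distD (Phi (H - u eps rho)) _ _)).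
by rewrite [leRHS](splitr delta) lerD.
Qed.

Lemma threshold_minimax_total r (z0 m0 : R -> R) : radius_family r ->
  (\forall eps \near 0^'+, solves (r eps) (z0 eps) (m0 eps)) ->
  asymptotically_minimax_total xi a sigma r
    (fun eps => threshold eps (z0 eps) (m0 eps) (u eps (r eps) / 2)).
Proof.
move=> rr sol; split; first exact: (near_is_test _ rr sol).
apply: cvg_dist_le => delta d0; have d2 : 0 < delta / 2 by rewrite divr_gt0.
have [r0 r00 Hr] := total_risk iid halpha hbeta d2.
apply: (near_given_solution (Q := fun eps rho z m =>
  `|gamma_error xi eps (Theta2_r a sigma rho) (threshold eps z m (u eps rho / 2))
     - gamma_minimax xi a sigma eps rho| <= delta) rr r00 sol).
move=> eps rho z m e0 rp s; have [h1 h2] := Hr eps rho z m e0 rp s.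
rewrite distrC in h2; apply: (le_trans (ler_distD (2 * Phi (- u eps rho / 2)) _ _)).
by rewrite [leRHS](splitr delta) lerD.
Qed.

Lemma separation_rate_is_separation : is_separation_rate xi a sigma separation_rate.
Proof.
split; first exact: separation_rate_radius.
- move=> r rr /(extreme_value_below rr) u0; split.
    have Phi0 : 2 * Phi (0 : R) = 1.
      by have := PhiN (0 : R); rewrite oppr0; lra.
    have h : Phi (- u eps (r eps) / 2) @[eps --> 0^'+] --> Phi (0 : R).
      apply: continuous_cvg; first exact: continuous_Phi.
      have : - u eps (r eps) / 2 @[eps --> 0^'+] --> - (0 : R) / 2.
        by apply: cvgM; [exact: cvgN|exact: cvg_cst].
      by rewrite oppr0 mul0r.
    apply: (cvg_dist0 (gamma_minimax_sharp rr)).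
    have : 2 * Phi (- u eps (r eps) / 2) @[eps --> 0^'+] --> 2 * Phi (0 : R).
      by apply: cvgM; [exact: cvg_cst|exact: h].
    by rewrite Phi0.
  move=> level l01; have [H PH] : exists H : R, Phi H = 1 - level.
    by apply: quantile_exists; lra.
  have h : Phi (H - u eps (r eps)) @[eps --> 0^'+] --> Phi H.
    apply: continuous_cvg; first exact: continuous_Phi.
    have : H - u eps (r eps) @[eps --> 0^'+] --> H - 0.
      by apply: cvgB; [exact: cvg_cst|exact: u0].
    by rewrite subr0.
  by rewrite -PH; exact: cvg_dist0 (beta_minimax_sharp rr l01 PH) h.
- move=> r rr /(extreme_value_above rr) uy; split.
    have h : Phi (- u eps (r eps) / 2) @[eps --> 0^'+] --> (0 : R).
      under eq_fun do rewrite mulNr; apply: Phi_cvg0.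
      apply/cvgryPge => A; move/cvgryPge : uy => /(_ (A * 2)); apply: filterS => eps.
      by rewrite ler_pdivlMr.
    apply: (cvg_dist0 (gamma_minimax_sharp rr)).
    have : 2 * Phi (- u eps (r eps) / 2) @[eps --> 0^'+] --> 2 * (0 : R).
      by apply: cvgM; [exact: cvg_cst|exact: h].
    by rewrite mulr0.
  move=> level l01; have [H PH] : exists H : R, Phi H = 1 - level.
    by apply: quantile_exists; lra.
  have h : Phi (H - u eps (r eps)) @[eps --> 0^'+] --> (0 : R).
    under eq_fun do rewrite -opprB; apply: Phi_cvg0.
    apply/cvgryPge => A; move/cvgryPge : uy => /(_ (A + H)); apply: filterS => eps.
    by rewrite lerBrDr.
  exact: cvg_dist0 (beta_minimax_sharp rr l01 PH) h.
Qed.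

End model.

End small_noise.


Theorem theorem4p2 (R : realType) (alpha beta : R)
    (halpha : 0 < alpha) (hbeta : 0 < beta) :
  let a := a_poly alpha in
  let sigma := sigma_poly beta in
  let u := extreme_value a sigma in
  exists2 c1 : R, 0 < c1 &
  forall (d : measure_display) (T : measurableType d) (P : probability T R)
    (xi : nat -> {RV P >-> R}), iid_standard_normal xi ->
  [/\ forall r : R -> R, radius_family r ->
      [/\ forall level H : R, 0 < level < 1 -> Phi H = 1 - level ->
            beta_minimax xi a sigma eps (r eps) level
              - Phi (H - u eps (r eps)) @[eps --> 0^'+] --> (0 : R),
          gamma_minimax xi a sigma eps (r eps)
            - 2 * Phi (- u eps (r eps) / 2) @[eps --> 0^'+] --> (0 : R)
        & u eps (r eps) /
            (c1 * eps ^- 2 *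
              r eps `^ ((4 * alpha + 4 * beta + 1) / (2 * alpha)))
            @[eps --> 0^'+] --> (1 : R)],
      forall r : R -> R, radius_family r ->
      (\forall eps \near 0^'+,
         exists! zm : R * R, solves_extreme_system alpha beta (r eps) zm.1 zm.2)
      /\
      (forall z0 m : R -> R,
        (\forall eps \near 0^'+,
           solves_extreme_system alpha beta (r eps) (z0 eps) (m eps)) ->
        [/\ \forall eps \near 0^'+, forall eta : R^nat,
              is_extreme_sequence a sigma (r eps) eta <->
              (forall k, (eta k) ^+ 2 =
                         eta_tilde2 alpha beta (z0 eps) (m eps) k),
            forall level H : R, 0 < level < 1 -> Phi H = 1 - level ->
              asymptotically_minimax_level xi a sigma r level
                (fun eps => threshold_test alpha beta eps (z0 eps) (m eps) H)
          & asymptotically_minimax_total xi a sigma r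
              (fun eps => threshold_test alpha beta eps (z0 eps) (m eps)
                            (u eps (r eps) / 2))])
    & is_separation_rate xi a sigma
        (fun eps => eps `^ (4 * alpha / (4 * alpha + 4 * beta + 1)))].
Proof.
(* The constant is fixed before the probability space: u comes from a deterministic problem
   depending only on [alpha], [beta], eps and r. *)
move=> a sigma u; have [c1 c10 Hu] := extreme_value_asymp halpha hbeta.
exists c1 => // d T P xi iid; split; last exact: separation_rate_is_separation.
- move=> r rr; split; [|exact: gamma_minimax_sharp|exact: Hu].
  by move=> level H l01 PH; exact: beta_minimax_sharp.
- move=> r rr; split; first exact: near_solution_unique.
  move=> z0 m sol; split.
  + by apply: filterS sol => eps sol eta; exact: extreme_sequenceP.
  + by move=> level H l01 PH; exact: threshold_minimax_level.
  + exact: threshold_minimax_total.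
Qed.
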